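(* Let $d,d_1\ge 1$, let $\Sigma=(\sigma^{ij})_{1\le i\le d,\,1\le j\le d_1}$ have Borel measurable entries on $\mathbb{R}^d$, let $b=(b^i)_{1\le i\le d}$ be a Borel vector field on $\mathbb{R}^d$, and set $A=\Sigma\Sigma^t$. Suppose that either $q(x,y)>0$ for all $x\neq y$, or $q(x,y)<0$ for all $x\neq y$. Then there exists at most one probability solution $\mu$ to the equation $L^*\mu=0$ satisfying $$\int_{\mathbb{R}^d}\bigl(\|\Sigma(x)\|^2+|b(x)|\,|x|\bigr)\,\mu(dx)<\infty.$$
   Context: For a symmetric nonnegative definite matrix $A(x)=(a^{ij}(x))$ and a vector field $b(x)=(b^i(x))$ with Borel measurable entries, $Lf(x)=\mathrm{trace}(A(x)D^2f(x))+\langle b(x),\nabla f(x)\rangle$. A probability solution to $L^*\mu=0$ is a Borel probability measure $\mu$ on $\mathbb{R}^d$ such that all $a^{ij}$ and $b^i$ are $\mu$-integrable on every compact set and $\int_{\mathbb{R}^d}Lf\,d\mu=0$ for every $f\in C_0^\infty(\mathbb{R}^d)$. Here $A(x)=\Sigma(x)\Sigma(x)^t$ with $\Sigma(x)$ a $d\times d_1$ matrix, and $$q(x,y)=\langle x-y,b(x)-b(y)\rangle+\mathrm{trace}\bigl((\Sigma(x)-\Sigma(y))(\Sigma(x)-\Sigma(y))^t\bigr).$$ $\|\cdot\|$ denotes a matrix norm, $|\cdot|$ the Euclidean norm. *)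

(* Defs.v *)
From HB Require Import structures.
From mathcomp Require Import all_boot all_order all_algebra.
From mathcomp Require Import all_classical all_reals all_analysis.
Set Implicit Arguments. Unset Strict Implicit. Unset Printing Implicit Defensive.
Import Order.TTheory GRing.Theory Num.Theory.
Import numFieldNormedType.Exports.
Local Open Scope classical_set_scope.
Local Open Scope ring_scope.

Definition Rd (R : realType) (d : nat) := g_sigma_algebraType (@open 'rV[R]_d).

Definition evec (R : realType) (d : nat) (i : 'I_d) : 'rV[R]_d :=
  \row_(j < d) (i == j)%:R.

Definition pder (R : realType) (d : nat) (i : 'I_d) (f : 'rV[R]_d -> R)
  : 'rV[R]_d -> R := fun x => ('D_(evec R i) f) x.

Definition pders (R : realType) (d : nat) (s : seq 'I_d) (f : 'rV[R]_d -> R)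
  : 'rV[R]_d -> R := foldr (@pder R d) f s.

Definition smooth (R : realType) (d : nat) (f : 'rV[R]_d -> R) : Prop :=
  forall (s : seq 'I_d) (x : 'rV[R]_d), differentiable (pders s f) x.

Definition compact_support (R : realType) (d : nat) (f : 'rV[R]_d -> R) : Prop :=
  compact (closure [set x | f x != 0]).

Definition test_fun (R : realType) (d : nat) (f : 'rV[R]_d -> R) : Prop :=
  smooth f /\ compact_support f.

Definition diffA (R : realType) (d d1 : nat) (Sigma : 'rV[R]_d -> 'M[R]_(d, d1))
  (x : 'rV[R]_d) : 'M[R]_d := Sigma x *m (Sigma x)^T.

Definition Lop (R : realType) (d d1 : nat) (Sigma : 'rV[R]_d -> 'M[R]_(d, d1))
  (b : 'rV[R]_d -> 'rV[R]_d) (f : 'rV[R]_d -> R) (x : 'rV[R]_d) : R :=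
  \sum_(i < d) \sum_(j < d) diffA Sigma x i j * pder i (pder j f) x
  + \sum_(i < d) b x 0 i * pder i f x.

Definition dotv (R : realType) (d : nat) (u v : 'rV[R]_d) : R :=
  \sum_(i < d) u 0 i * v 0 i.
Definition enorm (R : realType) (d : nat) (u : 'rV[R]_d) : R := Num.sqrt (dotv u u).

Definition frob (R : realType) (m n : nat) (M : 'M[R]_(m, n)) : R :=
  Num.sqrt (\sum_(i < m) \sum_(j < n) M i j ^+ 2).

Definition qfun (R : realType) (d d1 : nat) (Sigma : 'rV[R]_d -> 'M[R]_(d, d1))
  (b : 'rV[R]_d -> 'rV[R]_d) (x y : 'rV[R]_d) : R :=
  dotv (x - y) (b x - b y)
  + \tr ((Sigma x - Sigma y) *m (Sigma x - Sigma y)^T).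

Definition prob_solution (R : realType) (d d1 : nat)
  (Sigma : 'rV[R]_d -> 'M[R]_(d, d1)) (b : 'rV[R]_d -> 'rV[R]_d)
  (mu : probability (Rd R d) R) : Prop :=
  (forall K : set 'rV[R]_d, compact K ->
     (forall i j, mu.-integrable (K : set (Rd R d))
                    (fun x : Rd R d => (diffA Sigma x i j)%:E)) /\
     (forall i, mu.-integrable (K : set (Rd R d))
                    (fun x : Rd R d => (b x 0 i)%:E))) /\
  (forall f : 'rV[R]_d -> R, test_fun f ->
     (\int[mu]_(x in [set: Rd R d]) (Lop Sigma b f x)%:E = 0)%E).

(* Main.v *)
(* Write k0(x) = 1 / (1 + |x|^2 / 2).

   If q > 0 off the diagonal, testing the equation with truncations of x_i and |x|^2
   gives that b and |Sigma|^2 + <b, x> have mean zero under a solution mu. Expanding q,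
   its truncated integral against mu x mu is then at most a vanishing error, so mu x mu
   lives on the diagonal and mu is a point mass at a common zero p of b and Sigma. Two
   such points satisfy q(p, p') = 0, hence coincide.

   If q < 0 off the diagonal, two solutions are compared through near-couplings. First
   each solution is smoothed: x is replaced by xi = x + del Z, with Z an independent
   random vector that allows integration by parts. On the product of two smoothed spaces
   take the density P = U(xi) K(xi - eta) V(eta), where K = k0^m and U, V solve the
   regularized Schroedinger system U = 1 / (kap + K V), V = 1 / (kap + K^T U); the
   marginals of P have densities 1 - kap U and 1 - kap V. The logarithmic gradient of P
   is a sum of U- and V-parts and of m times the gradient of ln k0. Testing the first
   equation with U K and ln U, the second with V K and ln V, and evaluating the mixed
   second order term by integration by parts in both variables, the positivity of a sum
   of squares shows that the P-integral of k0(xi - eta) q is at least -C / m. With m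
   large, kap small and finally del small, the near-couplings P satisfy
   \int P Q -> 0 for Q(x, y) = - k0(x - y) q(x, y), which is positive off the diagonal.
   For a Borel set A, Lusin's theorem gives compact sets K1 in A and K2 in its complement,
   of nearly full measure, on which the coefficients are continuous; Q is bounded below on
   K1 x K2, so P moves almost no mass from A to its complement, and mu1 A <= mu2 A. *)

Require Import Defs.
From HB Require Import structures.
From mathcomp Require Import all_boot all_order all_algebra.
From mathcomp Require Import all_classical all_reals all_analysis.
From mathcomp Require Import measurable_realfun ring lra.
Set Implicit Arguments. Unset Strict Implicit. Unset Printing Implicit Defensive.
Import Order.TTheory GRing.Theory Num.Theory.
Import numFieldNormedType.Exports.
Local Open Scope classical_set_scope.
Local Open Scope ring_scope.

(** * Functions with bounded derivatives of all orders *)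

(** A solution may be singular and the coefficients are only Borel, so integration by parts under
    [mu] itself is impossible. The smoothing displaces the point alone and keeps the coefficients of
    the undisplaced point: the equation survives, because it may be tested with translates of a test
    function, and no derivative ever falls on [Sigma] or [b]. The kernel [k0] is chosen because
    [k0], [x k0] and all their derivatives are bounded, so that integrability of [|Sigma|^2] and [b]
    suffices, and because minus the Hessian of [ln k0] is [k0 I] minus a rank one square: contracted
    with differences of the columns of [Sigma] it is at most the trace part of [k0 q], while the
    gradient gives exactly the drift part. The integration by parts constants grow like [del^-2],
    but the form to be estimated carries the factor [m], which can outgrow them. The parameter [kap]
    keeps [U] and [V] between positive constants, so that [ln U] and [ln V] have bounded
    derivatives; its cost, the missing mass [kap U], enters the integral of [L ln U] with the
    favourable sign. *)

Definition lin (R : realType) (d : nat) (g : 'I_d -> 'rV[R]_d -> R) (x h : 'rV[R]_d) : R :=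
  \sum_(i < d) h 0 i * g i x.

(* A quadratic Taylor bound that is uniform in the base point: unlike differentiability,
   it passes to convolutions by a plain integration of the inequality. *)
Definition qrem (R : realType) (d : nat) (f : 'rV[R]_d -> R)
    (g : 'I_d -> 'rV[R]_d -> R) :=
  exists C : R, forall x h : 'rV[R]_d, `|f (x + h) - f x - lin g x h| <= C * `|h| ^+ 2.

Definition bnd (R : realType) (T : Type) (f : T -> R) := exists C : R, forall x, `|f x| <= C.

(** The derivatives are existentially quantified instead of being [pder i f]: the closure properties
    can then exhibit them by explicit formulas, and [qrem_pder] identifies them with the partial
    derivatives afterwards. *)
Fixpoint BI (R : realType) (d : nat) (n : nat) (f : 'rV[R]_d -> R) : Prop :=
  match n with
  | 0 => bnd f
  | n.+1 => bnd f /\ exists2 g, qrem f g & forall i, BI n (g i)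
  end.

Section bounded_functions.
Variables (R : realType) (T : Type).
Implicit Types f g : T -> R.

Lemma bnd_gt0 f : bnd f -> exists2 C : R, 0 < C & forall x, `|f x| <= C.
Proof.
case=> C hC; exists (`|C| + 1); first by rewrite ltr_wpDl.
by move=> x; rewrite (le_trans (hC x))// (le_trans (ler_norm _))// lerDl.
Qed.

Lemma bnd_cst (c : R) : @bnd R T (fun=> c).
Proof. by exists `|c|. Qed.

Lemma bndD f g : bnd f -> bnd g -> bnd (fun x => f x + g x).
Proof.
move=> [C hC] [D hD]; exists (C + D) => x.
by rewrite (le_trans (ler_normD _ _))// lerD.
Qed.

Lemma bndM f g : bnd f -> bnd g -> bnd (fun x => f x * g x).
Proof.
move=> [C hC] [D hD]; exists (C * D) => x.
by rewrite normrM ler_pM.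
Qed.

Lemma bndZ c f : bnd f -> bnd (fun x => c * f x).
Proof. by move=> bf; apply: bndM => //; exact: bnd_cst. Qed.

Lemma bndN f : bnd f -> bnd (fun x => - f x).
Proof. by move=> [C hC]; exists C => x; rewrite normrN. Qed.

Lemma bndV (c : R) f : 0 < c -> (forall x, c <= f x) -> bnd (fun x => (f x)^-1).
Proof.
move=> c0 cf; exists c^-1 => x.
rewrite ger0_norm ?invr_ge0 ?(le_trans (ltW c0))//.
by rewrite lef_pV2 ?posrE// (lt_le_trans c0).
Qed.

End bounded_functions.

Section BIcalc.
Variables (R : realType) (d : nat).
Implicit Types (f : 'rV[R]_d -> R) (g : 'I_d -> 'rV[R]_d -> R).

Lemma coord_le (h : 'rV[R]_d) i : `|h 0 i| <= `|h|.
Proof.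
rewrite [leRHS]/Num.Def.normr /= mx_normrE.
exact: (le_bigmax _ (fun x : 'I_1 * 'I_d => `|h x.1 x.2|) (ord0, i)).
Qed.

Lemma lin_le g : (forall i, bnd (g i)) ->
  exists2 G : R, 0 <= G & forall x h : 'rV[R]_d, `|lin g x h| <= G * `|h|.
Proof.
move=> bg; pose C i := xget 0 [set C | forall x, `|g i x| <= C].
have hC i x : `|g i x| <= C i.
  by rewrite /C; case: xgetP => [c -> hc //|]; have [c hc] := bg i => /(_ c).
exists (\sum_i C i).
  by apply: sumr_ge0 => i _; exact: le_trans (hC i 0).
move=> x h; rewrite (le_trans (ler_norm_sum _ _ _))// mulr_suml.
by apply: ler_sum => i _; rewrite normrM mulrC ler_pM// coord_le.
Qed.

Lemma qremP f g : qrem f g ->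
  exists2 C : R, 0 <= C & forall x h : 'rV[R]_d, `|f (x + h) - f x - lin g x h| <= C * `|h| ^+ 2.
Proof.
case=> C hC; exists `|C| => // x h.
by rewrite (le_trans (hC x h))// ler_wpM2r ?exprn_ge0// ler_norm.
Qed.

(** For [|h| <= 1] the quadratic remainder is at most a multiple of [|h|]; for [|h| > 1] the bound
    on [f] is already at most a multiple of [|h|]. *)
Lemma qrem_lip f g : bnd f -> (forall i, bnd (g i)) -> qrem f g ->
  exists2 L : R, 0 <= L & forall x h : 'rV[R]_d, `|f (x + h) - f x| <= L * `|h|.
Proof.
move=> [B hB] /lin_le[G G0 hG] /qremP[C C0 hC].
have B0 : 0 <= B by exact: le_trans (hB 0).
exists (G + C + 2 * B); first by rewrite !addr_ge0// mulr_ge0.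
move=> x h; have [h1|h1] := leP `|h| 1.
  rewrite -[f _ - _](subrK (lin g x h)) (le_trans (ler_normD _ _))//.
  rewrite (le_trans (lerD (hC _ _) (hG _ _)))//.
  have hh : `|h| ^+ 2 <= `|h| by rewrite expr2 ler_piMl.
  have := ler_wpM2l C0 hh; have := mulr_ge0 B0 (normr_ge0 h); nra.
rewrite (le_trans (ler_normB _ _))// (le_trans (lerD (hB _) (hB _)))//.
have := mulr_ge0 G0 (normr_ge0 h); have := mulr_ge0 C0 (normr_ge0 h); nra.
Qed.

Lemma BI_bnd n f : BI n f -> bnd f.
Proof. by case: n => [//|n] []. Qed.

Lemma BI_S n f : BI n.+1 f ->
  bnd f /\ exists2 g, qrem f g & forall i, BI n (g i).
Proof. by []. Qed.

Lemma BI_pred n f : BI n.+1 f -> BI n f.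
Proof.
elim: n f => [f []//|n IH f /BI_S[bf [g qg Bg]]].
by split => //; exists g => // i; apply: IH.
Qed.

Lemma BI_cst n (c : R) : @BI R d n (fun=> c).
Proof.
elim: n c => [c|n IH c]; first exact: bnd_cst.
split; first exact: bnd_cst.
exists (fun _ _ => 0) => //; exists 0 => x h.
by rewrite /lin subrr big1 ?subrr ?normr0 ?mul0r// => i _; rewrite mulr0.
Qed.

Lemma qremD f f' g g' : qrem f g -> qrem f' g' ->
  qrem (fun x => f x + f' x) (fun i x => g i x + g' i x).
Proof.
move=> [C hC] [C' hC']; exists (C + C') => x h.
have -> : lin (fun i x => g i x + g' i x) x h = lin g x h + lin g' x h.
  by rewrite /lin -big_split/=; apply: eq_bigr => i _; rewrite mulrDr.
rewrite mulrDl (le_trans _ (lerD (hC x h) (hC' x h)))//.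
by rewrite (le_trans _ (ler_normD _ _))// le_eqVlt; apply/orP; left; apply/eqP; congr `|_|; ring.
Qed.

Lemma BID n f f' : BI n f -> BI n f' -> BI n (fun x => f x + f' x).
Proof.
elim: n f f' => [f f'|n IH f f' /BI_S[bf [g qg Bg]] /BI_S[bf' [g' qg' Bg']]].
  exact: bndD.
split; first exact: bndD.
by exists (fun i x => g i x + g' i x); [exact: qremD|move=> i; apply: IH].
Qed.

(** The increment of a product minus its linear part consists of the two remainders and of the
    product of the two increments; the last is quadratic by [qrem_lip]. *)
Lemma qremM f f' g g' : bnd f -> bnd f' ->
  (forall i, bnd (g i)) -> (forall i, bnd (g' i)) -> qrem f g -> qrem f' g' ->
  qrem (fun x => f x * f' x) (fun i x => g i x * f' x + f x * g' i x).
Proof.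
move=> bf bf' bg bg' qg qg'.
have [L L0 hL] := qrem_lip bf bg qg; have [L' L'0 hL'] := qrem_lip bf' bg' qg'.
have [C C0 hC] := qremP qg; have [C' C'0 hC'] := qremP qg'.
have [B B0 hB] := bnd_gt0 bf; have [B' B'0 hB'] := bnd_gt0 bf'.
exists (C * B' + B * C' + L * L') => x h.
have -> : lin (fun i x => g i x * f' x + f x * g' i x) x h =
    lin g x h * f' x + f x * lin g' x h.
  rewrite /lin mulr_suml mulr_sumr -big_split/=.
  by apply: eq_bigr => i _; ring.
have -> : f (x + h) * f' (x + h) - f x * f' x - (lin g x h * f' x + f x * lin g' x h) =
   (f (x + h) - f x - lin g x h) * f' x + f x * (f' (x + h) - f' x - lin g' x h) +
   (f (x + h) - f x) * (f' (x + h) - f' x) by ring.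
rewrite (le_trans (ler_normD _ _))// [leRHS]mulrDl lerD//.
  rewrite (le_trans (ler_normD _ _))// [leRHS]mulrDl lerD//.
    by rewrite normrM [leRHS]mulrAC ler_pM.
  by rewrite normrM -mulrA ler_pM.
by rewrite normrM expr2 mulrACA ler_pM.
Qed.

Lemma BIM n f f' : BI n f -> BI n f' -> BI n (fun x => f x * f' x).
Proof.
elim: n f f' => [f f'|n IH f f' Bf Bf']; first exact: bndM.
have [Pf Pf'] := (BI_pred Bf, BI_pred Bf').
have [bf [g qg Bg]] := BI_S Bf; have [bf' [g' qg' Bg']] := BI_S Bf'.
split; first exact: bndM.
exists (fun i x => g i x * f' x + f x * g' i x).
  by apply: qremM => // i; [exact: BI_bnd (Bg i)|exact: BI_bnd (Bg' i)].
by move=> i; apply: BID; apply: IH.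
Qed.

Lemma BIZ n c f : BI n f -> BI n (fun x => c * f x).
Proof. by move=> Bf; apply: BIM => //; exact: BI_cst. Qed.

Lemma BIN n f : BI n f -> BI n (fun x => - f x).
Proof.
move=> /(BIZ (-1)); congr BI; apply/funext => x; exact: mulN1r.
Qed.

Lemma BI_sum n (I : Type) (s : seq I) (F : I -> 'rV[R]_d -> R) :
  (forall i, BI n (F i)) -> BI n (fun x => \sum_(i <- s) F i x).
Proof.
move=> BF; elim: s => [|i s IH].
  rewrite (_ : (fun x => _) = (fun=> 0)); first exact: BI_cst.
  by apply/funext => x; rewrite big_nil.
rewrite (_ : (fun x => _) = (fun x => F i x + \sum_(j <- s) F j x)).
  exact: BID.
by apply/funext => x; rewrite big_cons.
Qed.

Lemma BIX n f m : BI n f -> BI n (fun x => f x ^+ m).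
Proof.
move=> Bf; elim: m => [|m IH].
  by rewrite (_ : (fun x => _) = (fun=> 1)); [exact: BI_cst|apply/funext => x].
rewrite (_ : (fun x => _) = (fun x => f x * f x ^+ m)); first exact: BIM.
by apply/funext => x; rewrite exprS.
Qed.

Lemma linZ g (u : 'rV[R]_d -> R) x h :
  lin (fun i x => u x * g i x) x h = u x * lin g x h.
Proof. by rewrite /lin mulr_sumr; apply: eq_bigr => i _; ring. Qed.

Lemma qremV (c : R) f g : 0 < c -> (forall x, c <= f x) -> bnd f ->
  (forall i, bnd (g i)) -> qrem f g ->
  qrem (fun x => (f x)^-1) (fun i x => - ((f x)^-1 * (f x)^-1) * g i x).
Proof.
move=> c0 cf bf bg qg.
have [L L0 hL] := qrem_lip bf bg qg; have [G G0 hG] := lin_le bg.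
have [C C0 hC] := qremP qg; have [B B0 hB] := bnd_gt0 bf.
exists ((C * B + G * L) * (c ^- 3)) => x h.
rewrite linZ.
have fx := lt_le_trans c0 (cf x); have fxh := lt_le_trans c0 (cf (x + h)).
have -> : (f (x + h))^-1 - (f x)^-1 - - ((f x)^-1 * (f x)^-1) * lin g x h =
  (- ((f (x + h) - f x - lin g x h) * f x) + lin g x h * (f (x + h) - f x)) *
  ((f x * f x * f (x + h))^-1).
  by field; rewrite !lt0r_neq0.
rewrite normrM [leRHS]mulrAC ler_pM//.
  rewrite (le_trans (ler_normD _ _))// [leRHS]mulrDl lerD//.
    by rewrite normrN normrM [leRHS]mulrAC ler_pM.
  by rewrite normrM expr2 mulrACA ler_pM.
rewrite ger0_norm; last by rewrite invr_ge0 !mulr_ge0// ltW.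
rewrite lef_pV2 ?posrE ?mulr_gt0 ?exprn_gt0//.
rewrite !exprS expr0 mulr1 mulrA; apply: ler_pM => //; last exact: ler_pM (ltW c0) (ltW c0) _ _.
  by rewrite mulr_ge0// ltW.
exact: ltW.
Qed.

Lemma BIV n (c : R) f : 0 < c -> (forall x, c <= f x) -> BI n f ->
  BI n (fun x => (f x)^-1).
Proof.
move=> c0 cf; elim: n f cf => [f cf bf|n IH f cf Bf]; first exact: (bndV c0).
have Pf := BI_pred Bf; have [bf [g qg Bg]] := BI_S Bf.
split; first exact: (bndV c0).
exists (fun i x => - ((f x)^-1 * (f x)^-1) * g i x).
  by apply: qremV c0 _ _ _ qg => // i; exact: BI_bnd (Bg i).
by move=> i; apply: BIM => //; apply: BIN; apply: BIM; exact: IH.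
Qed.

(** Both one-sided bounds are [ln t <= t - 1], at [t = b / a] and at [t = a / b]; the right-hand
    side is exactly the sum of the two resulting upper bounds. *)
Lemma ln_rem (a b : R) : 0 < a -> 0 < b ->
  `|ln b - ln a - (b - a) / a| <= (b - a) ^+ 2 / (a * b).
Proof.
move=> a0 b0.
have ln_le (t : R) : 0 < t -> ln t <= t - 1.
  by move=> t0; have := @le_ln1Dx R (t - 1); rewrite addrCA subrr addr0; apply; lra.
have h1 : ln b - ln a <= (b - a) / a.
  rewrite -ln_div ?posrE// (le_trans (ln_le _ _))// ?divr_gt0//.
  by rewrite le_eqVlt; apply/orP; left; apply/eqP; field; rewrite lt0r_neq0.
have h2 : ln a - ln b <= (a - b) / b.
  rewrite -ln_div ?posrE// (le_trans (ln_le _ _))// ?divr_gt0//.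
  by rewrite le_eqVlt; apply/orP; left; apply/eqP; field; rewrite lt0r_neq0.
have h3 : (b - a) ^+ 2 / (a * b) = (b - a) / a + (a - b) / b.
  by field; rewrite !lt0r_neq0.
rewrite ler0_norm; lra.
Qed.

Lemma qrem_ln (c : R) f g : 0 < c -> (forall x, c <= f x) -> bnd f ->
  (forall i, bnd (g i)) -> qrem f g ->
  qrem (fun x => ln (f x)) (fun i x => (f x)^-1 * g i x).
Proof.
move=> c0 cf bf bg qg.
have [L L0 hL] := qrem_lip bf bg qg.
have [C C0 hC] := qremP qg.
exists (L * L * c ^- 2 + C * c^-1) => x h.
rewrite linZ.
have fx := lt_le_trans c0 (cf x); have fxh := lt_le_trans c0 (cf (x + h)).
have -> : ln (f (x + h)) - ln (f x) - (f x)^-1 * lin g x h =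
  (ln (f (x + h)) - ln (f x) - (f (x + h) - f x) / f x) +
  (f (x + h) - f x - lin g x h) / f x by ring.
rewrite (le_trans (ler_normD _ _))// [leRHS]mulrDl lerD//.
  rewrite (le_trans (ln_rem _ _))// [leRHS]mulrAC ler_pM//.
  - by rewrite exprn_even_ge0.
  - by rewrite invr_ge0 mulr_ge0 ?ltW.
  - by rewrite -real_normK ?num_real// !expr2 mulrACA ler_pM.
  rewrite lef_pV2 ?posrE ?mulr_gt0 ?exprn_gt0//.
  by rewrite expr2; apply: ler_pM (ltW c0) (ltW c0) _ _.
rewrite normrM [leRHS]mulrAC ler_pM// ger0_norm; last by rewrite invr_ge0 ltW.
by rewrite lef_pV2 ?posrE.
Qed.

Lemma BI_ln n (c : R) f : 0 < c -> (forall x, c <= f x) -> BI n f ->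
  BI n (fun x => ln (f x)).
Proof.
move=> c0 cf Bf.
have bln : bnd (fun x => ln (f x)).
  have [B B0 hB] := bnd_gt0 (BI_bnd Bf).
  exists (`|ln c| + `|ln B|) => x.
  have fx := lt_le_trans c0 (cf x).
  have h1 : ln c <= ln (f x) by rewrite ler_ln ?posrE.
  have h2 : ln (f x) <= ln B by rewrite ler_ln ?posrE// (le_trans (ler_norm _)).
  by rewrite ler_norml; have := ler_norm (ln B); have := ler_norm (- ln c);
    rewrite normrN => ? ?; have := normr_ge0 (ln B); have := normr_ge0 (ln c); lra.
case: n Bf => [//|n Bf]; have Pf := BI_pred Bf; have [bf [g qg Bg]] := BI_S Bf.
split => //; exists (fun i x => (f x)^-1 * g i x).
  by apply: qrem_ln c0 _ _ _ qg => // i; exact: BI_bnd (Bg i).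
by move=> i; apply: BIM => //; exact: (BIV c0).
Qed.

Lemma qrem_affine f g (a : 'rV[R]_d) (s : R) : qrem f g ->
  qrem (fun x => f (a + s *: x)) (fun i x => s * g i (a + s *: x)).
Proof.
move=> [C hC]; exists (C * `|s| ^+ 2) => x h.
have -> : lin (fun i x => s * g i (a + s *: x)) x h = lin g (a + s *: x) (s *: h).
  by rewrite /lin; apply: eq_bigr => i _; rewrite mxE; ring.
by rewrite scalerDr addrA (le_trans (hC _ _))// normrZ exprMn mulrA.
Qed.

Lemma BI_affine n f (a : 'rV[R]_d) (s : R) : BI n f -> BI n (fun x => f (a + s *: x)).
Proof.
elim: n f => [f [C hC]|n IH f /BI_S[[C hC] [g qg Bg]]]; first by exists C.
split; first by exists C.
exists (fun i x => s * g i (a + s *: x)); first exact: qrem_affine.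
by move=> i; apply: BIZ; apply: IH.
Qed.

End BIcalc.

Section BI_differentiable.
Variables (R : realType) (d : nat).
Implicit Types (f : 'rV[R]_d -> R) (g : 'I_d -> 'rV[R]_d -> R).

Lemma lin_linear g x : linear (lin g x : 'rV[R]_d -> R).
Proof.
move=> k u v; rewrite /lin scaler_sumr -big_split/=; apply: eq_bigr => i _.
by rewrite !mxE mulrDl -mulrA.
Qed.

Lemma lin_continuous g x : continuous (lin g x : 'rV[R]_d -> R).
Proof.
rewrite /lin; apply: continuous_big => [|i _ u]; first exact: add_continuous.
by apply: (@cvgM R 'rV[R]_d (nbhs u)); [exact: (@coord_continuous R 1 d 0 i u)|exact: cvg_cst].
Qed.

Lemma evec_coord (i j : 'I_d) : evec R i 0 j = (i == j)%:R.
Proof. by rewrite mxE. Qed.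

Lemma lin_evec g x i : lin g x (evec R i) = g i x.
Proof.
rewrite /lin (bigD1 i)//= evec_coord eqxx mul1r big1 ?addr0// => j ji.
by rewrite evec_coord eq_sym (negbTE ji) mul0r.
Qed.

Lemma qrem_littleo f g x : qrem f g ->
  f \o shift x = cst (f x) + (lin g x : 'rV[R]_d -> R) +o_ (0 : 'rV[R]_d) id.
Proof.
move=> /qremP[C C0 hC]; apply/eqaddoP => _/posnumP[e]; near=> h.
rewrite /= -!fctE/= !fctE.
have -> : f (h + x) - (f x + lin g x h) = f (x + h) - f x - lin g x h.
  by rewrite (addrC h x); ring.
rewrite (le_trans (hC _ _))// expr2 mulrA ler_wpM2r//.
have : `|h| <= e%:num / (C + 1).
  near: h; apply/nbhs_ballP; exists (e%:num / (C + 1)) => /=.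
    by rewrite divr_gt0// ltr_wpDl.
  by move=> y; rewrite -ball_normE/= sub0r normrN => /ltW.
rewrite ler_pdivlMr ?ltr_wpDl// => h1.
by rewrite (le_trans _ h1)// mulrC ler_wpM2l// lerDl.
Unshelve. all: by end_near. Qed.

Lemma qrem_is_diff f g x : qrem f g ->
  differentiable f x /\ 'd f x = lin g x :> ('rV[R]_d -> R).
Proof.
move=> qg.
pose M := GRing.isLinear.Build _ _ _ _ _ (@lin_linear g x).
pose L : {linear 'rV[R]_d -> R} := HB.pack (lin g x : 'rV[R]_d -> R) M.
have E : 'd f x = L :> ('rV[R]_d -> R).
  apply: diff_unique; first exact: lin_continuous.
  exact: qrem_littleo.
split => //; apply/diff_locallyP; rewrite E; split; first exact: lin_continuous.
exact: qrem_littleo.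
Qed.

Lemma qrem_differentiable f g x : qrem f g -> differentiable f x.
Proof. by case/(qrem_is_diff x). Qed.

Lemma qrem_pder f g i : qrem f g -> pder i f = g i.
Proof.
move=> qg; apply/funext => x; have [df E] := qrem_is_diff x qg.
by rewrite /pder deriveE// E lin_evec.
Qed.

Lemma BI_qrem n f : BI n.+1 f -> qrem f (fun i => pder i f).
Proof.
move=> /BI_S[_ [g qg _]].
by rewrite (_ : (fun i => pder i f) = g)//; apply/funext => i; exact: qrem_pder.
Qed.

Lemma BI_pder n f i : BI n.+1 f -> BI n (pder i f).
Proof. by move=> /BI_S[_ [g qg Bg]]; rewrite (qrem_pder _ qg). Qed.

Lemma BI_differentiable n f x : BI n.+1 f -> differentiable f x.
Proof. by move=> /BI_qrem; exact: qrem_differentiable. Qed.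

Lemma BI_continuous n f : BI n.+1 f -> continuous f.
Proof. by move=> Bf x; apply: differentiable_continuous; exact: BI_differentiable Bf. Qed.

Lemma BI_pders s n f : BI (n + size s) f -> BI n (pders s f).
Proof.
elim: s n => [|i s IH] n /=; first by rewrite addn0.
by rewrite addnS -addSn => /IH; exact: BI_pder.
Qed.

Definition Binf f := forall n, BI n f.

Lemma Binf_smooth f : Binf f -> smooth f.
Proof. by move=> Bf s x; apply: (@BI_differentiable 0); apply: BI_pders. Qed.

Lemma Binf_pder f i : Binf f -> Binf (pder i f).
Proof. by move=> Bf n; exact: BI_pder. Qed.

Lemma Binf_bnd f : Binf f -> bnd f.
Proof. by move=> /(_ 0). Qed.

Lemma Binf_qrem f : Binf f -> qrem f (fun i => pder i f).
Proof. by move=> /(_ 1) /BI_qrem. Qed.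

Lemma Binf_continuous f : Binf f -> continuous f.
Proof. by move=> /(_ 1) /BI_continuous. Qed.

Lemma Binf_cst (c : R) : Binf (fun=> c).
Proof. by move=> n; exact: BI_cst. Qed.

Lemma BinfD f f' : Binf f -> Binf f' -> Binf (fun x => f x + f' x).
Proof. by move=> Bf Bf' n; exact: BID. Qed.

Lemma BinfM f f' : Binf f -> Binf f' -> Binf (fun x => f x * f' x).
Proof. by move=> Bf Bf' n; exact: BIM. Qed.

Lemma BinfZ c f : Binf f -> Binf (fun x => c * f x).
Proof. by move=> Bf n; exact: BIZ. Qed.

Lemma BinfN f : Binf f -> Binf (fun x => - f x).
Proof. by move=> Bf n; exact: BIN. Qed.

Lemma BinfX f m : Binf f -> Binf (fun x => f x ^+ m).
Proof. by move=> Bf n; exact: BIX. Qed.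

Lemma BinfV (c : R) f : 0 < c -> (forall x, c <= f x) -> Binf f ->
  Binf (fun x => (f x)^-1).
Proof. by move=> c0 cf Bf n; exact: (BIV c0). Qed.

Lemma Binf_ln (c : R) f : 0 < c -> (forall x, c <= f x) -> Binf f ->
  Binf (fun x => ln (f x)).
Proof. by move=> c0 cf Bf n; exact: (BI_ln c0). Qed.

Lemma Binf_affine f (a : 'rV[R]_d) (s : R) : Binf f ->
  Binf (fun x => f (a + s *: x)).
Proof. by move=> Bf n; exact: BI_affine. Qed.

Lemma pder_cst (c : R) i : pder i (fun=> c) = (fun=> 0) :> ('rV[R]_d -> R).
Proof.
apply: (@qrem_pder (fun=> c) (fun (_ : 'I_d) (_ : 'rV[R]_d) => 0)).
exists 0 => x h; rewrite /lin subrr big1 ?subrr ?normr0 ?mul0r// => j _.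
by rewrite mulr0.
Qed.

Lemma pderD f f' i : Binf f -> Binf f' ->
  pder i (fun x => f x + f' x) = (fun x => pder i f x + pder i f' x).
Proof.
move=> /Binf_qrem qf /Binf_qrem qf'.
by rewrite (qrem_pder _ (qremD qf qf')).
Qed.

Lemma pderM f f' i : Binf f -> Binf f' ->
  pder i (fun x => f x * f' x) = (fun x => pder i f x * f' x + f x * pder i f' x).
Proof.
move=> Bf Bf'.
have bg h (Bh : Binf h) j : bnd (pder j h) by apply: Binf_bnd; exact: Binf_pder.
rewrite (qrem_pder i (qremM (Binf_bnd Bf) (Binf_bnd Bf') (bg _ Bf) (bg _ Bf')
   (Binf_qrem Bf) (Binf_qrem Bf'))).
by [].
Qed.

Lemma pderZ c f i : Binf f -> pder i (fun x => c * f x) = (fun x => c * pder i f x).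
Proof.
move=> Bf; rewrite pderM//; last by move=> n; exact: BI_cst.
by rewrite pder_cst; apply/funext => x; rewrite mul0r add0r.
Qed.

Lemma pderN f i : Binf f -> pder i (fun x => - f x) = (fun x => - pder i f x).
Proof.
move=> Bf; rewrite (_ : (fun x => - f x) = (fun x => -1 * f x)).
  by rewrite pderZ//; apply/funext => x; rewrite mulN1r.
by apply/funext => x; rewrite mulN1r.
Qed.

Lemma pder_affine f (a : 'rV[R]_d) (s : R) i : Binf f ->
  pder i (fun x => f (a + s *: x)) = (fun x => s * pder i f (a + s *: x)).
Proof. by move=> /Binf_qrem/(qrem_affine a s)/qrem_pder ->. Qed.

Lemma pder_ln (c : R) f i : 0 < c -> (forall x, c <= f x) -> Binf f ->
  pder i (fun x => ln (f x)) = (fun x => (f x)^-1 * pder i f x).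
Proof.
move=> c0 cf Bf.
have bg j : bnd (pder j f) by apply: Binf_bnd; exact: Binf_pder.
by rewrite (qrem_pder i (qrem_ln c0 cf (Binf_bnd Bf) bg (Binf_qrem Bf))).
Qed.

End BI_differentiable.

(** * The kernel k0 and its powers *)

Section kernel.
Variables (R : realType) (d : nat).
Implicit Types (x h : 'rV[R]_d) (i j : 'I_d).

Lemma dotv_ge0 x : 0 <= dotv x x.
Proof. by apply: sumr_ge0 => i _; rewrite -expr2 exprn_even_ge0. Qed.

Lemma dotvDD x h : dotv (x + h) (x + h) = dotv x x + 2 * dotv x h + dotv h h.
Proof.
rewrite /dotv mulr_sumr -!big_split/=; apply: eq_bigr => i _.
by rewrite mxE; ring.
Qed.

Lemma dotvNN x : dotv (- x) (- x) = dotv x x.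
Proof. by apply: eq_bigr => i _; rewrite mxE mulrNN. Qed.

Lemma dotv_le x h : `|dotv x h| <= d%:R * (`|x| * `|h|).
Proof.
rewrite (le_trans (ler_norm_sum _ _ _))//.
rewrite (le_trans (ler_sum _ (_ : forall i, true -> _ <= `|x| * `|h|)))//.
  by move=> i _; rewrite normrM ler_pM// coord_le.
by rewrite sumr_const card_ord mulr_natl.
Qed.

Lemma coord_sqr_le x i : x 0 i ^+ 2 <= dotv x x.
Proof.
rewrite /dotv (bigD1 i)//= -expr2 lerDl.
by apply: sumr_ge0 => j _; rewrite -expr2 exprn_even_ge0.
Qed.

Lemma norm_sqr_le x : `|x| ^+ 2 <= dotv x x.
Proof.
have [E|N] := eqVneq `|x| 0; first by rewrite E expr0n/= dotv_ge0.
have [[i j] E] := mx_norm_neq0 N; rewrite [`|x|]E /=.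
by rewrite (ord1 i) real_normK ?num_real// coord_sqr_le.
Qed.

(** The factor [1 / 2] makes the gradient of [kden] equal to [x]; hence [yk] is the gradient of
    [ln kden], that is, minus the gradient of [ln k0]. *)
Definition kden x : R := 1 + dotv x x / 2.
Definition k0 x : R := (kden x)^-1.
Definition yk i x : R := x 0 i * k0 x.

Lemma kden_ge1 x : 1 <= kden x.
Proof. by rewrite /kden lerDl divr_ge0// dotv_ge0. Qed.

Lemma kden_gt0 x : 0 < kden x.
Proof. exact: lt_le_trans (kden_ge1 x). Qed.

Lemma k0_gt0 x : 0 < k0 x.
Proof. by rewrite invr_gt0 kden_gt0. Qed.

Lemma k0_le1 x : k0 x <= 1.
Proof. by rewrite invf_le1 ?kden_gt0 ?kden_ge1. Qed.

Lemma k0N x : k0 (- x) = k0 x.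
Proof. by rewrite /k0 /kden dotvNN. Qed.

Lemma ykN i x : yk i (- x) = - yk i x.
Proof. by rewrite /yk k0N mxE mulNr. Qed.

Lemma norm_kden x : `|x| <= kden x /\ `|x| ^+ 2 <= 2 * kden x.
Proof.
have := norm_sqr_le x; rewrite /kden; set N := `|x|; set e := dotv x x => Ne.
by split; nra.
Qed.

Lemma yk_le1 i x : `|yk i x| <= 1.
Proof.
rewrite /yk normrM (ger0_norm (ltW (k0_gt0 x))) ler_pdivrMr ?kden_gt0// mul1r.
by rewrite (le_trans (coord_le x i))//; case: (norm_kden x).
Qed.

Lemma kernel_ineq (N M t a b D S c : R) :
  0 <= N -> 0 <= M -> 0 <= t -> t <= N + M -> 1 <= a -> 1 <= b -> N <= a ->
  N ^+ 2 <= 2 * a -> M <= b -> `|D| <= c * (N * t) -> 0 <= S -> S <= c * t ^+ 2 ->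
  0 <= c ->
  [/\ `|- S * a + D ^+ 2 + D * S| <= (c + 5 * c ^+ 2) * t ^+ 2 * (a * a * b),
      N * `|- S * a + D ^+ 2 + D * S| <= (c + 6 * c ^+ 2) * t ^+ 2 * (a * a * b) &
      t * `|D + S| <= (3 * c) * t ^+ 2 * (a * b)].
Proof.
move=> N0 M0 t0 tNM a1 b1 Na N2a Mb hD S0 hS c0.
have a0 : 0 <= a by lra.
have b0 : 0 <= b by lra.
have ab1 : 1 <= a * b by nra.
have aab : a <= a * a * b by nra.
have aab2 : a * a <= a * a * b by nra.
have Na2 : N <= a * a * b by nra.
have N2 : N ^+ 2 <= 2 * (a * a * b) by lra.
have N3 : N ^+ 3 <= 2 * (a * a * b).
  rewrite exprS; have : N * N ^+ 2 <= a * (2 * a) by apply: ler_pM => //; exact: exprn_ge0.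
  lra.
have Nt : N * t <= 3 * (a * a * b).
  have : N * t <= N * (N + M) by exact: ler_wpM2l.
  have : N * M <= a * b by exact: ler_pM.
  have : a * b <= a * a * b by nra.
  nra.
have N2t : N ^+ 2 * t <= 4 * (a * a * b).
  have : N ^+ 2 * t <= N ^+ 2 * (N + M) by apply: ler_wpM2l => //; exact: exprn_ge0.
  have : N ^+ 2 * M <= 2 * a * b by apply: ler_pM => //; exact: exprn_ge0.
  have : a * b <= a * a * b by nra.
  by rewrite mulrDr -exprSr; lra.
have tab : t <= 2 * (a * b) by nra.
have t2 : 0 <= t ^+ 2 by exact: exprn_ge0.
set P := a * a * b in aab aab2 Na2 N2 N3 Nt N2t *.
have hDS : `|- S * a + D ^+ 2 + D * S| <= c * t ^+ 2 * a + c ^+ 2 * t ^+ 2 * N ^+ 2 + c ^+ 2 * t ^+ 2 * (N * t).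
  rewrite (le_trans (ler_normD _ _))// lerD//.
    rewrite (le_trans (ler_normD _ _))// lerD//.
      by rewrite normrM normrN (ger0_norm S0) (ger0_norm a0) ler_wpM2r.
    rewrite normrX.
    have -> : c ^+ 2 * t ^+ 2 * N ^+ 2 = (c * (N * t)) ^+ 2 by ring.
    by rewrite ler_pXn2r ?nnegrE ?mulr_ge0.
  rewrite normrM (ger0_norm S0).
  have -> : c ^+ 2 * t ^+ 2 * (N * t) = (c * (N * t)) * (c * t ^+ 2) by ring.
  exact: ler_pM.
have c2t : 0 <= c ^+ 2 * t ^+ 2 by rewrite mulr_ge0// exprn_ge0.
have ct : 0 <= c * t ^+ 2 by exact: mulr_ge0.
split.
- rewrite (le_trans hDS)//.
  have := ler_wpM2l ct aab; have := ler_wpM2l c2t N2; have := ler_wpM2l c2t Nt.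
  lra.
- rewrite (le_trans (ler_wpM2l N0 hDS))//.
  have NaP : N * a <= P by rewrite (le_trans _ aab2)// ler_wpM2r.
  have := ler_wpM2l ct NaP; have := ler_wpM2l c2t N3; have := ler_wpM2l c2t N2t.
  by rewrite (exprS N 2); lra.
- have : `|D + S| <= c * (N * t) + c * t ^+ 2.
    by rewrite (le_trans (ler_normD _ _))// (ger0_norm S0) lerD.
  move=> /(ler_wpM2l t0)/le_trans; apply.
  have Nab : N <= a * b by nra.
  have := ler_wpM2l ct Nab; have := ler_wpM2l ct tab.
  by rewrite expr2; lra.
Qed.

(** Over the denominator [a a b], the numerator left of [k0 (x + h)] after subtracting its linear
    part is [- S a + D^2 + D S]. The constant is the dimension because [|.|] is the sup norm while
    [dotv] is the Euclidean product. *)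
Lemma kernel_data x h : let D := dotv x h in let S := dotv h h / 2 in
  let a := kden x in let b := kden (x + h) in let c := d%:R in
  [/\ kden (x + h) = a + D + S,
      `|- S * a + D ^+ 2 + D * S| <= (c + 5 * c ^+ 2) * `|h| ^+ 2 * (a * a * b),
      `|x| * `|- S * a + D ^+ 2 + D * S| <= (c + 6 * c ^+ 2) * `|h| ^+ 2 * (a * a * b) &
      `|h| * `|D + S| <= (3 * c) * `|h| ^+ 2 * (a * b)].
Proof.
move=> D S a b c.
have [Na N2a] := norm_kden x; have [Mb _] := norm_kden (x + h).
have hh : `|h| <= `|x| + `|x + h|.
  by rewrite -[X in `|X| <= _](addKr x) (le_trans (ler_normD _ _))// normrN.
have hS : S <= c * `|h| ^+ 2.
  have := dotv_le h h; rewrite (ger0_norm (dotv_ge0 h)) -expr2 /S -/c.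
  have := dotv_ge0 h; lra.
have S0 : 0 <= S by rewrite divr_ge0// dotv_ge0.
have [h1 h2 h3] := kernel_ineq (normr_ge0 x) (normr_ge0 (x + h)) (normr_ge0 h) hh
  (kden_ge1 x) (kden_ge1 (x + h)) Na N2a Mb (dotv_le x h) S0 hS (ler0n _ _).
by split => //; rewrite /b /a /kden dotvDD /D /S; field.
Qed.

Lemma qrem_k0 : qrem k0 (fun i x => - (yk i x * k0 x)).
Proof.
exists (d%:R + 5 * d%:R ^+ 2) => x h.
have [E h1 _ _] := kernel_data x h.
have -> : lin (fun i x => - (yk i x * k0 x)) x h = - (dotv x h * (k0 x * k0 x)).
  rewrite /lin /dotv mulr_suml -sumrN; apply: eq_bigr => i _.
  by rewrite /yk; ring.
have a0 := kden_gt0 x; have b0 := kden_gt0 (x + h).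
have -> : k0 (x + h) - k0 x - - (dotv x h * (k0 x * k0 x)) =
  (- (dotv h h / 2) * kden x + dotv x h ^+ 2 + dotv x h * (dotv h h / 2)) /
  (kden x * kden x * kden (x + h)).
  rewrite /k0; move: b0 a0; rewrite E.
  move: (kden x) (dotv x h) (dotv h h / 2) => a D S b0 a0.
  by field; rewrite !lt0r_neq0.
rewrite normrM normfV (gtr0_norm (_ : 0 < kden x * kden x * kden (x + h))) ?mulr_gt0//.
by rewrite ler_pdivrMr ?mulr_gt0.
Qed.

Lemma qrem_yk i :
  qrem (yk i) (fun j x => (i == j)%:R * k0 x - yk i x * yk j x).
Proof.
exists ((d%:R + 6 * d%:R ^+ 2) + 3 * d%:R) => x h.
have [E _ h1 h2] := kernel_data x h.
have -> : lin (fun j x => (i == j)%:R * k0 x - yk i x * yk j x) x h =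
   h 0 i * k0 x - x 0 i * dotv x h * (k0 x * k0 x).
  rewrite /lin; under eq_bigr do rewrite mulrBr.
  rewrite big_split/= sumrN; congr (_ - _).
    rewrite (bigD1 i)//= eqxx mul1r big1 ?addr0// => j ji.
    by rewrite eq_sym (negbTE ji) mul0r mulr0.
  rewrite /dotv mulr_sumr mulr_suml; apply: eq_bigr => j _.
  by rewrite /yk; ring.
have a0 := kden_gt0 x; have b0 := kden_gt0 (x + h).
have -> : yk i (x + h) - yk i x - (h 0 i * k0 x - x 0 i * dotv x h * (k0 x * k0 x)) =
  (x 0 i * (- (dotv h h / 2) * kden x + dotv x h ^+ 2 + dotv x h * (dotv h h / 2))) /
  (kden x * kden x * kden (x + h)) +
  - (h 0 i * (dotv x h + dotv h h / 2) / (kden x * kden (x + h))).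
  rewrite /yk /k0 mxE; move: b0 a0; rewrite E.
  move: (kden x) (dotv x h) (dotv h h / 2) => a D S b0 a0.
  by field; rewrite !lt0r_neq0.
rewrite (le_trans (ler_normD _ _))// [leRHS]mulrDl normrN lerD//.
  rewrite normrM normfV (gtr0_norm (_ : 0 < kden x * kden x * kden (x + h))) ?mulr_gt0//.
  rewrite ler_pdivrMr ?mulr_gt0// (le_trans _ h1)// normrM ler_wpM2r//.
  exact: coord_le.
rewrite normrM normfV (gtr0_norm (_ : 0 < kden x * kden (x + h))) ?mulr_gt0//.
rewrite ler_pdivrMr ?mulr_gt0// (le_trans _ h2)// normrM ler_wpM2r//.
exact: coord_le.
Qed.

(** A simultaneous induction works because the family is closed under differentiation: the
    derivatives of [k0] and [yk] are polynomials in [k0] and [yk]. *)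
Lemma BI_k0_yk n : @BI R d n k0 /\ forall i, BI n (yk i).
Proof.
elim: n => [|n [IHk IHy]].
  split=> [|i]; exists 1 => x; last exact: yk_le1.
  by rewrite (gtr0_norm (k0_gt0 x)) k0_le1.
split=> [|i]; split.
- exact: BI_bnd IHk.
- exists (fun i x => - (yk i x * k0 x)); first exact: qrem_k0.
  by move=> i; apply: BIN; apply: BIM.
- exact: BI_bnd (IHy i).
- exists (fun j x => (i == j)%:R * k0 x - yk i x * yk j x); first exact: qrem_yk.
  move=> j; apply: BID; first exact: BIZ.
  by apply: BIN; apply: BIM.
Qed.

Lemma Binf_k0 : Binf k0.
Proof. by move=> n; case: (BI_k0_yk n). Qed.

Lemma Binf_yk i : Binf (yk i).
Proof. by move=> n; case: (BI_k0_yk n). Qed.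

Lemma pder_k0 i : pder i k0 = (fun x => - (yk i x * k0 x)).
Proof. exact: qrem_pder qrem_k0. Qed.

Lemma pder_yk i j : pder j (yk i) = (fun x => (i == j)%:R * k0 x - yk i x * yk j x).
Proof. exact: (qrem_pder _ (qrem_yk i)). Qed.

Definition kern (m : nat) x : R := k0 x ^+ m.

Lemma Binf_kern m : Binf (kern m).
Proof. by apply: BinfX; exact: Binf_k0. Qed.

Lemma kern_gt0 m x : 0 < kern m x.
Proof. by rewrite exprn_gt0// k0_gt0. Qed.

Lemma kern_le1 m x : kern m x <= 1.
Proof. by rewrite exprn_ile1 ?k0_le1// ltW// k0_gt0. Qed.

Lemma kernN m x : kern m (- x) = kern m x.
Proof. by rewrite /kern k0N. Qed.

Lemma pder_kern m i : pder i (kern m) = (fun x => - (m%:R * yk i x * kern m x)).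
Proof.
elim: m => [|m IH].
  rewrite (_ : kern 0 = fun=> 1); last by apply/funext => x; rewrite /kern expr0.
  by rewrite pder_cst; apply/funext => x; rewrite !mul0r oppr0.
rewrite (_ : kern m.+1 = fun x => k0 x * kern m x); last first.
  by apply/funext => x; rewrite /kern exprS.
rewrite pderM; [|exact: Binf_k0|exact: Binf_kern].
by rewrite IH pder_k0; apply/funext => x; rewrite -natr1; ring.
Qed.

End kernel.

(** * Integrability and Fubini tools *)

Section integration_tools.
Context d (T : measurableType d) (R : realType).

Definition L1 (M : {measure set T -> \bar R}) (f : T -> R) : Prop :=
  M.-integrable setT (EFin \o f).

Implicit Types (M : {measure set T -> \bar R}) (f g h : T -> R).

Lemma L1_meas M f : L1 M f -> measurable_fun setT f.
Proof. by move=> /(measurable_int M)/measurable_EFinP. Qed.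

Lemma L1D M f g : L1 M f -> L1 M g -> L1 M (fun x => f x + g x).
Proof. by move=> If Ig; exact: (integrableD measurableT If Ig). Qed.

Lemma L1N M f : L1 M f -> L1 M (fun x => - f x).
Proof. by move=> If; exact: (integrableN If). Qed.

Lemma L1B M f g : L1 M f -> L1 M g -> L1 M (fun x => f x - g x).
Proof. by move=> If Ig; apply: L1D => //; exact: L1N. Qed.

Lemma L1Z M (c : R) f : L1 M f -> L1 M (fun x => c * f x).
Proof. by move=> If; exact: (integrableZl measurableT c If). Qed.

Lemma L1_0 M : L1 M (fun=> 0).
Proof. exact: integrable0. Qed.

Lemma L1_sum M (I : Type) (s : seq I) (F : I -> T -> R) :
  (forall i, L1 M (F i)) -> L1 M (fun x => \sum_(i <- s) F i x).
Proof.
move=> IF; elim: s => [|i s IH].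
  rewrite (_ : (fun _ => _) = fun=> 0); first exact: L1_0.
  by apply/funext => x; rewrite big_nil.
rewrite (_ : (fun _ => _) = fun x => F i x + \sum_(j <- s) F j x); first exact: L1D.
by apply/funext => x; rewrite big_cons.
Qed.

Lemma L1_le M f g : measurable_fun setT f -> (forall x, `|f x| <= g x) ->
  L1 M g -> L1 M f.
Proof.
move=> mf fg; apply: le_integrable => //; first exact/measurable_EFinP.
by move=> x _; rewrite /= lee_fin (le_trans (fg x))// ler_norm.
Qed.

Lemma L1_norm M f : L1 M f -> L1 M (fun x => `|f x|).
Proof. by move=> /integrable_norm. Qed.

Lemma L1_bM M h f : measurable_fun setT h -> bnd h -> L1 M f ->
  L1 M (fun x => h x * f x).
Proof.
move=> mh [C hC] If.
apply: (L1_le (g := fun x => C * `|f x|)).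
- by apply: measurable_funM => //; exact: L1_meas If.
- by move=> x; rewrite normrM ler_wpM2r.
- by apply: L1Z; exact: L1_norm.
Qed.

Lemma L1_bnd (M : {finite_measure set T -> \bar R}) f :
  measurable_fun setT f -> bnd f -> L1 M f.
Proof.
move=> mf [C hC]; apply: (@L1_le M f (cst C)) => //.
exact: finite_measure_integrable_cst.
Qed.

Lemma int_sum M (I : Type) (s : seq I) (F : I -> T -> R) :
  (forall i, L1 M (F i)) ->
  \int[M]_x (\sum_(i <- s) F i x) = \sum_(i <- s) \int[M]_x F i x.
Proof.
move=> IF; elim: s => [|i s IH].
  under eq_Rintegral do rewrite big_nil.
  by rewrite big_nil Rintegral_cst// mul0r.
under eq_Rintegral do rewrite big_cons.
by rewrite RintegralD//; [rewrite IH big_cons|exact: IF|exact: L1_sum].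
Qed.

Lemma intD M f g : L1 M f -> L1 M g ->
  \int[M]_x (f x + g x) = \int[M]_x f x + \int[M]_x g x.
Proof. exact: RintegralD. Qed.

Lemma intB M f g : L1 M f -> L1 M g ->
  \int[M]_x (f x - g x) = \int[M]_x f x - \int[M]_x g x.
Proof. exact: RintegralB. Qed.

Lemma intZ M c f : L1 M f -> \int[M]_x (c * f x) = c * \int[M]_x f x.
Proof. exact: RintegralZl. Qed.

Lemma intN M f : L1 M f -> \int[M]_x (- f x) = - \int[M]_x f x.
Proof.
move=> If; rewrite -mulN1r -intZ//; apply: eq_Rintegral => x _.
by rewrite mulN1r.
Qed.

Lemma int_le M f g : L1 M f -> L1 M g -> (forall x, f x <= g x) ->
  \int[M]_x f x <= \int[M]_x g x.
Proof. by move=> If Ig fg; apply: le_Rintegral. Qed.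

Lemma int_ge0 M f : (forall x, 0 <= f x) -> 0 <= \int[M]_x f x.
Proof. by move=> f0; apply: Rintegral_ge0. Qed.

Lemma int_norm_le M f g : L1 M f -> L1 M g -> (forall x, `|f x| <= g x) ->
  `|\int[M]_x f x| <= \int[M]_x g x.
Proof.
move=> If Ig fg; rewrite (le_trans (le_normr_Rintegral _ If))//.
by apply: int_le => //; exact: L1_norm.
Qed.

Lemma int_cst (M : probability T R) (c : R) : \int[M]_x c = c.
Proof.
rewrite Rintegral_cst//.
rewrite -[RHS]mulr1; congr (_ * _).
exact: (congr1 fine (probability_setT M)).
Qed.

Lemma int_EFin M f : L1 M f ->
  (\int[M]_x (f x)%:E)%E = (\int[M]_x f x)%:E.
Proof. by move=> If; rewrite /Rintegral fineK//; exact: integrable_fin_num. Qed.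

Lemma int_cvg M (F : nat -> T -> R) f g :
  (forall n, measurable_fun setT (F n)) -> (forall n x, `|F n x| <= g x) ->
  L1 M g -> (forall x, F ^~ x @ \oo --> f x) ->
  L1 M f /\ (fun n => \int[M]_x F n x) @ \oo --> \int[M]_x f x.
Proof.
move=> mF Fg Ig Ff.
have [|||||If _ cv] := @dominated_convergence _ T R M setT measurableT
   (fun n x => (F n x)%:E) (fun x => (f x)%:E) (fun x => (g x)%:E).
- by move=> n; apply/measurable_EFinP.
- apply/measurable_EFinP; apply: (measurable_fun_cvg mF) => x _; exact: Ff.
- by apply: aeW => x _; apply: cvg_EFin; [exact: nearW|exact: Ff].
- exact: Ig.
- by apply: aeW => x n _; rewrite lee_fin.
split => //.
have IF n : L1 M (F n) by exact: L1_le Ig.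
rewrite -[X in _ --> X]/(fine (\int[M]_x f x)%:E) -int_EFin//.
apply: fine_cvg; rewrite fineK; last exact: integrable_fin_num.
exact: cv.
Qed.

End integration_tools.

(** * Measurability of vector-valued maps *)

Section coordinatewise_measurability.
Context dT (T : measurableType dT) (R : realType) (d : nat).

(** Stated by coordinates so that sums and dilations of random vectors reduce to real-valued
    functions; [cmeas_open] recovers preimages of open sets. *)
Definition cmeas (xi : T -> 'rV[R]_d) :=
  forall i, measurable_fun setT (fun e => xi e 0 i).

Lemma cmeas_ball (xi : T -> 'rV[R]_d) (q : 'rV[R]_d) (r : R) :
  cmeas xi -> measurable [set e | forall i, `|q 0 i - xi e 0 i| < r].
Proof.
move=> mxi.
rewrite (_ : [set _ | _] = \bigcap_(i in [set: 'I_d]) [set e | `|q 0 i - xi e 0 i| < r]).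
  apply: fin_bigcap_measurable; first exact: finite_finset.
  move=> i _.
  have := @measurable_fun_ltr _ _ _ setT (fun e => `|q 0 i - xi e 0 i|) (cst r).
  move=> /(_ _ _) mlt; rewrite -[X in measurable X]setTI.
  apply: (mlt _ _ measurableT [set true]) => //.
  by apply: measurableT_comp => //; apply: measurable_funB => //; exact: mxi.
by apply/seteqP; split => [e /= h i _|e /= h i]; exact: h.
Qed.

Lemma rat_approx (x : 'rV[R]_d) (e : R) : 0 < e ->
  exists (q : 'rV[rat]_d) (r : rat), [/\ (0 : R) < ratr r, ratr r < e &
     forall i, `|ratr (q 0 i) - x 0 i| < (ratr r : R)].
Proof.
move=> e0; have /rat_in_itvoo[r] := e0; rewrite inE/= => /itvP hr.
have r0 : 0 < ratr r :> R by rewrite hr.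
have hq i : exists q : rat, `|ratr q - x 0 i| < (ratr r : R).
  have : x 0 i - ratr r < x 0 i + ratr r by lra.
  move=> /rat_in_itvoo[q]; rewrite inE/= => /itvP h.
  by exists q; rewrite ltr_distl !h.
have [q qE] := choice hq.
exists (\row_i q i), r; split => //; first by rewrite hr.
by move=> i; rewrite mxE.
Qed.

(** An open set is the union of the rational boxes that it contains, which are countably many, and
    the preimage of a box is a finite intersection of measurable sets. *)
Lemma cmeas_open (xi : T -> 'rV[R]_d) (O : set 'rV[R]_d) :
  cmeas xi -> open O -> measurable (xi @^-1` O).
Proof.
move=> mxi oO.
pose c (q : 'rV[rat]_d) : 'rV[R]_d := \row_i ratr (q 0 i).
pose B (p : 'rV[rat]_d * rat) : set 'rV[R]_d :=
  [set y | forall i, `|c p.1 0 i - y 0 i| < ratr p.2].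
pose F p : set T := if pselect (B p `<=` O) then xi @^-1` B p else set0.
suff -> : xi @^-1` O = \bigcup_p F p.
  apply: countable_bigcupT_measurable; first exact: countableP.
  by move=> p; rewrite /F; case: ifP => // _; exact: cmeas_ball.
apply/seteqP; split => [e Oe|e [p _]]; last first.
  by rewrite /F; case: (pselect (B p `<=` O)) => //= BO Be; exact: BO.
have : nbhs (xi e) O by exact: open_nbhs_nbhs.
move=> /nbhs_ballP[r /= r0 rO].
(* Half the radius: the centre of the box is within [s] of [xi e] and every point of the box within
   [s] of the centre. *)
have [q [s [s0 sr hq]]] := rat_approx (xi e) (divr_gt0 r0 (ltr0Sn _ 1)).
exists (q, s) => //; rewrite /F; case: (pselect (B (q, s) `<=` O)) => /= [BO|[]].
  by move=> i /=; rewrite mxE; exact: hq.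
move=> y By; apply: rO; split => // i j; rewrite (ord1 i).
have h1 := hq j; have := By j; rewrite /= mxE => h2.
rewrite /ball /= -(subrK (ratr (q 0 j)) (xi e 0 j)) -addrA.
by rewrite (le_lt_trans (ler_normD _ _))// distrC; lra.
Qed.

Lemma cmeas_comp (xi : T -> 'rV[R]_d) (f : 'rV[R]_d -> R) :
  cmeas xi -> continuous f -> measurable_fun setT (f \o xi).
Proof.
move=> mxi /continuousP cf.
apply: (measurability _ (RGenOpens.measurableE R)).
move=> _ [_ [a [b ->] <-]]; rewrite setTI comp_preimage.
by apply: cmeas_open => //; exact/cf/interval_open.
Qed.

End coordinatewise_measurability.

Section Rd_measurability.
Variables (R : realType) (d : nat).

Lemma Rd_open (O : set 'rV[R]_d) : open O -> measurable (O : set (Rd R d)).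
Proof. by move=> oO; apply: sub_gen_smallest. Qed.

Lemma Rd_closed (F : set 'rV[R]_d) : closed F -> measurable (F : set (Rd R d)).
Proof.
by move=> cF; rewrite -[F]setCK; apply: measurableC; apply: Rd_open; exact: closed_openC.
Qed.

Lemma Rd_continuous (f : 'rV[R]_d -> R) : continuous f ->
  measurable_fun setT (f : Rd R d -> R).
Proof.
move=> /continuousP cf.
apply: (measurability _ (RGenOpens.measurableE R)).
move=> _ [_ [a [b ->] <-]]; rewrite setTI.
by apply: Rd_open; exact/cf/interval_open.
Qed.

Lemma Rd_cmeas : @cmeas _ (Rd R d) R d (fun x => x).
Proof. by move=> i; apply: Rd_continuous => x; exact: coord_continuous. Qed.

End Rd_measurability.

(** * Fubini's theorem under domination by a product *)

Section fubini_bounded.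
Context dT1 dT2 (T1 : measurableType dT1) (T2 : measurableType dT2) (R : realType).
Variables (M1 : probability T1 R) (M2 : probability T2 R).
Implicit Types (F : T1 * T2 -> R).

Lemma prod_L1 F (w1 : T1 -> R) (w2 : T2 -> R) : measurable_fun setT F ->
  (forall x y, `|F (x, y)| <= w1 x * w2 y) -> L1 M1 w1 -> L1 M2 w2 ->
  L1 (M1 \x M2)%E F.
Proof.
move=> mF Fw I1 I2; apply/integrable12ltyP; first exact/measurable_EFinP.
have w20 y : M2.-integrable setT (EFin \o (fun y => `|w2 y|)) by exact: L1_norm.
apply: (@le_lt_trans _ _ (\int[M1]_x (`|w1 x| * \int[M2]_y `|w2 y|)%:E)%E); last first.
  have := integrable_lty measurableT (L1Z (\int[M2]_y `|w2 y|) (L1_norm I1)).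
  by under eq_integral do rewrite /= mulrC.
apply: ge0_le_integral => //.
- by move=> x _; apply: integral_ge0.
- apply: (measurable_fun_fubini_tonelli_F (fun z => `|(F z)%:E|)%E) => //.
  by apply: measurableT_comp => //; exact/measurable_EFinP.
- apply/measurable_EFinP; apply: measurable_funM => //.
  by apply: measurableT_comp => //; exact: L1_meas I1.
- move=> x _.
  apply: (@le_trans _ _ (\int[M2]_y (`|w1 x| * `|w2 y|)%:E)%E).
    apply: ge0_le_integral => //.
    + apply: measurableT_comp => //; apply/measurable_EFinP.
      exact: measurable_fun_pair2.
    + apply/measurable_EFinP; apply: measurable_funM => //.
      by apply: measurableT_comp => //; exact: L1_meas I2.
    + move=> y _; rewrite lee_fin (le_trans (Fw x y))// -normrM.
      exact: ler_norm.
  rewrite int_EFin ?intZ//; last by apply: L1Z; exact: L1_norm.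
  exact: L1_norm.
Qed.

Lemma prod_L1_fst F (w1 : T1 -> R) (w2 : T2 -> R) x : measurable_fun setT F ->
  (forall x y, `|F (x, y)| <= w1 x * w2 y) -> L1 M2 w2 ->
  L1 M2 (fun y => F (x, y)).
Proof.
move=> mF Fw I2; apply: (L1_le (g := fun y => w1 x * w2 y)) => //.
  exact: measurable_fun_pair2.
exact: L1Z.
Qed.

Lemma prod_L1_snd F (w1 : T1 -> R) (w2 : T2 -> R) y : measurable_fun setT F ->
  (forall x y, `|F (x, y)| <= w1 x * w2 y) -> L1 M1 w1 ->
  L1 M1 (fun x => F (x, y)).
Proof.
move=> mF Fw I1; apply: (L1_le (g := fun x => w2 y * w1 x)) => //.
- exact: measurable_fun_pair1.
- by move=> x; rewrite mulrC.
- exact: L1Z.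
Qed.

Lemma fub1 F (w1 : T1 -> R) (w2 : T2 -> R) : measurable_fun setT F ->
  (forall x y, `|F (x, y)| <= w1 x * w2 y) -> L1 M1 w1 -> L1 M2 w2 ->
  L1 M1 (fun x => \int[M2]_y F (x, y)) /\
  \int[(M1 \x M2)%E]_z F z = \int[M1]_x \int[M2]_y F (x, y).
Proof.
move=> mF Fw I1 I2; have IF := prod_L1 mF Fw I1 I2.
have E : fubini_F M2 (EFin \o F) = EFin \o (fun x => \int[M2]_y F (x, y)).
  apply/funext => x; rewrite /fubini_F /= -int_EFin//.
  exact: prod_L1_fst Fw I2.
split; first by rewrite /L1 -E; exact: integrable_fubini_F.
by rewrite {1}/Rintegral -(integral12_prod_meas1 IF) E.
Qed.

Lemma fub2 F (w1 : T1 -> R) (w2 : T2 -> R) : measurable_fun setT F ->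
  (forall x y, `|F (x, y)| <= w1 x * w2 y) -> L1 M1 w1 -> L1 M2 w2 ->
  L1 M2 (fun y => \int[M1]_x F (x, y)) /\
  \int[(M1 \x M2)%E]_z F z = \int[M2]_y \int[M1]_x F (x, y).
Proof.
move=> mF Fw I1 I2; have IF := prod_L1 mF Fw I1 I2.
have E : fubini_G M1 (EFin \o F) = EFin \o (fun y => \int[M1]_x F (x, y)).
  apply/funext => y; rewrite /fubini_G /= -int_EFin//.
  exact: prod_L1_snd Fw I1.
split.
  apply: (L1_le (g := fun y => \int[M1]_x `|w1 x| * `|w2 y|)).
  - by apply/measurable_EFinP; rewrite -E; apply: measurable_fubini_G IF.
  - move=> y; rewrite -RintegralZr//; last exact: L1_norm.
    apply: int_norm_le.
    + exact: prod_L1_snd Fw I1.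
    + by under eq_fun do rewrite mulrC; apply: L1Z; exact: L1_norm.
    + by move=> x; rewrite (le_trans (Fw x y))// -normrM ler_norm.
  - by apply: L1Z; exact: L1_norm.
by rewrite {1}/Rintegral -(integral21_prod_meas1 IF) E.
Qed.

End fubini_bounded.

(** * Convolution with the weighted law of a random vector *)

Section parametric_integral.
Context dT (T : measurableType dT) (R : realType) (d : nat).
Variables (M : probability T R) (eta : T -> 'rV[R]_d) (w : T -> R).
Hypotheses (meta : cmeas eta) (mw : measurable_fun setT w) (bw : bnd w).

Definition pint (k : 'rV[R]_d -> R) (x : 'rV[R]_d) : R :=
  \int[M]_e (k (x - eta e) * w e).

Lemma cmeas_sub (x : 'rV[R]_d) : cmeas (fun e => x - eta e).
Proof.
move=> i; rewrite (_ : (fun _ => _) = fun e => x 0 i - eta e 0 i).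
  by apply: measurable_funB => //; exact: meta.
by apply/funext => e; rewrite !mxE.
Qed.

Lemma pint_L1 k x : continuous k -> bnd k -> L1 M (fun e => k (x - eta e) * w e).
Proof.
move=> ck [C hC]; apply: L1_bnd.
  by apply: measurable_funM => //; apply: (cmeas_comp (cmeas_sub x)).
by apply: bndM => //; exists C.
Qed.

Lemma qrem_pint k g : continuous k -> bnd k ->
  (forall i, continuous (g i)) -> (forall i, bnd (g i)) ->
  qrem k g -> qrem (pint k) (fun i => pint (g i)).
Proof.
move=> ck bk cg bg /qremP[C C0 hC]; have [W W0 hW] := bnd_gt0 bw.
exists (C * W) => x h.
have Ik y : L1 M (fun e => k (y - eta e) * w e) by exact: pint_L1.
have Ig i : L1 M (fun e => h 0 i * (g i (x - eta e) * w e)).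
  by apply: L1Z; exact: pint_L1.
have -> : pint k (x + h) - pint k x - lin (fun i => pint (g i)) x h =
  \int[M]_e ((k (x + h - eta e) * w e - k (x - eta e) * w e) -
     \sum_i h 0 i * (g i (x - eta e) * w e)).
  rewrite intB ?intB//; first last.
  - exact: L1_sum.
  - exact: L1B.
  congr (_ - _); rewrite int_sum//; apply: eq_bigr => i _.
  by rewrite intZ//; exact: pint_L1.
rewrite (le_trans (int_norm_le (g := fun=> C * W * `|h| ^+ 2) _ _ _))//.
- by apply: L1B; [exact: L1B|exact: L1_sum].
- exact: finite_measure_integrable_cst.
- move=> e.
  have -> : k (x + h - eta e) * w e - k (x - eta e) * w e -
     \sum_i h 0 i * (g i (x - eta e) * w e) =
    (k (x - eta e + h) - k (x - eta e) - lin g (x - eta e) h) * w e.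
    rewrite -(addrAC x (- eta e)) /lin !mulrBl mulr_suml; congr (_ - _).
    by apply: eq_bigr => i _; rewrite mulrA.
  rewrite normrM [leRHS]mulrAC; apply: ler_pM => //.
- by rewrite int_cst.
Qed.

(** One order is lost because [BI 0] gives only boundedness, whereas measurability of the integrand
    is drawn from continuity of [k], which takes one more order. For [Binf] the loss is
    invisible. *)
Lemma BI_pint n k : BI n.+1 k -> BI n (pint k).
Proof.
elim: n k => [k Bk|n IH k Bk].
  have [W W0 hW] := bnd_gt0 bw; have [C C0 hC] := bnd_gt0 (BI_bnd Bk).
  exists (C * W) => x.
  rewrite (le_trans (int_norm_le (g := fun=> C * W) _ _ _)) ?int_cst//.
  - by apply: pint_L1; [exact: BI_continuous Bk|exact: BI_bnd Bk].
  - exact: finite_measure_integrable_cst.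
  - by move=> e; rewrite normrM ler_pM.
have [bk [g qg Bg]] := BI_S Bk.
split; first by apply: (@BI_bnd _ _ n); apply: IH; exact: BI_pred.
exists (fun i => pint (g i)); last by move=> i; apply: IH.
apply: qrem_pint => //.
- exact: BI_continuous Bk.
- by move=> i; exact: BI_continuous (Bg i).
- by move=> i; exact: BI_bnd (Bg i).
Qed.

Lemma Binf_pint k : Binf k -> Binf (pint k).
Proof. by move=> Bk n; exact: BI_pint. Qed.

End parametric_integral.

(** * The regularized Schroedinger system *)

Section sequence_limits.
Variable R : realType.
Implicit Types (u : nat -> R) (a l : R).

Lemma seq_cvg_ge u a l : (forall n, a <= u n) -> u @ \oo --> l -> a <= l.
Proof.
move=> au ul; rewrite -(cvg_lim (@Rhausdorff R) ul).
by apply: limr_ge; [exact: cvgP ul|exact: nearW].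
Qed.

Lemma seq_cvg_le u a l : (forall n, u n <= a) -> u @ \oo --> l -> l <= a.
Proof.
move=> au ul; rewrite -(cvg_lim (@Rhausdorff R) ul).
by apply: limr_le; [exact: cvgP ul|exact: nearW].
Qed.

End sequence_limits.

Section schroedinger_potentials.
Context dT1 dT2 (T1 : measurableType dT1) (T2 : measurableType dT2).
Context (R : realType) (d : nat).
Variables (M1 : probability T1 R) (M2 : probability T2 R).
Variables (xi : T1 -> 'rV[R]_d) (eta : T2 -> 'rV[R]_d).
Hypotheses (mxi : cmeas xi) (meta : cmeas eta).
Variables (kap : R) (K : 'rV[R]_d -> R).
Hypotheses (kap0 : 0 < kap) (BK : Binf K) (K0 : forall x, 0 <= K x).

Definition potential_step dT (T : measurableType dT) (M : probability T R)
    (eta : T -> 'rV[R]_d) (V : 'rV[R]_d -> R) (x : 'rV[R]_d) : R :=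
  (kap + pint M eta (V \o eta) K x)^-1.

Let good (V : 'rV[R]_d -> R) := forall x, 0 <= V x <= kap^-1.

Lemma good_bnd V : good V -> bnd V.
Proof.
move=> gV; exists kap^-1 => x; have /andP[V0 V1] := gV x.
by rewrite ger0_norm.
Qed.

Section one_step.
Context dT (T : measurableType dT) (M : probability T R) (et : T -> 'rV[R]_d).
Hypothesis met : cmeas et.

Lemma pint_ge0 w x : (forall e, 0 <= w e) -> 0 <= pint M et w K x.
Proof. by move=> w0; apply: int_ge0 => e; rewrite mulr_ge0. Qed.

Lemma potential_step_good V : good V -> good (potential_step M et V).
Proof.
move=> gV x; have p0 : 0 <= pint M et (V \o et) K x.
  by apply: pint_ge0 => e /=; case/andP: (gV (et e)).
rewrite invr_ge0 addr_ge0 ?(ltW kap0)//= lef_pV2 ?posrE ?ltr_wpDr//.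
by rewrite lerDl.
Qed.

Lemma potential_step_Binf V : good V -> measurable_fun setT (V \o et) ->
  Binf (potential_step M et V).
Proof.
move=> gV mV; apply: (BinfV kap0).
  by move=> x; rewrite lerDl pint_ge0// => e /=; case/andP: (gV (et e)).
apply: BinfD; first exact: Binf_cst.
apply: Binf_pint => //.
by have [C hC] := good_bnd gV; exists C => e; exact: hC.
Qed.

Lemma potential_step_le V V' : good V -> good V' ->
  measurable_fun setT (V \o et) -> measurable_fun setT (V' \o et) ->
  (forall x, V x <= V' x) ->
  forall x, potential_step M et V' x <= potential_step M et V x.
Proof.
move=> gV gV' mV mV' VV' x.
have p0 W : good W -> 0 <= pint M et (W \o et) K x.
  by move=> gW; apply: pint_ge0 => e /=; case/andP: (gW (et e)).
rewrite lef_pV2 ?posrE ?ltr_wpDr ?p0// lerD2l.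
have bo W : good W -> bnd (W \o et).
  by move=> /good_bnd[C hC]; exists C => e; exact: hC.
apply: int_le.
- by apply: pint_L1 => //; [exact: bo|exact: Binf_continuous|exact: Binf_bnd].
- by apply: pint_L1 => //; [exact: bo|exact: Binf_continuous|exact: Binf_bnd].
- by move=> e; rewrite /= ler_wpM2l.
Qed.

Lemma potential_step_cvg (V : nat -> 'rV[R]_d -> R) V' :
  (forall n, good (V n)) -> (forall n, measurable_fun setT (V n \o et)) ->
  (forall x, V ^~ x @ \oo --> V' x) ->
  forall x, (fun n => potential_step M et (V n) x) @ \oo --> potential_step M et V' x.
Proof.
move=> gV mV cV x; have [B B0 hB] := bnd_gt0 (Binf_bnd BK).
have gV' : good V'.
  move=> y; apply/andP; split.
    by apply: seq_cvg_ge (cV y) => n; case/andP: (gV n y).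
  by apply: seq_cvg_le (cV y) => n; case/andP: (gV n y).
have [] := @int_cvg _ T R M (fun n e => K (x - et e) * V n (et e))
   (fun e => K (x - et e) * V' (et e)) (fun=> B * kap^-1).
- move=> n; apply: measurable_funM; last exact: mV.
  by apply: (cmeas_comp (cmeas_sub met x)); exact: Binf_continuous.
- move=> n e; rewrite normrM ler_pM// ger0_norm; first by case/andP: (gV n (et e)).
  by case/andP: (gV n (et e)).
- exact: finite_measure_integrable_cst.
- by move=> e; apply: cvgM; [exact: cvg_cst|exact: cV].
move=> _ cv; apply: cvgV.
  rewrite lt0r_neq0// ltr_wpDr//; apply: pint_ge0 => e /=.
  by case/andP: (gV' (et e)).
by apply: cvgD; [exact: cvg_cst|exact: cv].
Qed.

End one_step.
Let step1 := potential_step M2 eta.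
Let step2 := potential_step M1 xi.

Fixpoint potential_iter (n : nat) : 'rV[R]_d -> R :=
  if n is n'.+1 then step2 (step1 (potential_iter n')) else fun=> kap^-1.

Let iter_spec n : good (potential_iter n) /\ Binf (potential_iter n).
Proof.
elim: n => [|n [gV BV]] /=.
  by split=> [x|]; [rewrite invr_ge0 (ltW kap0) lexx|exact: Binf_cst].
have mV : measurable_fun setT (potential_iter n \o eta).
  by apply: cmeas_comp => //; exact: Binf_continuous.
have gU := potential_step_good M2 eta gV.
have BU := potential_step_Binf M2 meta gV mV.
have mU : measurable_fun setT (step1 (potential_iter n) \o xi).
  by apply: cmeas_comp => //; exact: Binf_continuous.
by split; [exact: potential_step_good|exact: potential_step_Binf].
Qed.

Let iter_dec n x : potential_iter n.+1 x <= potential_iter n x.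
Proof.
have mV k : measurable_fun setT (potential_iter k \o eta).
  by apply: cmeas_comp => //; apply: Binf_continuous; case: (iter_spec k).
have gU k := potential_step_good M2 eta (iter_spec k).1.
have mU k : measurable_fun setT (step1 (potential_iter k) \o xi).
  apply: cmeas_comp => //; apply: Binf_continuous.
  exact: potential_step_Binf (iter_spec k).1 (mV k).
elim: n x => [x|n IH x].
  by case/andP: ((iter_spec 1).1 x).
change (step2 (step1 (potential_iter n.+1)) x <= step2 (step1 (potential_iter n)) x).
apply: (potential_step_le M1 mxi (gU n) (gU n.+1) (mU n) (mU n.+1)) => y.
exact: (potential_step_le M2 meta (iter_spec n.+1).1 (iter_spec n).1 (mV n.+1) (mV n)).
Qed.

(* [V |-> U |-> V] is order preserving, so the iteration started from the upper bound
   [1 / kap] decreases to a solution. *)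
Lemma potentials_exist : exists U V : 'rV[R]_d -> R,
  [/\ Binf U /\ Binf V, (forall x, 0 <= U x <= kap^-1) /\ (forall x, 0 <= V x <= kap^-1),
      forall x, U x = (kap + pint M2 eta (V \o eta) K x)^-1 &
      forall x, V x = (kap + pint M1 xi (U \o xi) K x)^-1].
Proof.
pose V x := limn (fun n => potential_iter n x).
have cV x : (fun n => potential_iter n x) @ \oo --> V x.
  apply: nonincreasing_is_cvgn; last first.
    exists 0 => _ [n _ <-]; by case/andP: ((iter_spec n).1 x).
  by apply/nonincreasing_seqP => n; exact: iter_dec.
have gV : good V.
  move=> y; apply/andP; split.
    by apply: seq_cvg_ge (cV y) => n; case/andP: ((iter_spec n).1 y).
  by apply: seq_cvg_le (cV y) => n; case/andP: ((iter_spec n).1 y).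
have mVn k : measurable_fun setT (potential_iter k \o eta).
  by apply: cmeas_comp => //; apply: Binf_continuous; case: (iter_spec k).
have mV : measurable_fun setT (V \o eta).
  by apply: (measurable_fun_cvg mVn) => e _; exact: cV.
(* Smoothness of the limits comes from the equations and not from the convergence, which is only
   pointwise: [potential_step] turns a bounded measurable function into a [Binf] one. *)
pose U := step1 V.
have gU : good U by exact: potential_step_good.
have BU : Binf U by exact: potential_step_Binf.
have mU : measurable_fun setT (U \o xi).
  by apply: cmeas_comp => //; exact: Binf_continuous.
have cU x : (fun n => step1 (potential_iter n) x) @ \oo --> U x.
  by apply: potential_step_cvg => // n; case: (iter_spec n).
have E x : V x = step2 U x.
  have c2 : (fun n => potential_iter n.+1 x) @ \oo --> step2 U x.
    apply: potential_step_cvg => // n.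
      by apply: potential_step_good; case: (iter_spec n).
    apply: cmeas_comp => //; apply: Binf_continuous.
    exact: potential_step_Binf (iter_spec n).1 (mVn n).
  apply: (cvg_unique (@Rhausdorff R)) c2.
  have := cV x; rewrite -(cvg_shiftS (fun n => potential_iter n x)).
  exact.
exists U, V; split => //.
have -> : V = step2 U by apply/funext.
by split => //; exact: potential_step_Binf.
Qed.

End schroedinger_potentials.

Section product_domination.
Context dT1 dT2 (T1 : measurableType dT1) (T2 : measurableType dT2) (R : realType).
Variables (M1 : probability T1 R) (M2 : probability T2 R).
Implicit Types (F G h : T1 * T2 -> R).

(* Domination by a product of integrable functions is stable under the algebra needed
   below and makes every iterated integral converge at every point, not only almost
   everywhere. *)
Definition DP F := measurable_fun setT F /\
  exists (w1 : T1 -> R) (w2 : T2 -> R), [/\ L1 M1 w1 /\ L1 M2 w2,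
    forall x, 0 <= w1 x, forall y, 0 <= w2 y &
    forall x y, `|F (x, y)| <= w1 x * w2 y].

Lemma DP_L1 F : DP F -> L1 (M1 \x M2)%E F.
Proof. by move=> [mF [w1 [w2 [[I1 I2] _ _ Fw]]]]; exact: prod_L1 Fw I1 I2. Qed.

Lemma DP_fub1 F : DP F -> L1 M1 (fun x => \int[M2]_y F (x, y)) /\
  \int[(M1 \x M2)%E]_z F z = \int[M1]_x \int[M2]_y F (x, y).
Proof. by move=> [mF [w1 [w2 [[I1 I2] _ _ Fw]]]]; exact: fub1 Fw I1 I2. Qed.

Lemma DP_fub2 F : DP F -> L1 M2 (fun y => \int[M1]_x F (x, y)) /\
  \int[(M1 \x M2)%E]_z F z = \int[M2]_y \int[M1]_x F (x, y).
Proof. by move=> [mF [w1 [w2 [[I1 I2] _ _ Fw]]]]; exact: fub2 Fw I1 I2. Qed.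

Lemma DP_fst F x : DP F -> L1 M2 (fun y => F (x, y)).
Proof. by move=> [mF [w1 [w2 [[I1 I2] _ _ Fw]]]]; exact: prod_L1_fst Fw I2. Qed.

Lemma DP_snd F y : DP F -> L1 M1 (fun x => F (x, y)).
Proof. by move=> [mF [w1 [w2 [[I1 I2] _ _ Fw]]]]; exact: prod_L1_snd Fw I1. Qed.

Lemma DPD F G : DP F -> DP G -> DP (fun z => F z + G z).
Proof.
move=> [mF [w1 [w2 [[I1 I2] w10 w20 Fw]]]] [mG [v1 [v2 [[J1 J2] v10 v20 Gw]]]].
split; first exact: measurable_funD.
exists (fun x => w1 x + v1 x), (fun y => w2 y + v2 y); split.
- by split; apply: L1D.
- by move=> x; rewrite addr_ge0.
- by move=> x; rewrite addr_ge0.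
move=> x y; rewrite (le_trans (ler_normD _ _))//.
have := Fw x y; have := Gw x y.
have := mulr_ge0 (w10 x) (v20 y); have := mulr_ge0 (v10 x) (w20 y).
by move=> *; rewrite mulrDl !mulrDr; lra.
Qed.

Lemma DP_bM h F : measurable_fun setT h -> bnd h -> DP F -> DP (fun z => h z * F z).
Proof.
move=> mh /bnd_gt0[C C0 hC] [mF [w1 [w2 [[I1 I2] w10 w20 Fw]]]].
split; first exact: measurable_funM.
exists (fun x => C * w1 x), w2; split => //.
- by split => //; apply: L1Z.
- by move=> x; rewrite mulr_ge0// ltW.
by move=> x y; rewrite normrM -mulrA ler_pM.
Qed.

Lemma DPZ c F : DP F -> DP (fun z => c * F z).
Proof. by apply: DP_bM => //; exact: bnd_cst. Qed.

Lemma DPN F : DP F -> DP (fun z => - F z).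
Proof.
move=> /(DPZ (-1)); rewrite (_ : (fun z => - F z) = fun z => -1 * F z)//.
by apply/funext => z; rewrite mulN1r.
Qed.

Lemma DP_12 (g1 : T1 -> R) (g2 : T2 -> R) : L1 M1 g1 -> L1 M2 g2 ->
  DP (fun z => g1 z.1 * g2 z.2).
Proof.
move=> I1 I2; split.
  apply: measurable_funM.
    by apply: (measurableT_comp (L1_meas I1)); exact: measurable_fst.
  by apply: (measurableT_comp (L1_meas I2)); exact: measurable_snd.
exists (fun x => `|g1 x|), (fun y => `|g2 y|); split => //.
- by split; apply: L1_norm.
- by move=> x y /=; rewrite normrM.
Qed.

Lemma DP_1 (g1 : T1 -> R) : L1 M1 g1 -> DP (fun z => g1 z.1).
Proof.
move=> I1; rewrite (_ : (fun _ => _) = fun z => g1 z.1 * 1).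
  by apply: (DP_12 (g2 := fun=> 1)) => //; exact: finite_measure_integrable_cst.
by apply/funext => z; rewrite mulr1.
Qed.

Lemma DP_2 (g2 : T2 -> R) : L1 M2 g2 -> DP (fun z => g2 z.2).
Proof.
move=> I2; rewrite (_ : (fun _ => _) = fun z => 1 * g2 z.2).
  by apply: (DP_12 (g1 := fun=> 1)) => //; exact: finite_measure_integrable_cst.
by apply/funext => z; rewrite mul1r.
Qed.

Lemma DP_bnd h : measurable_fun setT h -> bnd h -> DP h.
Proof.
move=> mh bh; rewrite (_ : h = fun z => h z * 1).
  by apply: DP_bM => //; apply: (DP_1 (g1 := fun=> 1)); exact: finite_measure_integrable_cst.
by apply/funext => z; rewrite mulr1.
Qed.

Lemma DP_sum (I : Type) (s : seq I) (F : I -> T1 * T2 -> R) :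
  (forall i, DP (F i)) -> DP (fun z => \sum_(i <- s) F i z).
Proof.
move=> dF; elim: s => [|i s IH].
  rewrite (_ : (fun _ => _) = fun=> 0); last by apply/funext => z; rewrite big_nil.
  by apply: DP_bnd => //; exact: bnd_cst.
rewrite (_ : (fun _ => _) = fun z => F i z + \sum_(j <- s) F j z); first exact: DPD.
by apply/funext => z; rewrite big_cons.
Qed.

End product_domination.

(** * The generator with frozen coefficients, and logarithmic gradients *)

Section generator.
Variables (R : realType) (d d1 : nat).
Implicit Types (s : 'M[R]_(d, d1)) (b : 'rV[R]_d) (f : 'rV[R]_d -> R).

(** The coefficients are arguments separate from the point [x] at which the derivatives are taken:
    after smoothing they belong to the undisplaced point. *)
Definition gen s b f (x : 'rV[R]_d) : R :=
  \sum_(i < d) \sum_(j < d) (s *m s^T) i j * pder i (pder j f) x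
  + \sum_(i < d) b 0 i * pder i f x.

Lemma cov_entry s i j : (s *m s^T) i j = \sum_k s i k * s j k.
Proof. by rewrite mxE; apply: eq_bigr => k _; rewrite mxE. Qed.

Lemma cov_quad s (v : 'I_d -> R) :
  \sum_i \sum_j (s *m s^T) i j * (v i * v j) = \sum_k (\sum_i s i k * v i) ^+ 2.
Proof.
under eq_bigr do under eq_bigr do rewrite cov_entry mulr_suml.
under eq_bigr do rewrite exchange_big/=.
rewrite exchange_big/=; apply: eq_bigr => k _.
rewrite expr2 mulr_suml; apply: eq_bigr => i _.
by rewrite mulr_sumr; apply: eq_bigr => j _; ring.
Qed.

(** The Hessian of [ln kden], that is, minus the Hessian of [ln k0]. *)
Definition cmat i j (x : 'rV[R]_d) : R := (i == j)%:R * k0 x - yk i x * yk j x.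

Lemma cmatN i j x : cmat i j (- x) = cmat i j x.
Proof. by rewrite /cmat k0N !ykN mulrNN. Qed.

Lemma Binf_cmat i j : Binf (cmat i j).
Proof.
apply: BinfD; first by apply: BinfZ; exact: Binf_k0.
by apply: BinfN; apply: BinfM; exact: Binf_yk.
Qed.

Lemma Binf_shift f (a : 'rV[R]_d) : Binf f -> Binf (fun x => f (x - a)).
Proof.
move=> /(Binf_affine (- a) 1); congr Binf; apply/funext => x.
by rewrite scale1r addrC.
Qed.

Lemma pder_shift f (a : 'rV[R]_d) i : Binf f ->
  pder i (fun x => f (x - a)) = (fun x => pder i f (x - a)).
Proof.
move=> /(pder_affine (- a) 1 i); rewrite (_ : (fun x => f (- a + _)) = fun x => f (x - a)).
  move=> ->; apply/funext => x; by rewrite mul1r scale1r addrC.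
by apply/funext => x; rewrite scale1r addrC.
Qed.

Section log_gradient.
Variables (U : 'rV[R]_d -> R) (c : R) (m : nat).
Hypotheses (BU : Binf U) (c0 : 0 < c) (cU : forall x, c <= U x).

Definition lU (i : 'I_d) : 'rV[R]_d -> R := pder i (fun x => ln (U x)).

Lemma Binf_lU i : Binf (lU i).
Proof. by apply: Binf_pder; exact: Binf_ln c0 cU BU. Qed.

Lemma U_gt0 x : 0 < U x. Proof. exact: lt_le_trans (cU x). Qed.

Lemma pder_lU i x : pder i U x = U x * lU i x.
Proof.
by rewrite /lU (pder_ln _ c0 cU BU) mulrA divff ?mul1r// lt0r_neq0// U_gt0.
Qed.

Variable a : 'rV[R]_d.
Let F x := U x * kern m (x - a).
Let al i x := lU i x - m%:R * yk i (x - a).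

Let BF : Binf F.
Proof. by apply: BinfM => //; apply: Binf_shift; exact: Binf_kern. Qed.

Let Bal i : Binf (al i).
Proof.
apply: BinfD; first exact: Binf_lU.
by apply: BinfN; apply: BinfZ; apply: Binf_shift; exact: Binf_yk.
Qed.

Lemma Binf_pot_kern : Binf F. Proof. exact: BF. Qed.

Lemma pder_pot_kern i : pder i F = (fun x => F x * al i x).
Proof.
rewrite pderM//; last by apply: Binf_shift; exact: Binf_kern.
rewrite pder_shift; last exact: Binf_kern.
apply/funext => x; rewrite pder_kern pder_lU /F /al; ring.
Qed.

Lemma pder_log_grad i j : pder i (al j) =
  (fun x => pder i (lU j) x - m%:R * cmat j i (x - a)).
Proof.
rewrite pderD; [|exact: Binf_lU|]; last first.
  by apply: BinfN; apply: BinfZ; apply: Binf_shift; exact: Binf_yk.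
rewrite pderN; last by apply: BinfZ; apply: Binf_shift; exact: Binf_yk.
rewrite pderZ; last by apply: Binf_shift; exact: Binf_yk.
by rewrite pder_shift ?pder_yk//; exact: Binf_yk.
Qed.

(** This is [L F = F (<A grad ln F, grad ln F> + L ln F)] with [ln F = ln U + m ln k0(. - a)]. The
    kernel part of [L ln F] is split off, since it is the one that produces the form [q]. *)
Lemma gen_pot_kern s b x : gen s b F x =
  F x * (\sum_i \sum_j (s *m s^T) i j * (al i x * al j x)
   + gen s b (fun x => ln (U x)) x
   - m%:R * (\sum_i \sum_j (s *m s^T) i j * cmat j i (x - a)
             + \sum_i b 0 i * yk i (x - a))).
Proof.
have EF i j : pder i (pder j F) x = F x * (al i x * al j x
    + pder i (lU j) x - m%:R * cmat j i (x - a)).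
  by rewrite (pder_pot_kern j) (pderM i BF (Bal j)) (pder_pot_kern i) pder_log_grad; ring.
rewrite /gen -/lU.
transitivity (\sum_i \sum_j F x * ((s *m s^T) i j * (al i x * al j x)
    + (s *m s^T) i j * pder i (lU j) x - m%:R * ((s *m s^T) i j * cmat j i (x - a)))
  + \sum_i F x * (b 0 i * lU i x - m%:R * (b 0 i * yk i (x - a)))).
  congr (_ + _); apply: eq_bigr => i _; last by rewrite (pder_pot_kern i) /al; ring.
  by apply: eq_bigr => j _; rewrite EF; ring.
have E1 i : \sum_j F x * ((s *m s^T) i j * (al i x * al j x)
    + (s *m s^T) i j * pder i (lU j) x - m%:R * ((s *m s^T) i j * cmat j i (x - a)))
  = F x * (\sum_j (s *m s^T) i j * (al i x * al j x)
    + \sum_j (s *m s^T) i j * pder i (lU j) x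
    - m%:R * \sum_j (s *m s^T) i j * cmat j i (x - a)).
  by rewrite -mulr_sumr big_split big_split/= sumrN mulr_sumr.
have E2 : \sum_i F x * (b 0 i * lU i x - m%:R * (b 0 i * yk i (x - a)))
  = F x * (\sum_i b 0 i * lU i x - m%:R * \sum_i b 0 i * yk i (x - a)).
  by rewrite -mulr_sumr big_split/= sumrN mulr_sumr.
rewrite E2 (eq_bigr _ (fun i _ => E1 i)) -mulr_sumr big_split big_split/= sumrN.
by rewrite -mulr_sumr -mulrDr; congr (_ * _); rewrite /gen -/lU; ring.
Qed.

(** The same logarithmic identity for [U] alone, solved for [U L ln U]; the square appears with a
    negative sign, which [log_generator_ge0] exploits. *)
Lemma gen_lnU s b x : U x * gen s b (fun x => ln (U x)) x =
  gen s b U x - U x * \sum_k (\sum_i s i k * lU i x) ^+ 2.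
Proof.
have EU i : pder i U = (fun x => U x * lU i x).
  by apply/funext => y; exact: pder_lU.
have BlU := Binf_lU.
have EUU i j : pder i (pder j U) x = U x * (lU i x * lU j x + pder i (lU j) x).
  rewrite (EU j) (pderM i BU (BlU j)) (EU i).
  by move: (U x) (lU i x) (lU j x) (pder i (lU j) x) => u v w t; ring.
rewrite -cov_quad /gen -/lU mulrDr !mulr_sumr addrAC; congr (_ + _); last first.
  by apply: eq_bigr => i _; rewrite (EU i) /lU; ring.
rewrite -sumrB; apply: eq_bigr => i _.
rewrite !mulr_sumr -sumrB; apply: eq_bigr => j _.
rewrite EUU -/(lU j).
by move: (U x) (lU i x) (lU j x) (pder i (lU j) x) => u v w t; ring.
Qed.

End log_gradient.
End generator.

(** * Smoothed solutions and the core inequality *)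

(* Smoothing replaces a solution [mu] by a random point [xi] with attached random
   coefficients [s], [be], so that the stationarity equation becomes [lift_gen];
   [lift_ibp] moves a derivative off the test function, which is not possible
   for [mu] itself. *)
Record lifted dT (T : measurableType dT) (R : realType) (d d1 : nat)
    (M : probability T R) (xi : T -> 'rV[R]_d) (s : T -> 'M[R]_(d, d1))
    (be : T -> 'rV[R]_d) (ta : 'I_d1 -> T -> R) : Prop := Lifted {
  lift_meas : cmeas xi;
  lift_s : forall i k, measurable_fun setT (fun e => s e i k);
  lift_s2 : forall i k, L1 M (fun e => s e i k ^+ 2);
  lift_b : forall i, L1 M (fun e => be e 0 i);
  lift_t : forall k, measurable_fun setT (ta k);
  lift_t2 : forall k, L1 M (fun e => ta k e ^+ 2);
  lift_gen : forall f, Binf f -> \int[M]_e gen (s e) (be e) f (xi e) = 0;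
  lift_ibp : forall f k, Binf f ->
    \int[M]_e (\sum_i s e i k * pder i f (xi e)) = \int[M]_e (ta k e * f (xi e)) }.

Lemma L1_sqr_bound dT (T : measurableType dT) (R : realType) (M : probability T R)
  (f : T -> R) : measurable_fun setT f -> L1 M (fun e => f e ^+ 2) -> L1 M f.
Proof.
move=> mf If; apply: (L1_le (g := fun e => 1 + f e ^+ 2)) => //.
  move=> e; rewrite -[X in _ + X]real_normK ?num_real//.
  by have := normr_ge0 (f e); nra.
by apply: L1D => //; exact: finite_measure_integrable_cst.
Qed.

Lemma L1_sqr_mul dT (T : measurableType dT) (R : realType) (M : probability T R)
  (f g : T -> R) : measurable_fun setT f -> measurable_fun setT g ->
  L1 M (fun e => f e ^+ 2) -> L1 M (fun e => g e ^+ 2) -> L1 M (fun e => f e * g e).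
Proof.
move=> mf mg If Ig; apply: (L1_le (g := fun e => f e ^+ 2 + g e ^+ 2)).
- exact: measurable_funM.
- move=> e; rewrite normrM -(real_normK (num_real (f e))) -(real_normK (num_real (g e))).
  by have := normr_ge0 (f e); have := normr_ge0 (g e); nra.
- exact: L1D.
Qed.

Section lifted_integrability.
Context dT (T : measurableType dT) (R : realType) (d d1 : nat).
Variables (M : probability T R) (xi : T -> 'rV[R]_d) (s : T -> 'M[R]_(d, d1)).
Variables (be : T -> 'rV[R]_d) (ta : 'I_d1 -> T -> R).
Hypothesis Hl : lifted M xi s be ta.

Lemma lift_sL1 i k : L1 M (fun e => s e i k).
Proof. apply: L1_sqr_bound; [exact: lift_s Hl _ _|exact: lift_s2 Hl _ _]. Qed.

Lemma lift_tL1 k : L1 M (ta k).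
Proof. apply: L1_sqr_bound; [exact: lift_t Hl _|exact: lift_t2 Hl _]. Qed.

Lemma lift_cov i j : L1 M (fun e => (s e *m (s e)^T) i j).
Proof.
under eq_fun do rewrite cov_entry.
apply: L1_sum => k; apply: L1_sqr_mul.
- exact: lift_s Hl _ _.
- exact: lift_s Hl _ _.
- exact: lift_s2 Hl _ _.
- exact: lift_s2 Hl _ _.
Qed.

Lemma lift_cmp_meas f : Binf f -> measurable_fun setT (fun e => f (xi e)).
Proof. by move=> /Binf_continuous; apply: cmeas_comp; exact: lift_meas Hl. Qed.

Lemma lift_cmp_bnd (f : 'rV[R]_d -> R) : Binf f -> bnd (fun e => f (xi e)).
Proof. by move=> /Binf_bnd[C hC]; exists C. Qed.

Lemma L1_mulb (f h : T -> R) : measurable_fun setT h -> bnd h -> L1 M f ->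
  L1 M (fun e => f e * h e).
Proof. by move=> mh bh If; under eq_fun do rewrite mulrC; exact: L1_bM. Qed.

Lemma lift_gen_L1 f : Binf f -> L1 M (fun e => gen (s e) (be e) f (xi e)).
Proof.
move=> Bf; apply: L1D.
  apply: L1_sum => i; apply: L1_sum => j; apply: L1_mulb; last exact: lift_cov.
    by apply: lift_cmp_meas; do 2 apply: Binf_pder.
  by apply: lift_cmp_bnd; do 2 apply: Binf_pder.
apply: L1_sum => i; apply: L1_mulb; last exact: lift_b Hl _.
  by apply: lift_cmp_meas; apply: Binf_pder.
by apply: lift_cmp_bnd; apply: Binf_pder.
Qed.

End lifted_integrability.

Lemma DP_Mb dT1 dT2 (T1 : measurableType dT1) (T2 : measurableType dT2)
  (R : realType) (M1 : probability T1 R) (M2 : probability T2 R) (F h : T1 * T2 -> R) :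
  measurable_fun setT h -> bnd h -> DP M1 M2 F -> DP M1 M2 (fun z => F z * h z).
Proof. by move=> mh bh If; under eq_fun do rewrite mulrC; exact: DP_bM. Qed.

(** * Testing one equation with [U K] and with [ln U] *)

Section diagonal_terms.
Context dT1 dT2 (T1 : measurableType dT1) (T2 : measurableType dT2).
Context (R : realType) (d d1 : nat).
Variables (M1 : probability T1 R) (M2 : probability T2 R).
Variables (xi : T1 -> 'rV[R]_d) (s : T1 -> 'M[R]_(d, d1)).
Variables (be : T1 -> 'rV[R]_d) (ta : 'I_d1 -> T1 -> R).
Hypothesis Hl : lifted M1 xi s be ta.
Variable (eta : T2 -> 'rV[R]_d).
Hypothesis meta : cmeas eta.
Variables (U V : 'rV[R]_d -> R) (c kap : R) (m : nat).
Hypotheses (BU : Binf U) (BV : Binf V) (c0 : 0 < c) (cU : forall x, c <= U x).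
Hypotheses (V0 : forall x, 0 <= V x) (kap0 : 0 < kap).
Hypothesis UE : forall x, U x = (kap + pint M2 eta (V \o eta) (kern m) x)^-1.

Definition dif (z : T1 * T2) : 'rV[R]_d := xi z.1 - eta z.2.
Definition plan (z : T1 * T2) : R := U (xi z.1) * kern m (dif z) * V (eta z.2).
Definition lgrad i (z : T1 * T2) : R := lU U i (xi z.1) - m%:R * yk i (dif z).

Let mxi := lift_meas Hl.

Lemma cmeas_fst : cmeas (fun z : T1 * T2 => xi z.1).
Proof. by move=> i; apply: (measurableT_comp (mxi i)); exact: measurable_fst. Qed.

Lemma cmeas_snd : cmeas (fun z : T1 * T2 => eta z.2).
Proof. by move=> i; apply: (measurableT_comp (meta i)); exact: measurable_snd. Qed.

Lemma cmeas_dif : cmeas dif.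
Proof.
move=> i; rewrite (_ : (fun _ => _) = fun z => xi z.1 0 i - eta z.2 0 i).
  by apply: measurable_funB; [exact: cmeas_fst|exact: cmeas_snd].
by apply/funext => z; rewrite !mxE.
Qed.

Lemma dif_meas f : Binf f -> measurable_fun setT (fun z => f (dif z)).
Proof. by move=> /Binf_continuous; apply: cmeas_comp; exact: cmeas_dif. Qed.

Lemma fst_meas f : Binf f -> measurable_fun setT (fun z : T1 * T2 => f (xi z.1)).
Proof. by move=> /Binf_continuous; apply: cmeas_comp; exact: cmeas_fst. Qed.

Lemma snd_meas f : Binf f -> measurable_fun setT (fun z : T1 * T2 => f (eta z.2)).
Proof. by move=> /Binf_continuous; apply: cmeas_comp; exact: cmeas_snd. Qed.

Lemma bnd_cmp (S : Type) (g : S -> 'rV[R]_d) (f : 'rV[R]_d -> R) :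
  Binf f -> bnd (fun z => f (g z)).
Proof. by move=> /Binf_bnd[C hC]; exists C. Qed.

Lemma plan_meas : measurable_fun setT plan.
Proof.
apply: measurable_funM; last exact: snd_meas.
by apply: measurable_funM; [exact: fst_meas|apply: dif_meas; exact: Binf_kern].
Qed.

Lemma plan_bnd : bnd plan.
Proof.
apply: bndM; last exact: bnd_cmp.
by apply: bndM; apply: bnd_cmp => //; exact: Binf_kern.
Qed.

Lemma plan_ge0 z : 0 <= plan z.
Proof.
by rewrite !mulr_ge0 ?(ltW (kern_gt0 _ _))// (le_trans (ltW c0)).
Qed.

Lemma lgrad_meas i : measurable_fun setT (lgrad i).
Proof.
apply: measurable_funB; first by apply: fst_meas; exact: Binf_lU c0 cU _.
by apply: measurable_funM => //; apply: dif_meas; exact: Binf_yk.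
Qed.

Lemma lgrad_bnd i : bnd (lgrad i).
Proof.
apply: bndD; first by apply: bnd_cmp; exact: Binf_lU c0 cU _.
by apply: bndN; apply: bndZ; apply: bnd_cmp; exact: Binf_yk.
Qed.

(** A rearrangement of [U (kap + K V) = 1], where [K V] is the integral of the kernel against
    [V]. *)
Lemma plan_marginal x : \int[M2]_y plan (x, y) = 1 - kap * U (xi x).
Proof.
have p0 : 0 <= pint M2 eta (V \o eta) (kern m) (xi x).
  by apply: pint_ge0 => [z|e]; [exact: ltW (kern_gt0 _ _)|exact: V0].
have -> : \int[M2]_y plan (x, y) = U (xi x) * pint M2 eta (V \o eta) (kern m) (xi x).
  rewrite -intZ; last first.
    apply: pint_L1 => //.
    - by apply: cmeas_comp => //; exact: Binf_continuous.
    - exact: bnd_cmp.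
    - by apply: Binf_continuous; exact: Binf_kern.
    - by apply: Binf_bnd; exact: Binf_kern.
  by apply: eq_Rintegral => y _; rewrite /plan /dif /= mulrA.
rewrite UE; field; rewrite lt0r_neq0//.
by rewrite ltr_wpDr.
Qed.

Let Q1 z := \sum_i \sum_j (s z.1 *m (s z.1)^T) i j * (lgrad i z * lgrad j z).
Let Q2 z := \sum_i \sum_j (s z.1 *m (s z.1)^T) i j * cmat j i (dif z)
             + \sum_i be z.1 0 i * yk i (dif z).
Let G0 e := gen (s e) (be e) (fun x => ln (U x)) (xi e).

Lemma DP_Q1 : DP M1 M2 (fun z => plan z * Q1 z).
Proof.
apply: DP_bM; [exact: plan_meas|exact: plan_bnd|].
apply: DP_sum => i; apply: DP_sum => j; apply: DP_Mb.
- by apply: measurable_funM; exact: lgrad_meas.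
- by apply: bndM; exact: lgrad_bnd.
- by apply: (DP_1 _ (lift_cov Hl i j)).
Qed.

Lemma DP_Q2 : DP M1 M2 (fun z => plan z * Q2 z).
Proof.
apply: DP_bM; [exact: plan_meas|exact: plan_bnd|].
apply: DPD.
  apply: DP_sum => i; apply: DP_sum => j; apply: DP_Mb.
  - by apply: dif_meas; exact: Binf_cmat.
  - by apply: bnd_cmp; exact: Binf_cmat.
  - by apply: (DP_1 _ (lift_cov Hl i j)).
apply: DP_sum => i; apply: DP_Mb.
- by apply: dif_meas; exact: Binf_yk.
- by apply: bnd_cmp; exact: Binf_yk.
- by apply: (DP_1 _ (lift_b Hl i)).
Qed.

(** Integrating out the second variable replaces [plan] by [1 - kap U]. The function [L ln U] has
    mean zero, so [- kap] times the integral of [U L ln U] remains; by [gen_lnU] and the mean zero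
    of [L U], that integral is minus the integral of a square. *)
Lemma log_generator_ge0 : 0 <= \int[(M1 \x M2)%E]_z (plan z * G0 z.1).
Proof.
have BlnU : Binf (fun x => ln (U x)) by exact: Binf_ln c0 cU BU.
have IG0 : L1 M1 G0 by exact: (lift_gen_L1 Hl BlnU).
have dpG : DP M1 M2 (fun z => plan z * G0 z.1).
  by apply: DP_bM; [exact: plan_meas|exact: plan_bnd|exact: DP_1].
have [_ ->] := DP_fub1 dpG.
have E1 e : \int[M2]_y (plan (e, y) * G0 e) = G0 e - kap * (U (xi e) * G0 e).
  rewrite RintegralZr ?plan_marginal//; first by ring.
  by apply: L1_bnd; [exact: measurable_fun_pair2 plan_meas|
    have [C hC] := plan_bnd; exists C].
under eq_Rintegral do rewrite /= E1.
have IUG : L1 M1 (fun e => U (xi e) * G0 e).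
  exact: L1_bM (lift_cmp_meas Hl BU) (bnd_cmp xi BU) IG0.
rewrite intB//; last exact: L1Z.
rewrite intZ// (lift_gen Hl BlnU) sub0r oppr_ge0 pmulr_rle0//.
have E2 e : U (xi e) * G0 e = gen (s e) (be e) U (xi e) -
    U (xi e) * \sum_k (\sum_i s e i k * lU U i (xi e)) ^+ 2.
  exact: gen_lnU c0 cU _ _ _.
have IQ : L1 M1 (fun e => U (xi e) * \sum_k (\sum_i s e i k * lU U i (xi e)) ^+ 2).
  have -> : (fun e => U (xi e) * \sum_k (\sum_i s e i k * lU U i (xi e)) ^+ 2) =
     (fun e => gen (s e) (be e) U (xi e) - U (xi e) * G0 e).
    by apply/funext => e; rewrite E2 subKr.
  exact: L1B (lift_gen_L1 Hl BU) IUG.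
under eq_Rintegral do rewrite E2.
rewrite intB//; last exact: (lift_gen_L1 Hl BU).
rewrite (lift_gen Hl BU) sub0r oppr_le0; apply: int_ge0 => e.
apply: mulr_ge0; first exact: le_trans (ltW c0) (cU _).
by apply: sumr_ge0 => k _; rewrite exprn_even_ge0.
Qed.

(** For each fixed second variable, the equation tested with [U K] has mean zero. Multiplied by [V]
    and integrated, the three pieces of [gen_pot_kern] sum to zero, and the piece with [L ln U] is
    nonnegative. *)
Lemma diagonal_terms_le :
  \int[(M1 \x M2)%E]_z (plan z * \sum_k (\sum_i s z.1 i k * lgrad i z) ^+ 2) <=
  m%:R * \int[(M1 \x M2)%E]_z (plan z * Q2 z).
Proof.
have BlnU : Binf (fun x => ln (U x)) by exact: Binf_ln c0 cU BU.
have IG0 : L1 M1 G0 by exact: (lift_gen_L1 Hl BlnU).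
have dpG : DP M1 M2 (fun z => plan z * G0 z.1).
  by apply: DP_bM; [exact: plan_meas|exact: plan_bnd|exact: DP_1].
pose Z z := plan z * Q1 z + plan z * G0 z.1 - m%:R * (plan z * Q2 z).
have dpZ : DP M1 M2 Z.
  apply: DPD; first by apply: DPD => //; exact: DP_Q1.
  by apply: DPN; apply: DPZ; exact: DP_Q2.
have ZE x y : Z (x, y) = V (eta y) *
    gen (s x) (be x) (fun u => U u * kern m (u - eta y)) (xi x).
  rewrite (gen_pot_kern _ BU c0 cU) /Z /plan /Q1 /Q2 /G0 /lgrad /dif /=.
  set q1 := \sum_i _; set q2 := \sum_i \sum_j _ * cmat _ _ _ + _.
  by set g := gen _ _ _ _; ring.
have Z0 : \int[(M1 \x M2)%E]_z Z z = 0.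
  have [_ ->] := DP_fub2 dpZ.
  transitivity (\int[M2]_y (0 : R)); last by rewrite int_cst.
  apply: eq_Rintegral => y _; under eq_Rintegral do rewrite ZE.
  have Bk : Binf (fun u => U u * kern m (u - eta y)) by exact: Binf_pot_kern.
  by rewrite intZ ?(lift_gen Hl Bk) ?mulr0//; exact: (lift_gen_L1 Hl Bk).
have := Z0; rewrite /Z intB; last 2 first.
- by apply: DP_L1; apply: DPD => //; exact: DP_Q1.
- by apply: DP_L1; apply: DPZ; exact: DP_Q2.
rewrite intD; [|exact: DP_L1 DP_Q1|exact: DP_L1].
rewrite intZ; last exact: DP_L1 DP_Q2.
have := log_generator_ge0.
have -> : \int[(M1 \x M2)%E]_z (plan z * Q1 z) =
  \int[(M1 \x M2)%E]_z (plan z * \sum_k (\sum_i s z.1 i k * lgrad i z) ^+ 2).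
  by apply: eq_Rintegral => z _; rewrite /Q1 cov_quad.
by rewrite /Q2; move=> h1 h2; lra.
Qed.

End diagonal_terms.

Lemma Binf_sum (R : realType) (d : nat) (I : Type) (r : seq I)
    (F : I -> 'rV[R]_d -> R) :
  (forall j, Binf (F j)) -> Binf (fun x => \sum_(j <- r) F j x).
Proof. by move=> BF n; apply: BI_sum => j; exact: BF. Qed.

Lemma pder_sum (R : realType) (d : nat) (I : Type) (r : seq I)
    (F : I -> 'rV[R]_d -> R) (i : 'I_d) : (forall j, Binf (F j)) ->
  pder i (fun x => \sum_(j <- r) F j x) = (fun x => \sum_(j <- r) pder i (F j) x).
Proof.
move=> BF; elim: r => [|j r IH].
  rewrite (_ : (fun _ => _) = fun=> 0); last by apply/funext => x; rewrite big_nil.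
  by rewrite pder_cst; apply/funext => x; rewrite big_nil.
rewrite (_ : (fun _ => _) = fun x => F j x + \sum_(k <- r) F k x); last first.
  by apply/funext => x; rewrite big_cons.
rewrite pderD//; last exact: Binf_sum.
by rewrite IH; apply/funext => x; rewrite big_cons.
Qed.

Section product_swap.
Context dT1 dT2 (T1 : measurableType dT1) (T2 : measurableType dT2) (R : realType).
Variables (M1 : probability T1 R) (M2 : probability T2 R).

Lemma DP_swap (G : T1 * T2 -> R) : DP M1 M2 G -> DP M2 M1 (fun z => G (z.2, z.1)).
Proof.
move=> [mG [w1 [w2 [[I1 I2] w10 w20 Gw]]]]; split.
  by apply: (measurableT_comp mG); exact: measurable_fun_pair.
exists w2, w1; split => // x y; by rewrite mulrC.
Qed.

Lemma int_swap (G : T1 * T2 -> R) : DP M1 M2 G ->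
  \int[(M2 \x M1)%E]_z G (z.2, z.1) = \int[(M1 \x M2)%E]_z G z.
Proof.
by move=> dG; have [_ ->] := DP_fub1 (DP_swap dG); have [_ ->] := DP_fub2 dG.
Qed.

End product_swap.

(** * Mixed terms and the lower bound for the integral of [k0 q] *)

Section core_inequality.
Context dT1 dT2 (T1 : measurableType dT1) (T2 : measurableType dT2).
Context (R : realType) (d d1 : nat).
Variables (M1 : probability T1 R) (M2 : probability T2 R).
Variables (xi : T1 -> 'rV[R]_d) (s : T1 -> 'M[R]_(d, d1)).
Variables (be : T1 -> 'rV[R]_d) (ta : 'I_d1 -> T1 -> R).
Variables (eta : T2 -> 'rV[R]_d) (s' : T2 -> 'M[R]_(d, d1)).
Variables (be' : T2 -> 'rV[R]_d) (ta' : 'I_d1 -> T2 -> R).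
Hypotheses (H1 : lifted M1 xi s be ta) (H2 : lifted M2 eta s' be' ta').
Variables (U V : 'rV[R]_d -> R) (c kap : R) (m : nat).
Hypotheses (BU : Binf U) (BV : Binf V) (c0 : 0 < c) (kap0 : 0 < kap).
Hypotheses (cU : forall x, c <= U x) (cV : forall x, c <= V x).
Hypothesis UE : forall x, U x = (kap + pint M2 eta (V \o eta) (kern m) x)^-1.
Hypothesis VE : forall x, V x = (kap + pint M1 xi (U \o xi) (kern m) x)^-1.

Let mxi := lift_meas H1.
Let meta := lift_meas H2.
Let U0 x : 0 <= U x. Proof. exact: le_trans (ltW c0) (cU x). Qed.
Let V0 x : 0 <= V x. Proof. exact: le_trans (ltW c0) (cV x). Qed.

Let MM := (M1 \x M2)%E.
Let dz (z : T1 * T2) : 'rV[R]_d := xi z.1 - eta z.2.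
Let P := plan xi eta U V m.
Let a (i : 'I_d) (z : T1 * T2) : R := lgrad xi eta U m i z.
(** The logarithmic gradient of [P] in the second variable. Its kernel part has the sign opposite to
    that in [a], because [eta] enters the difference negatively. *)
Let a' (i : 'I_d) (z : T1 * T2) : R := lU V i (eta z.2) + m%:R * yk i (dz z).
Let u k (z : T1 * T2) : R := \sum_i s z.1 i k * a i z.
Let v k (z : T1 * T2) : R := \sum_i s' z.2 i k * a' i z.

Let P_meas : measurable_fun setT P := plan_meas H1 meta m BU BV.
Let P_bnd : bnd P := plan_bnd xi eta m BU BV.
Let P_ge0 z : 0 <= P z := plan_ge0 xi eta m c0 cU V0 z.
Let a_meas i : measurable_fun setT (a i) := lgrad_meas H1 meta m BU c0 cU i.
Let a_bnd i : bnd (a i) := lgrad_bnd xi eta m BU c0 cU i.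

Let mdz : cmeas dz := cmeas_dif H1 meta.
Let mdif f : Binf f -> measurable_fun setT (fun z => f (dz z)).
Proof. by move=> /Binf_continuous; apply: cmeas_comp. Qed.

Let a'_meas i : measurable_fun setT (a' i).
Proof.
apply: measurable_funD; last by apply: measurable_funM => //; apply: mdif; exact: Binf_yk.
apply: cmeas_comp; first exact: (cmeas_snd meta).
by apply: Binf_continuous; exact: Binf_lU BV c0 cV _.
Qed.

Let a'_bnd i : bnd (a' i).
Proof.
apply: bndD; first by apply: (bnd_cmp (fun z : T1 * T2 => eta z.2)); exact: Binf_lU BV c0 cV _.
by apply: bndZ; apply: (bnd_cmp dz); exact: Binf_yk.
Qed.

Let planE x y : plan eta xi V U m (y, x) = P (x, y).
Proof.
by rewrite /P /plan /dif /= -(kernN m (eta y - xi x)) opprB; ring.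
Qed.

Let lgradE i x y : lgrad eta xi V m i (y, x) = a' i (x, y).
Proof.
by rewrite /lgrad /a' /dif /dz /= -(opprB (xi x) (eta y)) ykN mulrN opprK.
Qed.

Let DP_ss i j k : DP M1 M2 (fun z => s z.1 i k * s' z.2 j k).
Proof. exact: (DP_12 (lift_sL1 H1 i k) (lift_sL1 H2 j k)). Qed.

Let DP_uv k : DP M1 M2 (fun z => P z * (u k z * v k z)).
Proof.
apply: DP_bM => //.
rewrite (_ : (fun z => u k z * v k z) =
  fun z => \sum_i \sum_j (s z.1 i k * s' z.2 j k) * (a i z * a' j z)).
  apply: DP_sum => i; apply: DP_sum => j; apply: DP_Mb; last exact: DP_ss.
  - exact: measurable_funM.
  - exact: bndM.
apply/funext => z; rewrite /u /v mulr_suml; apply: eq_bigr => i _.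
by rewrite mulr_sumr; apply: eq_bigr => j _; ring.
Qed.

(** Up to the factor [m], the mixed second derivatives of [ln P] contracted with column [k] of the
    two noise matrices: [a'] depends on the first variable through [yk], whose derivative is
    [cmat]. *)
Let CC k (z : T1 * T2) : R := \sum_i \sum_j s z.1 i k * s' z.2 j k * cmat j i (dz z).

Let DP_CC k : DP M1 M2 (fun z => P z * CC k z).
Proof.
apply: DP_bM => //; apply: DP_sum => i; apply: DP_sum => j.
apply: DP_Mb; last exact: DP_ss.
- by apply: mdif; exact: Binf_cmat.
- by apply: (bnd_cmp dz); exact: Binf_cmat.
Qed.

Let DP_tt k : DP M1 M2 (fun z => P z * (ta k z.1 * ta' k z.2)).
Proof. by apply: DP_bM => //; exact: (DP_12 (lift_tL1 H1 k) (lift_tL1 H2 k)). Qed.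

Let DP_tv k : DP M1 M2 (fun z => ta k z.1 * (P z * v k z)).
Proof.
rewrite (_ : (fun _ => _) = fun z => P z * \sum_j (ta k z.1 * s' z.2 j k) * a' j z).
  apply: DP_bM => //; apply: DP_sum => j; apply: DP_Mb => //.
  exact: (DP_12 (lift_tL1 H1 k) (lift_sL1 H2 j k)).
apply/funext => z; rewrite mulrCA; congr (_ * _); rewrite /v mulr_sumr.
by apply: eq_bigr => j _; rewrite mulrA.
Qed.

(** With the first variable fixed, [P] is a constant times a test function of the second, and [P a']
    is its gradient; the integration by parts of the second solution applies to it. *)
Let ibp_second k : \int[MM]_z (ta k z.1 * (P z * v k z)) =
  \int[MM]_z (P z * (ta k z.1 * ta' k z.2)).
Proof.
rewrite /MM; have [_ ->] := DP_fub1 (DP_tv k); have [_ ->] := DP_fub1 (DP_tt k).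
apply: eq_Rintegral => x _.
pose f y := V y * kern m (y - xi x).
have Bf : Binf f by exact: Binf_pot_kern.
have E1 y : ta k x * (P (x, y) * v k (x, y)) =
    ta k x * U (xi x) * \sum_j s' y j k * pder j f (eta y).
  rewrite -mulrA; congr (_ * _); rewrite /v !mulr_sumr; apply: eq_bigr => j _.
  rewrite (pder_pot_kern m BV c0 cV) -planE -lgradE /plan /lgrad /dif /f /=.
  by move: (lU _ _ _) => w; ring.
have E2 y : P (x, y) * (ta k x * ta' k y) =
    ta k x * U (xi x) * (ta' k y * f (eta y)).
  by rewrite -planE /plan /dif /f /=; ring.
under eq_Rintegral do rewrite /= E1.
under [RHS]eq_Rintegral do rewrite /= E2.
rewrite !intZ ?(lift_ibp H2)//.
- apply: L1_mulb; [exact: lift_cmp_meas H2 _ Bf|exact: (bnd_cmp eta)|exact: lift_tL1 H2 k].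
- apply: L1_sum => j; apply: L1_mulb; last exact: lift_sL1 H2 j k.
    by apply: (lift_cmp_meas H2); exact: Binf_pder.
  by apply: (bnd_cmp eta); exact: Binf_pder.
Qed.

(** With the second variable fixed, [P v] is a test function [g] of the first. Its derivative falls
    once on [P], giving [P u v], and once on [a'], giving [m P CC]; the integration by parts of the
    first solution then trades both for the score [ta]. *)
Let ibp_first k : \int[MM]_z (P z * (u k z * v k z) + m%:R * (P z * CC k z)) =
  \int[MM]_z (ta k z.1 * (P z * v k z)).
Proof.
have dL : DP M1 M2 (fun z => P z * (u k z * v k z) + m%:R * (P z * CC k z)).
  by apply: DPD => //; apply: DPZ.
rewrite /MM; have [_ ->] := DP_fub2 dL; have [_ ->] := DP_fub2 (DP_tv k).
apply: eq_Rintegral => y _.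
pose F x := U x * kern m (x - eta y).
have BF : Binf F by exact: Binf_pot_kern.
pose b j x := lU V j (eta y) + m%:R * yk j (x - eta y).
have Byk j : Binf (fun x => yk j (x - eta y)) by apply: Binf_shift; exact: Binf_yk.
have Bb j : Binf (b j) by apply: BinfD; [exact: Binf_cst|exact: BinfZ].
pose g x := V (eta y) * \sum_j s' y j k * (F x * b j x).
have BFb j : Binf (fun x => F x * b j x) by exact: BinfM.
have Bs : Binf (fun x => \sum_j s' y j k * (F x * b j x)).
  by apply: Binf_sum => j; exact: BinfZ.
have Bg : Binf g by exact: BinfZ.
have pb i j : pder i (b j) = fun x => m%:R * cmat j i (x - eta y).
  rewrite pderD; [|exact: Binf_cst|exact: BinfZ].
  rewrite pder_cst (pderZ _ _ (Byk j)).
  rewrite pder_shift; last exact: Binf_yk.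
  by rewrite pder_yk; apply/funext => x; rewrite add0r.
have pg i x : pder i g x = V (eta y) * \sum_j s' y j k *
   (F x * ((lU U i x - m%:R * yk i (x - eta y)) * b j x + m%:R * cmat j i (x - eta y))).
  rewrite (pderZ _ _ Bs) pder_sum => [|j]; last exact: BinfZ.
  congr (_ * _); apply: eq_bigr => j _; rewrite (pderZ _ _ (BFb j)); congr (_ * _).
  rewrite (pderM _ BF (Bb j)) pb (pder_pot_kern m BU c0 cU) /F /=.
  by move: (lU _ _ _) (cmat _ _ _) (b j x) => w1 w2 w3; ring.
have E1 x : P (x, y) * (u k (x, y) * v k (x, y)) + m%:R * (P (x, y) * CC k (x, y)) =
    \sum_i s x i k * pder i g (xi x).
  transitivity (\sum_i \sum_j (P (x, y) * (s x i k * a i (x, y) * (s' y j k * a' j (x, y)))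
      + m%:R * (P (x, y) * (s x i k * s' y j k * cmat j i (dz (x, y)))))).
    under [RHS]eq_bigr do rewrite big_split/=.
    rewrite big_split/=; congr (_ + _).
      rewrite /u mulr_suml mulr_sumr; apply: eq_bigr => i _.
      by rewrite /v !mulr_sumr.
    rewrite /CC !mulr_sumr; apply: eq_bigr => i _.
    by rewrite !mulr_sumr.
  apply: eq_bigr => i _; rewrite pg !mulr_sumr; apply: eq_bigr => j _.
  rewrite /P /plan /dif /a /lgrad /a' /dz /b /F /=.
  move: (lU V _ _) (lU U _ _) (cmat _ _ _) => w1 w2 w3; ring.
have E2 x : ta k x * (P (x, y) * v k (x, y)) = ta k x * g (xi x).
  congr (_ * _); rewrite /g /v !mulr_sumr; apply: eq_bigr => j _.
  rewrite /P /plan /dif /a' /dz /b /F /=; move: (lU _ _ _) => w; ring.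
under eq_Rintegral do rewrite /= E1.
under [RHS]eq_Rintegral do rewrite /= E2.
exact: (lift_ibp H1 k Bg).
Qed.

Let cross_terms k : \int[MM]_z (P z * (u k z * v k z)) =
  \int[MM]_z (P z * (ta k z.1 * ta' k z.2)) - m%:R * \int[MM]_z (P z * CC k z).
Proof.
rewrite -ibp_second -ibp_first intD; [|exact: DP_L1|by apply: DP_L1; exact: DPZ].
by rewrite intZ ?addrK//; exact: DP_L1.
Qed.

(** The form [q] with the coefficients attached to the two sample points, but with the difference
    [dz] of the displaced points in the drift part. *)
Definition qhat (z : T1 * T2) : R :=
  \sum_k \sum_i (s z.1 i k - s' z.2 i k) ^+ 2
  + \sum_i (be z.1 0 i - be' z.2 0 i) * dz z 0 i.

Let Q2 z := \sum_i \sum_j (s z.1 *m (s z.1)^T) i j * cmat j i (dz z)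
             + \sum_i be z.1 0 i * yk i (dz z).
Let Q2' z := \sum_i \sum_j (s' z.2 *m (s' z.2)^T) i j * cmat j i (dz z)
             - \sum_i be' z.2 0 i * yk i (dz z).

Let cmat_bilinear (p q : 'I_d -> R) x : \sum_i \sum_j p i * q j * cmat j i x =
  k0 x * \sum_i p i * q i - (\sum_i p i * yk i x) * (\sum_j q j * yk j x).
Proof.
rewrite mulr_suml mulr_sumr -sumrB; apply: eq_bigr => i _.
under eq_bigr do rewrite /cmat mulrBr.
rewrite big_split/= sumrN; congr (_ - _).
  rewrite (bigD1 i)//= eqxx mul1r big1 ?addr0; first by ring.
  by move=> j /negbTE ->; rewrite mul0r mulr0.
by rewrite mulr_sumr; apply: eq_bigr => j _; ring.
Qed.

Let cov_cmat (S : 'M[R]_(d, d1)) x : \sum_i \sum_j (S *m S^T) i j * cmat j i x =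
  \sum_k \sum_i \sum_j S i k * S j k * cmat j i x.
Proof.
under eq_bigr do under eq_bigr do rewrite cov_entry mulr_suml.
under eq_bigr do rewrite exchange_big/=.
by rewrite exchange_big.
Qed.

(** For each column [k] the three [cmat] contractions combine into the quadratic form of [cmat] at
    the difference of the columns of [s] and [s']. Its rank one part is minus a square and is
    dropped; the drift part is an identity because [yk] is [k0] times the coordinate. *)
Let drift_le z : Q2 z + Q2' z - 2 * \sum_k CC k z <= k0 (dz z) * qhat z.
Proof.
rewrite /Q2 /Q2' !cov_cmat.
have -> : \sum_k \sum_i \sum_j s z.1 i k * s z.1 j k * cmat j i (dz z) +
    \sum_i be z.1 0 i * yk i (dz z) +
    (\sum_k \sum_i \sum_j s' z.2 i k * s' z.2 j k * cmat j i (dz z) -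
     \sum_i be' z.2 0 i * yk i (dz z)) - 2 * \sum_k CC k z =
    \sum_k (k0 (dz z) * \sum_i (s z.1 i k - s' z.2 i k) ^+ 2 -
      (\sum_i (s z.1 i k - s' z.2 i k) * yk i (dz z)) ^+ 2) +
    k0 (dz z) * \sum_i (be z.1 0 i - be' z.2 0 i) * dz z 0 i.
  set A := \sum_k \sum_i \sum_j s _ _ _ * _ * _; set B := \sum_i be _ _ _ * _.
  set A' := \sum_k \sum_i \sum_j s' _ _ _ * _ * _; set B' := \sum_i be' _ _ _ * _.
  rewrite (_ : k0 (dz z) * _ = B - B'); last first.
    by rewrite mulr_sumr -sumrB; apply: eq_bigr => i _; rewrite /yk; ring.
  rewrite [X in _ = X + _](_ : _ = A + A' - 2 * \sum_k CC k z) /=; first by ring.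
  rewrite mulr_sumr -sumrN -!big_split/=; apply: eq_bigr => k _.
  rewrite /CC !cmat_bilinear.
  have -> : \sum_i (s z.1 i k - s' z.2 i k) ^+ 2 = \sum_i s z.1 i k * s z.1 i k
     + \sum_i s' z.2 i k * s' z.2 i k - 2 * \sum_i s z.1 i k * s' z.2 i k.
    by rewrite mulr_sumr -sumrN -!big_split/=; apply: eq_bigr => i _; ring.
  have -> : \sum_i (s z.1 i k - s' z.2 i k) * yk i (dz z) =
      \sum_i s z.1 i k * yk i (dz z) - \sum_i s' z.2 i k * yk i (dz z).
    by rewrite -sumrB; apply: eq_bigr => i _; ring.
  by ring.
rewrite /qhat mulrDr lerD2r mulr_sumr; apply: ler_sum => k _.
by rewrite gerBl exprn_even_ge0.
Qed.

(** In the drift part [k0] is absorbed into the bounded [yk], so that integrability of the drifts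
    suffices and no moment of the points is involved. *)
Lemma core_DP : DP M1 M2 (fun z => P z * (k0 (dz z) * qhat z)).
Proof.
apply: DP_bM => //.
rewrite (_ : (fun z => k0 (dz z) * qhat z) = fun z =>
  k0 (dz z) * \sum_k \sum_i (s z.1 i k ^+ 2 + s' z.2 i k ^+ 2 - 2 * (s z.1 i k * s' z.2 i k))
  + \sum_i (be z.1 0 i - be' z.2 0 i) * yk i (dz z)); last first.
  apply/funext => z; rewrite /qhat mulrDr; congr (_ + _).
    by congr (_ * _); apply: eq_bigr => k _; apply: eq_bigr => i _; ring.
  by rewrite mulr_sumr; apply: eq_bigr => i _; rewrite /yk; ring.
apply: DPD.
  apply: DP_bM.
  - by apply: mdif; exact: Binf_k0.
  - by apply: (bnd_cmp dz); exact: Binf_k0.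
  apply: DP_sum => k; apply: DP_sum => i; apply: DPD; last by apply: DPN; exact: DPZ.
  by apply: DPD; [exact: (DP_1 _ (lift_s2 H1 i k))|exact: (DP_2 _ (lift_s2 H2 i k))].
apply: DP_sum => i; apply: DP_Mb.
- by apply: mdif; exact: Binf_yk.
- by apply: (bnd_cmp dz); exact: Binf_yk.
by apply: DPD; [exact: (DP_1 _ (lift_b H1 i))|apply: DPN; exact: (DP_2 _ (lift_b H2 i))].
Qed.

(* [u] and [v] are the components of the logarithmic gradient of [P] along the two noises;
   the inequality is the positivity of the [P]-integral of [|u + v|^2]. *)
Lemma core_inequality : 
  - (\sum_k (\int[M1]_e (ta k e ^+ 2) + \int[M2]_e (ta' k e ^+ 2))) <=
  m%:R * \int[MM]_z (P z * (k0 (dz z) * qhat z)).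
Proof.
have dgl1 := diagonal_terms_le H1 meta BU BV c0 cU V0 kap0 UE.
have dgl2 := diagonal_terms_le H2 mxi BV BU c0 cV U0 kap0 VE.
have dU : DP M1 M2 (fun z => P z * \sum_k u k z ^+ 2).
  have := DP_Q1 M2 H1 meta m BU BV c0 cU.
  by under eq_fun do rewrite cov_quad.
have dV : DP M1 M2 (fun z => P z * \sum_k v k z ^+ 2).
  have := DP_swap (DP_Q1 M1 H2 mxi m BV BU c0 cV).
  under eq_fun do rewrite cov_quad; congr DP; apply/funext => -[x y].
  rewrite planE; congr (_ * _); apply: eq_bigr => k _; congr (_ ^+ _).
  by apply: eq_bigr => i _; rewrite lgradE.
have dQ : DP M1 M2 (fun z => P z * Q2 z) by exact: (DP_Q2 M2 H1 meta m BU BV).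
have Q2E x y : \sum_i \sum_j (s' y *m (s' y)^T) i j * cmat j i (dif eta xi (y, x)) +
    \sum_i be' y 0 i * yk i (dif eta xi (y, x)) = Q2' (x, y).
  rewrite /dif /Q2' /dz /= -(opprB (xi x)); congr (_ + _).
    by apply: eq_bigr => i _; apply: eq_bigr => j _; rewrite cmatN.
  by rewrite -sumrN; apply: eq_bigr => i _; rewrite ykN mulrN.
have dQ' : DP M1 M2 (fun z => P z * Q2' z).
  have := DP_swap (DP_Q2 M1 H2 mxi m BV BU).
  by congr DP; apply/funext => -[x y]; rewrite planE Q2E.
have {}dgl2 : \int[MM]_z (P z * \sum_k v k z ^+ 2) <= m%:R * \int[MM]_z (P z * Q2' z).
  rewrite /MM -(int_swap dV) -(int_swap dQ').
  move: dgl2; congr (_ <= _ * _); apply: eq_Rintegral => -[y x] _; rewrite planE ?Q2E//.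
  congr (_ * _); apply: eq_bigr => k _; congr (_ ^+ _).
  by apply: eq_bigr => i _; rewrite lgradE.
have sq : 0 <= \int[MM]_z (P z * \sum_k u k z ^+ 2) + \int[MM]_z (P z * \sum_k v k z ^+ 2)
   + 2 * \sum_k \int[MM]_z (P z * (u k z * v k z)).
  have dUV : DP M1 M2 (fun z => \sum_k P z * (u k z * v k z)) by exact: DP_sum.
  rewrite -int_sum => [|k]; last exact: DP_L1.
  rewrite -intZ; last exact: DP_L1.
  rewrite -intD; [|exact: DP_L1|exact: DP_L1].
  rewrite -intD; [|by apply: DP_L1; exact: DPD|by apply: DP_L1; exact: DPZ].
  apply: int_ge0 => z.
  rewrite (_ : _ + _ = P z * \sum_k (u k z + v k z) ^+ 2).
    by rewrite mulr_ge0//; apply: sumr_ge0 => k _; rewrite exprn_even_ge0.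
  rewrite !mulr_sumr -!big_split/=; apply: eq_bigr => k _; ring.
(* From [2 t t' <= t^2 + t'^2] and the fact that both marginals of [P] have densities at most 1. The
   bound is independent of [m], which is what allows [m] to absorb it later. *)
have tt k : 2 * \int[MM]_z (P z * (ta k z.1 * ta' k z.2)) <=
    \int[M1]_e (ta k e ^+ 2) + \int[M2]_e (ta' k e ^+ 2).
  have d1' : DP M1 M2 (fun z => P z * ta k z.1 ^+ 2).
    by apply: DP_bM => //; exact: (DP_1 _ (lift_t2 H1 k)).
  have d2' : DP M1 M2 (fun z => P z * ta' k z.2 ^+ 2).
    by apply: DP_bM => //; exact: (DP_2 _ (lift_t2 H2 k)).
  rewrite -intZ; last exact: DP_L1.
  apply: (@le_trans _ _ (\int[MM]_z (P z * ta k z.1 ^+ 2 + P z * ta' k z.2 ^+ 2))).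
    apply: int_le; [by apply: DP_L1; exact: DPZ|by apply: DP_L1; exact: DPD|].
    move=> z; have := P_ge0 z; move: (P z) (ta k z.1) (ta' k z.2) => p t t' p0.
    by have := sqr_ge0 (t - t'); rewrite sqrrB; nra.
  rewrite intD; [|exact: DP_L1|exact: DP_L1]; apply: lerD.
    rewrite /MM; have [I ->] := DP_fub1 d1'; apply: int_le => //; first exact: lift_t2 H1 k.
    move=> x /=; rewrite RintegralZr//; last first.
      by apply: L1_bnd; [exact: measurable_fun_pair2|have [C hC] := P_bnd; exists C].
    rewrite (plan_marginal xi meta BV V0 kap0 UE)// ler_piMl ?exprn_even_ge0//.
    by rewrite gerBl mulr_ge0// ltW.
  rewrite /MM; have [I ->] := DP_fub2 d2'; apply: int_le => //; first exact: lift_t2 H2 k.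
  move=> y /=; rewrite RintegralZr//; last first.
    by apply: L1_bnd; [exact: measurable_fun_pair1|have [C hC] := P_bnd; exists C].
  under eq_Rintegral do rewrite -planE.
  rewrite (plan_marginal eta mxi BU U0 kap0 VE)// ler_piMl ?exprn_even_ge0//.
  by rewrite gerBl mulr_ge0// ltW.
have dC : DP M1 M2 (fun z => \sum_k P z * CC k z) by exact: DP_sum.
have dk := core_DP.
have dr : \int[MM]_z (P z * Q2 z) + \int[MM]_z (P z * Q2' z)
    - 2 * \sum_k \int[MM]_z (P z * CC k z) <= \int[MM]_z (P z * (k0 (dz z) * qhat z)).
  rewrite -int_sum => [|k]; last exact: DP_L1.
  rewrite -intZ; last exact: DP_L1.
  rewrite -intD; [|exact: DP_L1|exact: DP_L1].
  rewrite -intB; [|by apply: DP_L1; exact: DPD|by apply: DP_L1; exact: DPZ].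
  apply: int_le; [|exact: DP_L1|].
    by apply: DP_L1; apply: DPD; [exact: DPD|apply: DPN; exact: DPZ].
  move=> z; rewrite (_ : _ - _ = P z * (Q2 z + Q2' z - 2 * \sum_k CC k z)).
    by rewrite ler_wpM2l.
  by rewrite -mulr_sumr; ring.
have tts : 2 * \sum_k \int[MM]_z (P z * (ta k z.1 * ta' k z.2)) <=
    \sum_k (\int[M1]_e (ta k e ^+ 2) + \int[M2]_e (ta' k e ^+ 2)).
  by rewrite mulr_sumr; apply: ler_sum => k _.
have cr : \sum_k \int[MM]_z (P z * (u k z * v k z)) =
    \sum_k \int[MM]_z (P z * (ta k z.1 * ta' k z.2))
    - m%:R * \sum_k \int[MM]_z (P z * CC k z).
  by rewrite mulr_sumr -sumrB; apply: eq_bigr => k _; exact: cross_terms.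
rewrite cr in sq.
have := ler_wpM2l (ler0n R m) dr.
move: sq tts dgl1 dgl2; rewrite -/MM -/P -/Q2.
set X1 := \int[MM]_z (P z * \sum_k u k z ^+ 2).
set X2 := \int[MM]_z (P z * \sum_k v k z ^+ 2).
set S := \sum_k \int[MM]_z (P z * (ta k z.1 * ta' k z.2)).
set C := \sum_k \int[MM]_z (P z * CC k z).
set q1 := \int[MM]_z (P z * Q2 z).
set q2 := \int[MM]_z (P z * Q2' z).
set t := \sum_k _; set q := \int[MM]_z _.
move=> sq tts dgl1 dgl2; change (is_true (X1 <= m%:R * q1)) in dgl1.
by rewrite mulrBr mulrDr; lra.
Qed.

End core_inequality.

(** * Near-couplings *)

Lemma measurable_fun_inv dT (T : measurableType dT) (R : realType) (f : T -> R) :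
  measurable_fun setT f -> (forall e, 0 < f e) -> measurable_fun setT (fun e => (f e)^-1).
Proof.
move=> mf f0.
have E : [set x : R | 0 < x] = `]0, +oo[%classic.
  by apply/seteqP; split => x /=; rewrite in_itv/= andbT.
apply: (measurable_comp (F := [set x : R | 0 < x])) => //.
- by rewrite E.
- by move=> _ [e _ <-] /=.
- apply: open_continuous_measurable_fun; first by rewrite E; exact: interval_open.
  by move=> x; rewrite inE/= => x0; apply: inv_continuous; rewrite lt0r_neq0.
Qed.

Lemma measurable_ratio dT (T : measurableType dT) (R : realType) (w : T -> R) (l : R) :
  measurable_fun setT w -> (forall e, 0 < w e) -> 0 < l ->
  measurable_fun setT (fun e => l / (l + w e)).
Proof.
move=> mw w0 l0; apply: measurable_funM => //; apply: measurable_fun_inv.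
  exact: measurable_funD.
by move=> e; rewrite addr_gt0.
Qed.

Lemma ratio_le1 (R : realType) (l w : R) : 0 < l -> 0 < w -> `|l / (l + w)| <= 1.
Proof.
move=> l0 w0; have lw : 0 < l + w by rewrite addr_gt0.
rewrite gtr0_norm; last by rewrite divr_gt0.
by rewrite ler_pdivrMr// mul1r lerDl ltW.
Qed.

(** The ratio is a smooth substitute for the indicator of [w < l]: dominated by 1 and tending to 0
    pointwise as [l] does, since [w] is positive everywhere. *)
Lemma small_ratio dT (T : measurableType dT) (R : realType) (M : probability T R)
    (w : T -> R) (eps : R) :
  measurable_fun setT w -> (forall e, 0 < w e) -> 0 < eps ->
  exists2 l : R, 0 < l & \int[M]_e (l / (l + w e)) <= eps.
Proof.
move=> mw w0 eps0; pose l n : R := n.+1%:R^-1.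
have l0 n : 0 < l n by rewrite invr_gt0.
have lw n e : 0 < l n + w e by rewrite addr_gt0.
have mF n : measurable_fun setT (fun e => l n / (l n + w e)) by exact: measurable_ratio.
have [] := @int_cvg _ T R M (fun n e => l n / (l n + w e)) (fun=> 0) (fun=> 1).
- exact: mF.
- by move=> n e; exact: ratio_le1.
- exact: finite_measure_integrable_cst.
- move=> e; have cl : l @ \oo --> (0 : R) by exact: cvg_harmonic.
  rewrite -[X in _ --> X](mul0r (0 + w e)^-1); apply: cvgM => //.
  apply: cvgV; first by rewrite add0r lt0r_neq0.
  by apply: cvgD => //; exact: cvg_cst.
rewrite int_cst => _ cv.
have [n hn] : exists n, \int[M]_e (l n / (l n + w e)) <= eps.
  have /cvgr_lt /(_ eps eps0) [N _ hN] := cv.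
  by exists N; apply: ltW; exact: (hN N (leqnn N)).
by exists (l n).
Qed.

Lemma kden_le (R : realType) (d : nat) (x y : 'rV[R]_d) :
  kden (x - y) <= 4 * (kden x * kden y).
Proof.
have h : dotv (x - y) (x - y) <= 2 * dotv x x + 2 * dotv y y.
  have : dotv (x - y) (x - y) + dotv (x + y) (x + y) = 2 * dotv x x + 2 * dotv y y.
    rewrite !dotvDD dotvNN.
    have -> : dotv x (- y) = - dotv x y.
      by rewrite /dotv -sumrN; apply: eq_bigr => i _; rewrite mxE mulrN.
    by ring.
  by have := dotv_ge0 (x + y); lra.
rewrite /kden; have := dotv_ge0 x; have := dotv_ge0 y.
by move: (dotv x x) (dotv y y) (dotv _ _) h => X Y Z h Y0 X0; nra.
Qed.

(** Minorizing the kernel by a product decouples the two potentials in the mass estimate. The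
    constant comes from [kden (x - y) <= 4 kden x kden y], with [4^m] shared between the two
    factors. *)
Lemma kern_sub_ge (R : realType) (d m : nat) (x y : 'rV[R]_d) :
  (kern m x / 2 ^+ m) * (kern m y / 2 ^+ m) <= kern m (x - y).
Proof.
have p0 (u : 'rV[R]_d) : 0 <= k0 u by exact: ltW (k0_gt0 u).
rewrite /kern -!expr_div_n -exprMn; apply: lerXn2r; rewrite ?nnegrE//.
  by apply: mulr_ge0; apply: divr_ge0.
rewrite /k0 -!invfM lef_pV2 ?posrE ?mulr_gt0 ?kden_gt0//.
by rewrite (le_trans (kden_le x y))// le_eqVlt; apply/orP; left; apply/eqP; ring.
Qed.

Section near_coupling.
Context dT1 dT2 (T1 : measurableType dT1) (T2 : measurableType dT2).
Context (R : realType) (d d1 : nat).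
Variables (M1 : probability T1 R) (M2 : probability T2 R).
Variables (xi : T1 -> 'rV[R]_d) (s : T1 -> 'M[R]_(d, d1)).
Variables (be : T1 -> 'rV[R]_d) (ta : 'I_d1 -> T1 -> R).
Variables (eta : T2 -> 'rV[R]_d) (s' : T2 -> 'M[R]_(d, d1)).
Variables (be' : T2 -> 'rV[R]_d) (ta' : 'I_d1 -> T2 -> R).
Hypotheses (H1 : lifted M1 xi s be ta) (H2 : lifted M2 eta s' be' ta').

Let mxi := lift_meas H1.
Let meta := lift_meas H2.

(** By contradiction: if the lost mass [th] exceeded [2 eps], then [W], the [w]-weighted integral of
    [V], would be at least [om / kap]; by [kern_sub_ge] the integral of the kernel against [V] would
    then be so large that [th] falls below [eps]. *)
Lemma potential_mass m (eps : R) : 0 < eps -> exists2 kap : R, 0 < kap &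
  forall U V : 'rV[R]_d -> R, Binf U -> Binf V ->
  (forall x, 0 <= U x <= kap^-1) -> (forall x, 0 <= V x <= kap^-1) ->
  (forall x, U x = (kap + pint M2 eta (V \o eta) (kern m) x)^-1) ->
  (forall x, V x = (kap + pint M1 xi (U \o xi) (kern m) x)^-1) ->
  kap * \int[M1]_e U (xi e) <= 2 * eps.
Proof.
move=> eps0; pose w x : R := @kern R d m x / 2 ^+ m.
have w0 x : 0 < w x by apply: divr_gt0; [exact: kern_gt0|exact: exprn_gt0].
have Bw : Binf w.
  have := BinfZ ((2 ^+ m)^-1) (@Binf_kern R d m).
  by congr Binf; apply/funext => x; rewrite mulrC.
have mw1 : measurable_fun setT (fun e => w (xi e)) by exact: lift_cmp_meas H1 _ Bw.
have mw2 : measurable_fun setT (fun e => w (eta e)) by exact: lift_cmp_meas H2 _ Bw.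
have [l l0 hl] := small_ratio M2 mw2 (fun e => w0 (eta e)) (divr_gt0 eps0 (ltr0Sn R 1)).
have [l' l'0 hl'] := small_ratio M1 mw1 (fun e => w0 (xi e)) eps0.
pose om := l * eps; have om0 : 0 < om by rewrite mulr_gt0.
(* With [kap^2 = l' om], the bound [kap / (kap + w om / kap)] for [kap U] is exactly
   [l' / (l' + w)], whose integral is at most [eps]. *)
pose kap := Num.sqrt (l' * om).
have kap0 : 0 < kap by rewrite sqrtr_gt0 mulr_gt0.
have kap2 : kap ^+ 2 = l' * om by rewrite sqr_sqrtr// mulr_ge0// ltW.
exists kap => // U V BU BV gU gV UE VE.
have kU x : 0 <= kap * U x <= 1.
  have /andP[u0 u1] := gU x; rewrite mulr_ge0 ?(ltW kap0)//=.
  by rewrite (le_trans (ler_wpM2l (ltW kap0) u1))// divff// lt0r_neq0.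
have kV x : 0 <= kap * V x <= 1.
  have /andP[u0 u1] := gV x; rewrite mulr_ge0 ?(ltW kap0)//=.
  by rewrite (le_trans (ler_wpM2l (ltW kap0) u1))// divff// lt0r_neq0.
have IU : L1 M1 (fun e => U (xi e)).
  by apply: L1_bnd; [exact: lift_cmp_meas H1 _ BU|exact: (bnd_cmp xi)].
have IV : L1 M2 (fun e => V (eta e)).
  by apply: L1_bnd; [exact: lift_cmp_meas H2 _ BV|exact: (bnd_cmp eta)].
have U0 x : 0 <= U x by case/andP: (gU x).
have V0 x : 0 <= V x by case/andP: (gV x).
pose P := plan xi eta U V m.
have mP : measurable_fun setT P := plan_meas H1 meta m BU BV.
have bP : bnd P := plan_bnd xi eta m BU BV.
have dP : DP M1 M2 P by exact: DP_bnd.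
have E1 : \int[(M1 \x M2)%E]_z P z = 1 - kap * \int[M1]_e U (xi e).
  have [_ ->] := DP_fub1 dP.
  under eq_Rintegral do rewrite (plan_marginal xi meta BV V0 kap0 UE).
  rewrite intB ?intZ ?int_cst//; first exact: finite_measure_integrable_cst.
  exact: L1Z.
have E2 : \int[(M1 \x M2)%E]_z P z = 1 - kap * \int[M2]_e V (eta e).
  have [_ ->] := DP_fub2 dP.
  transitivity (\int[M2]_y (1 - kap * V (eta y))).
    apply: eq_Rintegral => y _; rewrite -(plan_marginal eta mxi BU U0 kap0 VE).
    apply: eq_Rintegral => x _.
    by rewrite /P /plan /dif /= -(kernN m (eta y - xi x)) opprB; ring.
  rewrite intB ?intZ ?int_cst//; first exact: finite_measure_integrable_cst.
  exact: L1Z.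
(* Both sides are the mass that [P] lacks, computed in the two orders of integration. *)
have EUV : kap * \int[M1]_e U (xi e) = kap * \int[M2]_e V (eta e) by lra.
set th := kap * \int[M1]_e U (xi e) in EUV *.
pose W := \int[M2]_e (w (eta e) * V (eta e)).
have IW : L1 M2 (fun e => w (eta e) * V (eta e)).
  by apply: L1_bM => //; exact: (bnd_cmp eta).
rewrite leNgt; apply/negP => th2.
(* Where [w >= l], [kap V] is at most [kap V w / l]; where [w < l], it is at most
   [1 <= 2 l / (l + w)], whose integral is at most [eps] by the choice of [l]. *)
have thW : th <= (kap * W) / l + eps.
  rewrite {1}EUV -intZ//.
  have Ir : L1 M2 (fun e => l / (l + w (eta e))).
    apply: (@L1_le _ _ _ _ _ (fun=> 1)).
    - exact: measurable_ratio.
    - by move=> e; exact: ratio_le1.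
    - exact: finite_measure_integrable_cst.
  apply: (@le_trans _ _ (\int[M2]_e (kap / l * (w (eta e) * V (eta e)) + 2 * (l / (l + w (eta e)))))).
    apply: int_le; [exact: L1Z|by apply: L1D; exact: L1Z|].
    move=> e; have /andP[v0 v1] := kV (eta e).
    have we := w0 (eta e).
    have r0 : 0 <= l / (l + w (eta e)).
      by apply: divr_ge0; apply: ltW => //; exact: addr_gt0.
    rewrite (_ : kap / l * _ = (w (eta e) / l) * (kap * V (eta e))); last by ring.
    have [wl|lw] := leP l (w (eta e)).
      apply: (@le_trans _ _ (1 * (kap * V (eta e)))); first by rewrite mul1r.
      rewrite -[leLHS]addr0 lerD//; last by rewrite mulr_ge0.
      by rewrite ler_wpM2r// ler_pdivlMr// mul1r.
    apply: (le_trans v1); rewrite -[leLHS]add0r lerD//.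
      by rewrite mulr_ge0// divr_ge0// ltW.
    by rewrite mulrA ler_pdivlMr ?addr_gt0//; lra.
  rewrite intD; [|exact: L1Z|exact: L1Z].
  rewrite (intZ _ Ir) (intZ _ IW) -/W; have : 2 * \int[M2]_e (l / (l + w (eta e))) <= eps by lra.
  by rewrite (_ : kap / l * W = kap * W / l); [lra|ring].
have omW : om <= kap * W.
  have : eps <= kap * W / l by lra.
  by rewrite ler_pdivlMr// mulrC.
have : th <= eps.
  rewrite (le_trans _ hl')// /th -intZ//; apply: int_le; [exact: L1Z| |].
    apply: (@L1_le _ _ _ _ _ (fun=> 1)).
    - exact: measurable_ratio.
    - by move=> e; exact: ratio_le1.
    - exact: finite_measure_integrable_cst.
  move=> e.
  have hS : w (xi e) * W <= pint M2 eta (V \o eta) (kern m) (xi e).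
    rewrite /W -intZ//; apply: int_le; first exact: L1Z.
      apply: pint_L1 => //.
      + by apply: cmeas_comp => //; exact: Binf_continuous.
      + exact: (bnd_cmp eta).
      + by apply: Binf_continuous; exact: Binf_kern.
      + by apply: Binf_bnd; exact: Binf_kern.
    by move=> y /=; rewrite mulrA ler_wpM2r// kern_sub_ge.
  have we := w0 (xi e).
  have hS' : w (xi e) * (om / kap) <= pint M2 eta (V \o eta) (kern m) (xi e).
    rewrite (le_trans _ hS)//; apply: ler_wpM2l; first exact: ltW.
    by rewrite ler_pdivrMr// mulrC.
  have p0 : 0 <= w (xi e) * (om / kap).
    by apply: mulr_ge0; [exact: ltW|apply: divr_ge0; exact: ltW].
  have kp : 0 < kap + pint M2 eta (V \o eta) (kern m) (xi e).
    by rewrite (lt_le_trans kap0)// lerDl (le_trans p0).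
  rewrite UE ler_pdivrMr// mulrAC ler_pdivlMr ?addr_gt0//.
  have -> : kap * (l' + w (xi e)) = l' * (kap + w (xi e) * (kap / l')).
    by field; rewrite lt0r_neq0.
  apply: ler_wpM2l; first exact: ltW.
  rewrite lerD2l (le_trans _ hS')//; apply: ler_wpM2l; first exact: ltW.
  by rewrite ler_pdivrMr// mulrAC ler_pdivlMr// -expr2 kap2 mulrC.
lra.
Qed.

(* [m] absorbs the integration by parts constants, which depend on the smoothing; [kap] is
   then chosen to make the lost mass [kap U] small. *)
Lemma near_coupling (eps : R) : 0 < eps -> exists P : T1 * T2 -> R,
  [/\ measurable_fun setT P /\ bnd P, forall z, 0 <= P z,
      (forall x, \int[M2]_y P (x, y) <= 1) /\ (forall y, \int[M1]_x P (x, y) <= 1),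
      1 - eps <= \int[(M1 \x M2)%E]_z P z &
      DP M1 M2 (fun z => P z * (k0 (xi z.1 - eta z.2) * qhat xi s be eta s' be' z)) /\
      - eps <= \int[(M1 \x M2)%E]_z
        (P z * (k0 (xi z.1 - eta z.2) * qhat xi s be eta s' be' z))].
Proof.
move=> eps0.
pose C := \sum_k (\int[M1]_e (ta k e ^+ 2) + \int[M2]_e (ta' k e ^+ 2)).
have C0 : 0 <= C.
  by apply: sumr_ge0 => k _; apply: addr_ge0; apply: int_ge0 => e; rewrite exprn_even_ge0.
pose m := (Num.truncn (C / eps)).+1.
have mC : C <= m%:R * eps.
  by rewrite -ler_pdivrMr//; apply: ltW; exact: truncnS_gt.
have [kap kap0 hkap] := potential_mass m (divr_gt0 eps0 (ltr0Sn R 1)).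
have [U [V [[BU BV] [gU gV] UE VE]]] :=
  potentials_exist M1 M2 mxi meta kap0 (@Binf_kern R d m) (fun x => ltW (kern_gt0 m x)).
have U0 x : 0 <= U x by case/andP: (gU x).
have V0 x : 0 <= V x by case/andP: (gV x).
(* Since [kern m <= 1] and the potentials are at most [1 / kap], both denominators in the system are
   at most [kap + 1 / kap]. *)
pose c := (kap + kap^-1)^-1.
have c0 : 0 < c by rewrite invr_gt0 addr_gt0// invr_gt0.
have lowb dT (T : measurableType dT) (M : probability T R) (et : T -> 'rV[R]_d)
    (W : 'rV[R]_d -> R) x : cmeas et -> Binf W -> (forall y, 0 <= W y <= kap^-1) ->
    c <= (kap + pint M et (W \o et) (kern m) x)^-1.
  move=> met BW gW.
  have W0 y : 0 <= W y by case/andP: (gW y).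
  have p0 : 0 <= pint M et (W \o et) (kern m) x.
    by apply: pint_ge0 => [y|e]; [exact: ltW (kern_gt0 _ _)|exact: W0].
  rewrite lef_pV2 ?posrE ?ltr_wpDr ?invr_ge0 ?(ltW kap0)// lerD2l.
  rewrite -[leRHS](int_cst M); apply: int_le.
  - apply: pint_L1 => //.
    + by apply: cmeas_comp => //; exact: Binf_continuous.
    + exact: (bnd_cmp et).
    + by apply: Binf_continuous; exact: Binf_kern.
    + by apply: Binf_bnd; exact: Binf_kern.
  - exact: finite_measure_integrable_cst.
  - move=> e /=; rewrite -[leRHS]mul1r ler_pM ?kern_le1//; first exact: ltW (kern_gt0 _ _).
    by case/andP: (gW (et e)).
have cU x : c <= U x by rewrite UE; exact: lowb.
have cV x : c <= V x by rewrite VE; exact: lowb.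
have mP : measurable_fun setT (plan xi eta U V m) := plan_meas H1 meta m BU BV.
have bP : bnd (plan xi eta U V m) := plan_bnd xi eta m BU BV.
have dP : DP M1 M2 (plan xi eta U V m) by exact: DP_bnd.
exists (plan xi eta U V m); split => //.
- by move=> z; exact: plan_ge0 c0 cU V0 z.
- split=> [x|y].
    by rewrite (plan_marginal xi meta BV V0 kap0 UE) gerBl mulr_ge0// ltW.
  have -> : \int[M1]_x plan xi eta U V m (x, y) = \int[M1]_x plan eta xi V U m (y, x).
    apply: eq_Rintegral => x _.
    by rewrite /plan /dif /= -(kernN m (eta y - xi x)) opprB; ring.
  by rewrite (plan_marginal eta mxi BU U0 kap0 VE) gerBl mulr_ge0// ltW.
- have [_ ->] := DP_fub1 dP.
  under eq_Rintegral do rewrite (plan_marginal xi meta BV V0 kap0 UE).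
  have IU : L1 M1 (fun e => U (xi e)).
    by apply: L1_bnd; [exact: lift_cmp_meas H1 _ BU|exact: (bnd_cmp xi)].
  rewrite intB ?(intZ _ IU) ?int_cst//; last 2 first.
  - exact: finite_measure_integrable_cst.
  - exact: L1Z.
  by have := hkap U V BU BV gU gV UE VE; lra.
split; first exact (core_DP H1 H2 m BU BV).
have := core_inequality H1 H2 BU BV c0 kap0 cU cV UE VE; rewrite -/C /=.
set I := \int[_]_z _ => h.
have m0 : 0 < m%:R :> R by rewrite ltr0n.
by rewrite -(ler_pM2l m0); apply: le_trans h; lra.
Qed.

End near_coupling.

(** * Smoothing *)

(** The approximations [f / (f^2 + 1 / (n + 1))] vanish where [f] does, in agreement with the
    convention that the inverse of 0 is 0. *)
Lemma measurable_funV dT (T : measurableType dT) (R : realType) (f : T -> R) :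
  measurable_fun setT f -> measurable_fun setT (fun e => (f e)^-1).
Proof.
move=> mf; pose den n e : R := f e ^+ 2 + n.+1%:R^-1.
have den0 n e : 0 < den n e.
  by rewrite ltr_wpDl ?exprn_even_ge0// invr_gt0.
apply: (@measurable_fun_cvg _ _ _ _ (fun n e => f e / den n e)).
  move=> n; apply: measurable_funM => //; apply: measurable_fun_inv => //.
  by apply: measurable_funD => //; apply: measurable_funX.
move=> e _; have [->|fe] := eqVneq (f e) 0.
  by rewrite invr0; under eq_fun do rewrite mul0r; exact: cvg_cst.
rewrite (_ : (f e)^-1 = f e / (f e ^+ 2 + 0)); last first.
  by rewrite addr0 expr2 invfM mulrA divff// mul1r.
apply: cvgM; first exact: cvg_cst.
apply: cvgV; first by rewrite addr0 sqrf_eq0.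
by apply: cvgD; [exact: cvg_cst|exact: cvg_harmonic].
Qed.

Section beta_smoothing.
Variable R : realType.
Notation mu := (@lebesgue_measure R).

Definition beta33 : probability (measurableTypeR R) R := beta_prob 3 3.
Definition betag (t : R) : R := XMonemX 2 2 t.
Definition betac : R := beta_fun 3 3.

Lemma betac_gt0 : 0 < betac. Proof. exact: beta_fun_gt0. Qed.

Lemma beta_pdf_in (t : R) : t \in `[0, 1] -> beta_pdf 3 3 t = betag t / betac.
Proof. by move=> t01; rewrite /beta_pdf patchE mem_set. Qed.

Lemma beta_pdf_out (t : R) : t \notin `[0, 1] -> beta_pdf 3 3 t = 0.
Proof.
move=> t01; rewrite /beta_pdf patchE memNset ?mul0r//.
by move=> h; move/negP: t01; apply.
Qed.

Lemma integral_beta33 (h : R -> R) : L1 beta33 h ->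
  (\int[beta33]_t (h t)%:E = \int[mu]_(t in `[0%R, 1%R]) (h t * (betag t / betac))%:E)%E.
Proof.
move=> Ih; have [mh fin] := integrableP _ _ _ Ih.
rewrite (@integral_beta_prob R 3 3 (EFin \o h) setT measurableT mh fin).
rewrite [RHS]integral_mkcond; apply: eq_integral => t _.
rewrite patchE; case: ifPn => t01 /=.
  by rewrite -EFinM beta_pdf_in//; rewrite inE in t01.
by rewrite beta_pdf_out ?mule0//; apply: contra t01; rewrite inE.
Qed.

Lemma int_beta33 (h : R -> R) : L1 beta33 h ->
  \int[beta33]_t h t = \int[mu]_(t in `[0, 1]) (h t * (betag t / betac)).
Proof. by move=> Ih; rewrite /Rintegral integral_beta33. Qed.

(** Passing to the Lebesgue integral through [integral_beta33] presupposes integrability, so [f] is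
    first truncated at [n], where the bound is uniform, and monotone convergence finishes. *)
Lemma beta33_L1 (f : R -> R) (C : R) :
  measurable_fun setT (f : measurableTypeR R -> R) ->
  (forall t, 0 <= f t) -> (forall t, t \in `[0, 1] -> f t * betag t <= C) ->
  L1 beta33 f.
Proof.
move=> mf f0 fC.
have c0 := betac_gt0.
pose g n (t : measurableTypeR R) : R := Num.min (f t) n%:R.
have g0 n t : 0 <= g n t by rewrite le_min f0/= ler0n.
have mg n : measurable_fun setT (g n) by exact: measurable_minr.
have b0 (t : R) : t \in `[0, 1] -> 0 <= betag t by exact: XMonemX_ge0.
have C0 : 0 <= C.
  have h0 : (0 : R) \in `[0, 1] by rewrite in_itv/= lexx ler01.
  by apply: le_trans (fC 0 h0); rewrite mulr_ge0// b0.
have gb n : (\int[beta33]_t (g n t)%:E <= (C / betac)%:E)%E.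
  have Ig : L1 beta33 (g n).
    apply: L1_bnd => //; exists n%:R => t.
    by rewrite ger0_norm// ge_min lexx orbT.
  rewrite integral_beta33//.
  apply: (@le_trans _ _ (\int[mu]_(t in `[0%R, 1%R]) (C / betac)%:E)%E).
    apply: ge0_le_integral => //.
    - by move=> t t01; rewrite lee_fin mulr_ge0// divr_ge0 ?b0// ltW.
    - apply/measurable_EFinP; apply: measurable_funM.
        exact: measurable_funTS (mg n).
      by apply: measurable_funM => //; exact: measurable_XMonemX.
    - move=> t t01; rewrite lee_fin mulrA ler_pM2r ?invr_gt0//.
      by rewrite (le_trans _ (fC t t01))// ler_wpM2r ?b0// ge_min lexx.
  by rewrite integral_cst//= lebesgue_measure_itv/= lte_fin ltr01 sube0 mule1.
apply/integrableP; split; first exact/measurable_EFinP.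
apply: (@le_lt_trans _ _ (C / betac)%:E); last exact: ltry.
have := @cvg_monotone_convergence _ _ R beta33 setT measurableT (fun n t => (g n t)%:E).
move=> /(_ _ _ _) cv.
have lim_g t : limn (fun n => (g n t)%:E) = `|(f t)%:E|%E.
  apply: lim_near_cst => //; exists (Num.truncn (f t)).+1 => // n /= hn.
  rewrite ger0_norm//; congr EFin; apply/min_idPl.
  by rewrite (le_trans (ltW (truncnS_gt _)))// ler_nat.
rewrite (eq_integral (fun t => limn (fun n => (g n t)%:E))); last first.
  by move=> t _; rewrite lim_g.
have {}cv : (\int[beta33]_t (g n t)%:E)%E @[n --> \oo] -->
    (\int[beta33]_t limn (fun n => (g n t)%:E))%E.
  apply: cv.
  - by move=> n; exact/measurable_EFinP.
  - by move=> n t _; rewrite lee_fin.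
  - move=> t _ m n mn; rewrite lee_fin le_min ge_min lexx/=.
    by rewrite ge_min ler_nat mn orbT.
rewrite -(cvg_lim _ cv)//; apply: lime_le; first exact: cvgP cv.
exact: nearW.
Qed.

(** The law [beta33] lives on the unit interval, but the smoothing vector must be bounded at every
    sample point; values outside the interval are sent to 0. *)
Definition clamp (t : R) : R := if (0 <= t <= 1) then t else 0.

(** The derivative of [betag]. *)
Definition bnum (t : R) : R := 2 * t * (1 - t) * (1 - 2 * t).

(* The score [- g' / g] of the density [g]; at the two zeros of [g] the division
   by 0 gives 0, which is harmless because [g'] vanishes there. *)
Definition bscore (t : R) : R := - bnum t / betag t.

Lemma betagE t : betag t = t ^+ 2 * (1 - t) ^+ 2.
Proof. by []. Qed.

Lemma bscore_betag t : bscore t * betag t = - bnum t.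
Proof.
rewrite /bscore; have [g0|g0] := eqVneq (betag t) 0; last by rewrite divfK.
rewrite g0 mulr0; have /eqP := g0; rewrite betagE mulf_eq0 !sqrf_eq0 /bnum.
by case/orP => /eqP ->; rewrite !(mulr0, mul0r) oppr0.
Qed.

Lemma bscore_meas : measurable_fun setT (bscore : measurableTypeR R -> R).
Proof.
apply: measurable_funM; last first.
  by apply: measurable_funV; exact: measurable_XMonemX.
apply: measurableT_comp => //; apply: measurable_funM; last first.
  by apply: measurable_funB => //; apply: measurable_funM.
by apply: measurable_funM; [exact: measurable_funM|exact: measurable_funB].
Qed.

(** Inside the interval [g'^2 / g = 4 (1 - 2 t)^2], whence the constant 4: the double zeros of the
    density are just cancelled. *)
Lemma bscore_sqr_L1 : L1 beta33 (fun t => bscore t ^+ 2).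
Proof.
apply: (@beta33_L1 _ 4).
- by apply: measurable_funX; exact: bscore_meas.
- by move=> t; exact: sqr_ge0.
move=> t; rewrite in_itv/= => /andP[t0 t1].
rewrite expr2 -mulrA bscore_betag.
have [g0|g0] := eqVneq (betag t) 0; first by rewrite /bscore g0 invr0 mulr0 mul0r.
have tn0 : t != 0 by apply: contraNneq g0 => ->; rewrite betagE expr0n mul0r.
have tn1 : 1 - t != 0 by apply: contraNneq g0 => h; rewrite betagE h expr0n mulr0.
have -> : bscore t * - bnum t = 4 * (1 - 2 * t) ^+ 2.
  by rewrite /bscore /bnum betagE; field; rewrite tn0 tn1.
by nra.
Qed.

Lemma clamp_meas : measurable_fun setT (clamp : measurableTypeR R -> R).
Proof.
apply: measurable_fun_ifT => //; apply: measurable_and.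
  by apply: measurable_fun_ler.
by apply: measurable_fun_ler.
Qed.

Lemma clamp_le1 t : `|clamp t| <= 1.
Proof.
rewrite /clamp; case: ifP => [/andP[t0 t1]|_]; last by rewrite normr0.
by rewrite ger0_norm.
Qed.

Lemma clamp_id t : t \in `[0, 1] -> clamp t = t.
Proof. by rewrite in_itv/= /clamp => ->. Qed.

Let pg : {poly R} := betac^-1 *: ('X^2 - 2 *: 'X^3 + 'X^4).

Let pgE t : pg.[t] = betag t / betac.
Proof. by rewrite /pg betagE !hornerE /=; ring. Qed.

Let pg'E t : pg^`().[t] = bnum t / betac.
Proof. by rewrite /pg /bnum !(derivZ, derivD, derivN, derivXn) /= !hornerE /= !(hornerMn, hornerXn, mulrS); ring. Qed.

(** The boundary terms vanish because the polynomial density is zero at both ends, and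
    [bscore_betag], valid also at the ends, turns its derivative into the score. *)
Lemma beta33_ibp (F f : R -> R) : (forall t : R, is_derive t (1 : R) F (f t)) ->
  continuous f -> bnd F -> bnd f ->
  \int[beta33]_t f (clamp t) = \int[beta33]_t (bscore t * F (clamp t)).
Proof.
move=> dF cf bF bf.
have cF : continuous F.
  by move=> t; apply: differentiable_continuous; apply/derivable1_diffP.
have mcl (h : R -> R) : continuous h ->
    measurable_fun setT (fun t : measurableTypeR R => h (clamp t)).
  move=> ch; apply: measurableT_comp; last exact: clamp_meas.
  exact: continuous_measurable_fun.
have bcl (h : R -> R) : bnd h -> bnd (fun t : measurableTypeR R => h (clamp t)).
  by move=> [C hC]; exists C.
have If : L1 beta33 (fun t => f (clamp t)) by apply: L1_bnd; [exact: mcl|exact: bcl].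
have IF : L1 beta33 (fun t => bscore t * F (clamp t)).
  apply: L1_mulb; [exact: mcl|exact: bcl|].
  by apply: L1_sqr_bound; [exact: bscore_meas|exact: bscore_sqr_L1].
rewrite (int_beta33 If) (int_beta33 IF).
rewrite (@eq_Rintegral _ _ _ mu _ (fun t => pg.[t] * f t)); last first.
  by move=> t; rewrite inE /= => t01; rewrite clamp_id// pgE mulrC.
rewrite [RHS](@eq_Rintegral _ _ _ mu _ (fun t => -1 * (pg^`().[t] * F t))); last first.
  move=> t; rewrite inE /= => t01; rewrite clamp_id// pg'E.
  have -> : bscore t * F t * (betag t / betac) = (bscore t * betag t) * F t / betac.
    by ring.
  by rewrite bscore_betag; ring.
have within (h : R -> R) : continuous h -> {within `[0, 1], continuous h}.
  by move=> ch; apply: continuous_subspaceT.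
rewrite RintegralZl//; last first.
  apply: continuous_compact_integrable; first exact: segment_compact.
  apply: within => t; apply: cvgM; [exact: continuous_horner|exact: cF].
rewrite (@Rintegration_by_parts R (horner pg) F (horner pg^`()) f 0 1) ?ltr01//.
- rewrite !pgE /betag /XMonemX /unstable.onem subrr subr0 expr0n/= !mulr0 !mul0r.
  by rewrite subrr sub0r mulN1r.
- by apply: within; exact: continuous_horner.
- split.
  + by move=> t _; exact: derivable_horner.
  + by apply: cvg_at_right_filter; exact: continuous_horner.
  + by apply: cvg_at_left_filter; exact: continuous_horner.
- by move=> t _; rewrite derivE.
- exact: within.
- split.
  + by move=> t _; exact: ex_derive.
  + by apply: cvg_at_right_filter; exact: cF.
  + by apply: cvg_at_left_filter; exact: cF.
- by move=> t _; rewrite derive1E; exact: derive_val.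
Qed.

End beta_smoothing.

Lemma is_derive_line (R : realType) (d : nat) (f : 'rV[R]_d -> R) (z : 'rV[R]_d)
    (k : 'I_d) (t : R) : differentiable f (z + t *: evec R k) ->
  is_derive t (1 : R) (fun u => f (z + u *: evec R k)) (pder k f (z + t *: evec R k)).
Proof.
move=> df; have E : (fun h : R => h^-1 *: (((fun u => f (z + u *: evec R k)) \o shift t) (h *: (1 : R))
       - f (z + t *: evec R k))) =
    (fun h : R => h^-1 *: ((f \o shift (z + t *: evec R k)) (h *: evec R k)
       - f (z + t *: evec R k))).
  apply/funext => h /=; congr (_ *: (f _ - _)).
  by rewrite -[h *: 1]/(h * 1) mulr1 scalerDl addrCA.
apply: DeriveDef; last by rewrite /pder /derive E.
by rewrite /derivable E; exact: diff_derivable.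
Qed.

Section smoothing.
Variables (R : realType) (d : nat).

(* [Z] is built one coordinate at a time from Beta(3, 3) variables, whose density vanishes
   to second order at both ends, so that the score is square integrable. *)
Record smoother dT (T : measurableType dT) (P : probability T R)
  (Z : T -> 'rV[R]_d) (sc : 'I_d -> T -> R) (k : nat) : Prop := Smoother {
  smo_meas : cmeas Z;
  smo_le : forall w, `|Z w| <= k%:R;
  smo_sc : forall i, measurable_fun setT (sc i);
  smo_sc2 : forall i, L1 P (fun w => sc i w ^+ 2);
  smo_ibp : forall (i : 'I_d) f, (i < k)%N -> Binf f ->
    \int[P]_w pder i f (Z w) = \int[P]_w (sc i w * f (Z w)) }.

Lemma smo_cmp dT (T : measurableType dT) (Z : T -> 'rV[R]_d) f : cmeas Z -> Binf f ->
  measurable_fun setT (fun w => f (Z w)) /\ bnd (fun w => f (Z w)).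
Proof.
move=> mZ Bf; split; last exact: bnd_cmp.
exact: (cmeas_comp mZ (Binf_continuous Bf)).
Qed.

Section step.
Context dT (T : measurableType dT) (P : probability T R).
Variables (Z : T -> 'rV[R]_d) (sc : 'I_d -> T -> R) (k : 'I_d).
Hypothesis Hs : smoother P Z sc k.

Let B := @beta33 R.
Let Z' (z : measurableTypeR R * T) := Z z.2 + clamp z.1 *: evec R k.
Let sc' (i : 'I_d) (z : measurableTypeR R * T) := if i == k then bscore z.1 else sc i z.2.

Let mZ' : cmeas Z'.
Proof.
move=> i; rewrite (_ : (fun _ => _) = fun z => Z z.2 0 i + clamp z.1 * (k == i)%:R); last first.
  by apply/funext => z; rewrite !mxE.
apply: measurable_funD.
  by apply: (measurableT_comp (smo_meas Hs i)); exact: measurable_snd.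
apply: measurable_funM => //.
by apply: (measurableT_comp (@clamp_meas R)); exact: measurable_fst.
Qed.

Let msc' i : measurable_fun setT (sc' i).
Proof.
rewrite /sc'; case: (i == k).
  by apply: (measurableT_comp (@bscore_meas R)); exact: measurable_fst.
by apply: (measurableT_comp (smo_sc Hs i)); exact: measurable_snd.
Qed.

Let dsc' i : DP B P (sc' i).
Proof.
rewrite /sc'; case: (i == k).
  apply: (@DP_1 _ _ (measurableTypeR R) T R B P (@bscore R)); apply: L1_sqr_bound; first exact: bscore_meas.
  exact: bscore_sqr_L1.
apply: (DP_2 B (g2 := sc i)); apply: L1_sqr_bound; first exact: smo_sc Hs _.
exact: smo_sc2 Hs _.
Qed.

(** In the new coordinate, [Z] is frozen and the one-dimensional formula is applied along a line; in
    an earlier coordinate, the new variable is frozen and the induction hypothesis is applied to a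
    translate of [f]. *)
Lemma smoother_step : smoother (B \x P)%E Z' sc' k.+1.
Proof.
split => //.
- move=> z; rewrite /Z' (le_trans (ler_normD _ _))// -natr1 lerD ?(smo_le Hs)//.
  rewrite normrZ -[leRHS]mulr1 ler_pM ?clamp_le1//.
  rewrite [leLHS]/Num.Def.normr /= mx_normrE bigmax_le// => -[i j] _ /=.
  by rewrite mxE; case: eqP => _; rewrite ?normr1 ?normr0.
- move=> i; apply: DP_L1; rewrite /sc'; case: (i == k).
    by apply: (@DP_1 _ _ (measurableTypeR R) T R B P (fun t => bscore t ^+ 2)); exact: bscore_sqr_L1.
  by apply: (DP_2 B (g2 := fun w => sc i w ^+ 2)); exact: smo_sc2 Hs _.
move=> i f ik Bf.
have Bp : Binf (pder i f) by exact: Binf_pder.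
have [mf bf] := smo_cmp mZ' Bf; have [mp bp] := smo_cmp mZ' Bp.
have dp : DP B P (fun z => pder i f (Z' z)) by exact: DP_bnd.
have ds : DP B P (fun z => sc' i z * f (Z' z)) by exact: DP_Mb.
move: ik; rewrite ltnS leq_eqVlt => /orP[/eqP/val_inj ik|ik].
  rewrite (DP_fub2 dp).2 (DP_fub2 ds).2; apply: eq_Rintegral => w _.
  rewrite /sc' /Z' /= ik eqxx -/B.
  have cl : continuous (fun t : R => Z w + t *: evec R k).
    by move=> t; apply: cvgD; [exact: cvg_cst|apply: cvgZr_tmp; exact: cvg_id].
  apply: (@beta33_ibp R (fun t => f (Z w + t *: evec R k))
    (fun t => pder k f (Z w + t *: evec R k))).
  - by move=> t; apply: is_derive_line; apply: (@BI_differentiable _ _ 0); exact: Bf.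
  - have cp : continuous (pder k f) by apply: Binf_continuous; rewrite -ik.
    by move=> t; exact: (continuous_comp (cl t) (cp _)).
  - exact: (bnd_cmp _ Bf).
  - by rewrite -ik; exact: (bnd_cmp _ Bp).
rewrite (DP_fub1 dp).2 (DP_fub1 ds).2; apply: eq_Rintegral => t _.
rewrite /sc' /Z' /=; case: eqP => [h|_]; first by move: ik; rewrite h ltnn.
pose a := clamp t *: evec R k.
have Bfa := Binf_affine a 1 Bf.
transitivity (\int[P]_w pder i (fun x => f (a + 1 *: x)) (Z w)).
  by apply: eq_Rintegral => w _; rewrite pder_affine// mul1r scale1r addrC.
rewrite (smo_ibp Hs)//; apply: eq_Rintegral => w _.
by rewrite scale1r addrC.
Qed.

End step.

Lemma smoother_exists : exists (dT : measure_display) (T : measurableType dT)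
  (P : probability T R) (Z : T -> 'rV[R]_d) (sc : 'I_d -> T -> R), smoother P Z sc d.
Proof.
suff H k : (k <= d)%N -> exists (dT : measure_display) (T : measurableType dT)
    (P : probability T R) (Z : T -> 'rV[R]_d) (sc : 'I_d -> T -> R), smoother P Z sc k.
  exact: H.
elim: k => [_|k IH kd].
  (* For [k = 0] no coordinate is to be integrated by parts, so the zero vector on any probability
     space will do. *)
  exists _, _, (@beta33 R), (fun=> 0), (fun _ _ => 0); split => //.
  - by move=> w; rewrite normr0.
  - by move=> i; rewrite expr0n; exact: L1_0.
have [dT [T [P [Z [sc Hs]]]]] := IH (ltnW kd).
have {}Hs : smoother P Z sc (Ordinal kd) by [].
by do 5 eexists; exact: smoother_step Hs.
Qed.

End smoothing.

Lemma gen_eq (R : realType) (d d1 : nat) (s : 'M[R]_(d, d1)) (b x y : 'rV[R]_d) f g :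
  (forall i, pder i f x = pder i g y) ->
  (forall i j, pder i (pder j f) x = pder i (pder j g) y) -> gen s b f x = gen s b g y.
Proof.
move=> E1 E2.
apply: (@f_equal2 _ _ _ (@GRing.add R)).
  apply: eq_bigr => i _; apply: eq_bigr => j _; exact: (congr1 (GRing.mul _) (E2 i j)).
by apply: eq_bigr => i _; exact: (congr1 (GRing.mul _) (E1 i)).
Qed.

Lemma gen_translate (R : realType) (d d1 : nat) (s : 'M[R]_(d, d1)) (b a x : 'rV[R]_d) f :
  Binf f -> gen s b (fun y => f (a + 1 *: y)) x = gen s b f (a + 1 *: x).
Proof.
move=> Bf.
have E i g : Binf g -> pder i (fun y => g (a + 1 *: y)) = fun y => pder i g (a + 1 *: y).
  by move=> Bg; rewrite pder_affine//; apply/funext => y; rewrite mul1r.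
have E2 i j : pder i (pder j (fun y => f (a + 1 *: y))) x = pder i (pder j f) (a + 1 *: x).
  by rewrite (E j f Bf) (E i (pder j f) (Binf_pder j Bf)).
apply: gen_eq => [i|//]; by rewrite (E i f Bf).
Qed.

Section smoothed_solution.
Variables (R : realType) (d d1 : nat) (mu : probability (Rd R d) R).
Variables (S : 'rV[R]_d -> 'M[R]_(d, d1)) (b : 'rV[R]_d -> 'rV[R]_d).
Hypothesis mS : forall i k, measurable_fun setT (fun x : Rd R d => S x i k).
Hypothesis IS : forall i k, L1 mu (fun x => S x i k ^+ 2).
Hypothesis Ib : forall i, L1 mu (fun x => b x 0 i).
Hypothesis eqn : forall f, Binf f -> \int[mu]_x gen (S x) (b x) f x = 0.

Context dT (T : measurableType dT) (P : probability T R).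
Variables (Z : T -> 'rV[R]_d) (sc : 'I_d -> T -> R) (del : R).
Hypothesis Hs : smoother P Z sc d.
Hypothesis del0 : 0 < del.

Definition sm_pt (z : Rd R d * T) : 'rV[R]_d := (z.1 : 'rV[R]_d) + del *: Z z.2.
(** For fixed [x] the matrix is constant, so the score along its column [k] is the same combination
    of the coordinate scores; [del^-1] undoes the chain rule for [f (x + del Z)]. *)
Definition sm_score (k : 'I_d1) (z : Rd R d * T) : R :=
  del^-1 * \sum_i S z.1 i k * sc i z.2.

Let mpt : cmeas sm_pt.
Proof.
move=> i; rewrite (_ : (fun _ => _) = fun z => (z.1 : 'rV[R]_d) 0 i + del * Z z.2 0 i); last first.
  by apply/funext => z; rewrite !mxE.
apply: measurable_funD.
  by apply: (measurableT_comp (@Rd_cmeas R d i)); exact: measurable_fst.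
apply: measurable_funM => //.
by apply: (measurableT_comp (smo_meas Hs i)); exact: measurable_snd.
Qed.

Let mSz i k : measurable_fun setT (fun z : Rd R d * T => S z.1 i k).
Proof. by apply: (measurableT_comp (mS i k)); exact: measurable_fst. Qed.

Let SL1 i k : L1 mu (fun x => S x i k).
Proof. by apply: L1_sqr_bound; [exact: mS|exact: IS]. Qed.

Let scL1 i : L1 P (sc i).
Proof. by apply: L1_sqr_bound; [exact: smo_sc Hs _|exact: smo_sc2 Hs _]. Qed.

Let cmp f : Binf f -> measurable_fun setT (fun z => f (sm_pt z)) /\ bnd (fun z => f (sm_pt z)).
Proof. exact: smo_cmp. Qed.

Let DPgen f : Binf f -> DP mu P (fun z => gen (S z.1) (b z.1) f (sm_pt z)).
Proof.
move=> Bf; apply: DPD.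
  apply: DP_sum => i; apply: DP_sum => j.
  have [m1 b1] := cmp (Binf_pder i (Binf_pder j Bf)).
  apply: DP_Mb => //.
  suff Ic : L1 mu (fun x => (S x *m (S x)^T) i j) by exact: (DP_1 P Ic).
  under eq_fun do rewrite cov_entry.
  by apply: L1_sum => k; apply: L1_sqr_mul.
apply: DP_sum => i; have [m1 b1] := cmp (Binf_pder i Bf).
by apply: DP_Mb => //; exact: (DP_1 P (Ib i)).
Qed.

Let DPscore k i : DP mu P (fun z => S z.1 i k * sc i z.2).
Proof. exact: (DP_12 (SL1 i k) (scL1 i)). Qed.

(** The equation holds for each value of [Z] separately, since a translate of a [Binf] function is
    [Binf]; the integration by parts holds for each [x] separately, where the coefficients are
    constants. *)
Lemma lifted_smooth :
  lifted (mu \x P)%E sm_pt (fun z => S z.1) (fun z => b z.1) sm_score.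
Proof.
split => //.
- move=> i k; apply: DP_L1; exact: (DP_1 P (IS i k)).
- move=> i; apply: DP_L1; exact: (DP_1 P (Ib i)).
- move=> k; apply: measurable_funM => //; apply: measurable_sum => i.
  by case: (DPscore k i).
- move=> k; rewrite (_ : (fun _ => _) = fun z => del^-1 ^+ 2 *
      \sum_i \sum_j (S z.1 i k * S z.1 j k) * (sc i z.2 * sc j z.2)); last first.
    apply/funext => z; rewrite /sm_score exprMn; congr (_ * _).
    rewrite expr2 mulr_suml; apply: eq_bigr => i _; rewrite mulr_sumr.
    by apply: eq_bigr => j _; ring.
  apply: L1Z; apply: L1_sum => i; apply: L1_sum => j; apply: DP_L1.
  have I1 : L1 mu (fun x => S x i k * S x j k) by exact: L1_sqr_mul.
  have I2 : L1 P (fun w => sc i w * sc j w).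
    apply: L1_sqr_mul; [exact: smo_sc Hs _|exact: smo_sc Hs _| |]; exact: smo_sc2 Hs _.
  exact: (DP_12 I1 I2).
- move=> f Bf; rewrite (DP_fub2 (DPgen Bf)).2.
  rewrite -[RHS](int_cst P); apply: eq_Rintegral => w _.
  have Ba := Binf_affine (del *: Z w) 1 Bf.
  rewrite -[RHS](eqn Ba); apply: eq_Rintegral => x _.
  by rewrite (gen_translate _ _ _ _ Bf) scale1r addrC.
move=> f k Bf.
have [mf bf] := cmp Bf.
have Bp i : Binf (pder i f) by exact: Binf_pder.
have D1 : DP mu P (fun z => \sum_i S z.1 i k * pder i f (sm_pt z)).
  apply: DP_sum => i; have [m1 b1] := cmp (Bp i).
  by apply: DP_Mb => //; exact: (DP_1 P (SL1 i k)).
have D2 : DP mu P (fun z => sm_score k z * f (sm_pt z)).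
  by apply: DP_Mb => //; apply: DPZ; apply: DP_sum => i; exact: DPscore.
rewrite (DP_fub1 D1).2 (DP_fub1 D2).2; apply: eq_Rintegral => x _.
rewrite /sm_pt /sm_score /=.
have Ba := Binf_affine x del Bf.
have Ip g i : Binf g -> L1 P (fun w => g (x + del *: Z w)).
  move=> Bg; have [m1 b1] := smo_cmp (smo_meas Hs) (Binf_affine x del Bg).
  exact: L1_bnd.
have Ifs i : L1 P (fun w => sc i w * f (x + del *: Z w)).
  have [m1 b1] := smo_cmp (smo_meas Hs) Ba.
  exact: L1_mulb.
rewrite int_sum; last by move=> i; apply: L1Z; exact: Ip.
transitivity (\sum_i \int[P]_w (del^-1 * S x i k * (sc i w * f (x + del *: Z w)))); last first.
  rewrite -int_sum; last by move=> i; exact: L1Z.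
  apply: eq_Rintegral => w _; rewrite mulr_sumr mulr_suml.
  by apply: eq_bigr => i _; ring.
apply: eq_bigr => i _; rewrite !intZ//; last exact: Ip.
have := smo_ibp Hs (ltn_ord i) Ba.
rewrite pder_affine// intZ; last exact: Ip.
by move=> <-; rewrite mulrACA mulVf ?lt0r_neq0// mul1r.
Qed.

End smoothed_solution.

(** * From test functions to bounded functions *)

Section flat_functions.
Variable R : realType.

(* The family [t ^- m * exp (- 1 / t)] extended by 0 to [t <= 0] is closed under
   differentiation up to linear combinations. *)
Definition flat (m : nat) (t : R) : R :=
  if 0 < t then t^-1 ^+ m * expR (- t^-1) else 0.

Definition flat' (m : nat) (t : R) : R := flat m.+2 t - m%:R * flat m.+1 t.

(** From [1 + s / m <= exp (s / m)] comes [s exp (- s / m) <= m], which is raised to the power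
    [m]. *)
Lemma pow_exp_le (m : nat) (s : R) : 0 <= s -> s ^+ m * expR (- s) <= m%:R ^+ m.
Proof.
move=> s0; case: m => [|n].
  by rewrite !expr0 mul1r -expR0 ler_expR oppr_le0.
pose N : R := n.+1%:R; have N0 : 0 < N by rewrite ltr0n.
have -> : - s = N * - (s / N) by rewrite mulrN mulrCA divff ?mulr1 ?lt0r_neq0.
rewrite expRM_natl -exprMn; apply: lerXn2r; rewrite ?nnegrE ?ler0n//.
  by rewrite mulr_ge0 ?expR_ge0.
rewrite expRN ler_pdivrMr ?expR_gt0//.
by have := expR_ge1Dx (s / N); rewrite -(ler_pM2l N0) mulrDr mulrCA divff ?lt0r_neq0//; lra.
Qed.

Lemma flat_bnd m : bnd (flat m).
Proof.
exists (m%:R ^+ m) => t; rewrite /flat; case: ltP => t0; last first.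
  by rewrite normr0 exprn_ge0.
have ti : 0 <= t^-1 by rewrite invr_ge0 ltW.
by rewrite ger0_norm ?pow_exp_le// mulr_ge0 ?exprn_ge0 ?expR_ge0.
Qed.

(** For the derivative at 0: the difference quotient there becomes [h] times the bounded
    [flat m.+2 h]. *)
Lemma flat_shift2 m t : flat m t = t ^+ 2 * flat m.+2 t.
Proof.
rewrite /flat; case: ltP => t0; last by rewrite mulr0.
by rewrite mulrA !exprS; congr (_ * _); field; rewrite lt0r_neq0.
Qed.

Lemma flat_is_derive m t : is_derive t (1 : R) (flat m) (flat' m t).
Proof.
have [t0|t0|<-] := ltgtP 0 t.
- have nt0 : t != 0 by rewrite lt0r_neq0.
  apply: (@near_eq_is_derive _ _ _ (fun u : R => u^-1 ^+ m * expR (- u^-1))).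
    by near=> u; rewrite /flat; have -> : 0 < u by near: u; exact: lt_nbhsr.
  have dV : is_derive t (1 : R) (fun u : R => u^-1) (- t ^- 2 *: (1 : R)).
    exact: is_deriveV.
  have dE : is_derive t (1 : R) (fun u : R => expR (- u^-1)) (expR (- t^-1) * - (- t ^- 2 *: (1 : R))).
    exact: (is_derive1_comp (f := expR) (g := fun u : R => - u^-1)).
  have := is_deriveM (is_deriveX m dV) dE; rewrite !fctE => dM.
  apply: is_derive_eq; rewrite /flat' /flat t0 /GRing.scale /= mulr1.
  case: m {dM} => [|m]; first by rewrite !expr0 /=; field.
  by rewrite /= -exprVn; move: (t^-1) => u; rewrite !exprS; ring.
- apply: (@near_eq_is_derive _ _ _ (fun=> 0 : R)).
    by near=> u; rewrite /flat; have /ltW/le_gtF -> : u < 0 by near: u; exact: lt_nbhsl.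
  by rewrite /flat' /flat (lt_gtF t0) mulr0 subr0; exact: is_derive_cst.
have -> : flat' m 0 = 0 by rewrite /flat' /flat ltxx mulr0 subr0.
have cv : h^-1 *: ((flat m \o shift 0) (h *: (1 : R)) - flat m 0) @[h --> 0^'] --> (0 : R).
  have [C C0 hC] := bnd_gt0 (flat_bnd m.+2).
  apply/cvgrPdist_le => e e0; near=> h.
  rewrite sub0r normrN /= addr0 -[h *: 1]/(h * 1) mulr1 {2}/flat ltxx subr0.
  rewrite flat_shift2 -[_ *: _]/(_ * _) expr2 -mulrA mulKf; last by near: h; exact: nbhs_dnbhs_neq.
  rewrite normrM (@le_trans _ _ (`|h| * C))// ?ler_wpM2l// -ler_pdivlMr//.
  by near: h; apply: dnbhs0_le; rewrite divr_gt0.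
by apply: DeriveDef; [apply/cvg_ex; exists 0|exact: cvg_lim].
Unshelve. all: by end_near.
Qed.

Lemma flat_lip m : exists2 L : R, 0 < L & forall a b, `|flat m b - flat m a| <= L * `|b - a|.
Proof.
have /bnd_gt0[L L0 hL] : bnd (flat' m).
  by apply: bndD; [exact: flat_bnd|apply: bndN; apply: bndZ; exact: flat_bnd].
exists L => // a b; wlog ab : a b / a <= b.
  by move=> H; have /orP[|ba] := le_total a b; [exact: H|rewrite distrC (distrC b); exact: H].
have [c _ ->] := @MVT_segment R (flat m) (flat' m) a b ab
  (fun x _ => flat_is_derive m x) (derivable_within_continuous (fun x _ => @ex_derive _ _ _ _ _ _ _ (flat_is_derive m x))).
by rewrite normrM ler_wpM2r.
Qed.

Lemma flat_rem m : exists2 C : R, 0 < C & forall a b,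
  `|flat m b - flat m a - flat' m a * (b - a)| <= C * (b - a) ^+ 2.
Proof.
have [L1 L10 h1] := flat_lip m.+1; have [L2 L20 h2] := flat_lip m.+2.
have lip' a b : `|flat' m b - flat' m a| <= (L2 + m%:R * L1) * `|b - a|.
  rewrite /flat' [X in `|X|](_ : _ = (flat m.+2 b - flat m.+2 a) - m%:R * (flat m.+1 b - flat m.+1 a)); last by ring.
  rewrite (le_trans (ler_normB _ _))// mulrDl lerD// normrM normr_nat -mulrA.
  by rewrite ler_wpM2l.
have L0 : 0 < L2 + m%:R * L1 by rewrite ltr_pwDl// mulr_ge0// ltW.
exists (L2 + m%:R * L1) => // a b.
have key a' b' : a' <= b' -> exists c, [/\ a' <= c, c <= b' &
    flat m b' - flat m a' = flat' m c * (b' - a')].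
  move=> ab; have [c] := @MVT_segment R (flat m) (flat' m) a' b' ab
    (fun x _ => flat_is_derive m x) (derivable_within_continuous (fun x _ => @ex_derive _ _ _ _ _ _ _ (flat_is_derive m x))).
  by rewrite in_itv/= => /andP[? ?] ?; exists c.
have [c hc E] : exists2 c, `|c - a| <= `|b - a| & flat m b - flat m a = flat' m c * (b - a).
  have /orP[ab|ba] := le_total a b.
    by have [c [? ? ?]] := key _ _ ab; exists c => //; rewrite !ger0_norm ?subr_ge0// lerB.
  have [c [? ? E]] := key _ _ ba; exists c.
    by rewrite distrC (distrC b) !ger0_norm ?subr_ge0// lerB.
  by rewrite -opprB E; ring.
rewrite E -mulrBl normrM -real_normK ?num_real// expr2 mulrA ler_wpM2r//.
by rewrite (le_trans (lip' _ _))// ler_wpM2l// ltW.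
Qed.

End flat_functions.

Section cutoff_function.
Variables (R : realType) (d : nat).
Implicit Types (u : 'rV[R]_d -> R) (g : 'I_d -> 'rV[R]_d -> R).

Lemma qrem_flat m u g : bnd u -> (forall i, bnd (g i)) -> qrem u g ->
  qrem (fun x => flat m (u x)) (fun i x => flat' m (u x) * g i x).
Proof.
move=> bu bg qg.
have [L L0 hL] := qrem_lip bu bg qg.
have [C C0 hC] := qremP qg.
have [D D0 hD] := flat_rem R m.
have /bnd_gt0[B B0 hB] : bnd (@flat' R m).
  by apply: bndD; [exact: flat_bnd|apply: bndN; apply: bndZ; exact: flat_bnd].
exists (D * L ^+ 2 + B * C) => x h.
rewrite linZ.
have -> : flat m (u (x + h)) - flat m (u x) - flat' m (u x) * lin g x h =
  (flat m (u (x + h)) - flat m (u x) - flat' m (u x) * (u (x + h) - u x)) +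
  flat' m (u x) * (u (x + h) - u x - lin g x h) by ring.
rewrite (le_trans (ler_normD _ _))// [leRHS]mulrDl lerD//.
  rewrite (le_trans (hD _ _))// -mulrA ler_wpM2l ?(ltW D0)// -exprMn.
  by rewrite -real_normK ?num_real// lerXn2r ?nnegrE// mulr_ge0.
by rewrite normrM -mulrA ler_pM.
Qed.

Lemma BI_flat n m u : BI n u -> BI n (fun x => flat m (u x)).
Proof.
have bf m' u' : bnd (fun x : 'rV[R]_d => flat m' (u' x)).
  by have [C hC] := flat_bnd R m'; exists C.
elim: n m u => [m u _|n IH m u Bu]; first exact: bf.
have Pu := BI_pred Bu; have [bu [g qg Bg]] := BI_S Bu.
split; first exact: bf.
exists (fun i x => flat' m (u x) * g i x).
  by apply: qrem_flat => // i; exact: BI_bnd (Bg i).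
move=> i; apply: BIM => //; apply: BID; first exact: IH.
by apply: BIN; apply: BIZ; exact: IH.
Qed.

(** [k0 x > 1 / 2] means [<x, x> < 2], so composing [flat 0] with the already smooth [k0] gives a
    bump of compact support. Its value at 0 is left as it is and divided out in [eqn_Binf]. *)
Definition cutoff (x : 'rV[R]_d) : R := flat 0 (k0 x - 2^-1).

Lemma Binf_cutoff : Binf cutoff.
Proof.
move=> n; apply: BI_flat; apply: BID; first exact: Binf_k0.
exact: BI_cst.
Qed.

Lemma cutoff_out x : 2 <= `|x| -> cutoff x = 0.
Proof.
move=> x2; rewrite /cutoff /flat ifF//; apply: le_gtF; rewrite subr_le0.
rewrite /k0 lef_pV2 ?posrE ?kden_gt0//.
have := norm_sqr_le x; rewrite /kden; have := sqr_ge0 (`|x| - 2).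
by nra.
Qed.

Lemma cutoff0_gt0 : 0 < cutoff 0.
Proof.
rewrite /cutoff /flat /k0 /kden ifT; first by rewrite mulr_gt0 ?expr0 ?expR_gt0.
by rewrite /dotv big1 ?mul0r ?addr0 ?invr1 => [|i _]; rewrite ?mxE ?mul0r//; lra.
Qed.

End cutoff_function.

Lemma cvg_sumR (R : realType) (T : Type) (F : set_system T) {FF : Filter F} (I : Type)
    (r : seq I) (f : T -> I -> R) (l : I -> R) :
  (forall i, f x i @[x --> F] --> l i) ->
  \sum_(i <- r) f x i @[x --> F] --> \sum_(i <- r) l i.
Proof.
by move=> fl; apply: cvg_big => // x; exact: add_continuous.
Qed.

Lemma closed_rV_ball (R : realType) (d : nat) (r : R) :
  closed [set x : 'rV[R]_d | `|x| <= r].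
Proof.
by apply: (@preimage_closed _ _ (fun x : 'rV[R]_d => `|x|) [set t | t <= r]) => [x _|];
  [exact: norm_continuous|exact: closed_le].
Qed.

Lemma compact_rV_ball (R : realType) (d : nat) (r : R) :
  compact [set x : 'rV[R]_d | `|x| <= r].
Proof.
apply: bounded_closed_compact; last exact: closed_rV_ball.
by exists r; split; [exact: num_real|move=> M rM x /= xr; rewrite (le_trans xr)// ltW].
Qed.

Lemma cvg_contract (R : realType) (d : nat) (g : 'rV[R]_d -> R) (x : 'rV[R]_d) :
  continuous g -> g (0 + harmonic n *: x) @[n --> \oo] --> g 0.
Proof.
move=> cg; have cv : 0 + harmonic n *: x @[n --> \oo] --> (0 : 'rV[R]_d).
  rewrite -[X in _ --> X]addr0; apply: cvgD; first exact: cvg_cst.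
  by rewrite -(scale0r x); apply: cvgZr_tmp; exact: cvg_harmonic.
exact: (continuous_cvg _ (cg 0) cv).
Qed.

Lemma finite_bound (R : realType) (I : finType) (T : Type) (g : I -> T -> R) :
  (forall i, bnd (g i)) -> exists2 C : R, 0 <= C & forall i x, `|g i x| <= C.
Proof.
move=> /choice[c hc]; exists (\sum_i `|c i|) => [|i x]; first exact: sumr_ge0.
rewrite (le_trans (hc i x))// (le_trans (ler_norm _))// (bigD1 i)//= lerDl.
exact: sumr_ge0.
Qed.

Section equation_extension.
Variables (R : realType) (d d1 : nat) (mu : probability (Rd R d) R).
Variables (S : 'rV[R]_d -> 'M[R]_(d, d1)) (b : 'rV[R]_d -> 'rV[R]_d).
Hypothesis mS : forall i k, measurable_fun setT (fun x : Rd R d => S x i k).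
Hypothesis mb : forall i, measurable_fun setT (fun x : Rd R d => b x 0 i).
Hypothesis IS : forall i k, L1 mu (fun x => S x i k ^+ 2).

Lemma cov_L1 i j : L1 mu (fun x => (S x *m (S x)^T) i j).
Proof.
under eq_fun do rewrite cov_entry.
by apply: L1_sum => k; apply: L1_sqr_mul.
Qed.

(** Dominated convergence, with asymmetric hypotheses: second derivatives meet the merely integrable
    covariance and must be uniformly bounded, while first derivatives may grow like any [G] for
    which [|b| G] is integrable. The energy identity uses [G = |x|]. *)
Lemma gen_limit (F : nat -> 'rV[R]_d -> R) (p : 'I_d -> 'rV[R]_d -> R)
    (h : 'I_d -> 'I_d -> 'rV[R]_d -> R) (C : R) (G : 'rV[R]_d -> R) :
  (forall n, Binf (F n)) ->
  (forall n i x, `|pder i (F n) x| <= G x) ->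
  (forall n i j x, `|pder i (pder j (F n)) x| <= C) ->
  (forall i, L1 mu (fun x => `|b x 0 i| * G x)) ->
  (forall i x, pder i (F n) x @[n --> \oo] --> p i x) ->
  (forall i j x, pder i (pder j (F n)) x @[n --> \oo] --> h i j x) ->
  (forall n, \int[mu]_x gen (S x) (b x) (F n) x = 0) ->
  \int[mu]_x (\sum_i \sum_j (S x *m (S x)^T) i j * h i j x + \sum_i b x 0 i * p i x) = 0.
Proof.
move=> BF FG FC IG cp ch F0.
set K : Rd R d -> R := fun x => _.
have mp n i : measurable_fun setT (fun x : Rd R d => pder i (F n) x).
  by apply: Rd_continuous; apply: Binf_continuous; exact: Binf_pder.
have mh n i j : measurable_fun setT (fun x : Rd R d => pder i (pder j (F n)) x).
  by apply: Rd_continuous; apply: Binf_continuous; do 2 apply: Binf_pder.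
have := @int_cvg _ (Rd R d) R mu (fun n x => gen (S x) (b x) (F n) x) K
  (fun x => \sum_i \sum_j `|(S x *m (S x)^T) i j| * C + \sum_i `|b x 0 i| * G x).
case.
- move=> n; apply: measurable_funD.
    apply: measurable_sum => i; apply: measurable_sum => j.
    by apply: measurable_funM => //; exact: L1_meas (cov_L1 i j).
  by apply: measurable_sum => i; apply: measurable_funM.
- move=> n x; rewrite (le_trans (ler_normD _ _))// lerD//.
    rewrite (le_trans (ler_norm_sum _ _ _))// ler_sum// => i _.
    rewrite (le_trans (ler_norm_sum _ _ _))// ler_sum// => j _.
    by rewrite normrM ler_wpM2l.
  rewrite (le_trans (ler_norm_sum _ _ _))// ler_sum// => i _.
  by rewrite normrM ler_wpM2l.
- apply: L1D; last exact: L1_sum.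
  apply: L1_sum => i; apply: L1_sum => j.
  under eq_fun do rewrite mulrC.
  by apply: L1Z; apply: L1_norm; exact: cov_L1.
- move=> x; apply: cvgD.
    apply: cvg_sumR => i; apply: cvg_sumR => j.
    by apply: cvgM; [exact: cvg_cst|exact: ch].
  by apply: cvg_sumR => i; apply: cvgM; [exact: cvg_cst|exact: cp].
move=> _; under eq_fun do rewrite F0; move=> cv.
exact: (cvg_unique _ cv (cvg_cst _)).
Qed.

Hypothesis Ib : forall i, L1 mu (fun x => b x 0 i).

Section bounded_tests.
Hypothesis eq0 : forall f : 'rV[R]_d -> R, test_fun f ->
  \int[mu]_x gen (S x) (b x) f x = 0.

Let dil n (x : 'rV[R]_d) : R := cutoff (0 + harmonic n *: x).

Let Bdil n : Binf (dil n).
Proof. by apply: Binf_affine; exact: Binf_cutoff. Qed.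

Let harm01 n : 0 < harmonic n :> R /\ harmonic n <= 1 :> R.
Proof. by rewrite /harmonic /= invr_gt0 invf_le1 ?ltr0n ?ler1n. Qed.

(** Each derivative falling on the dilated bump [cutoff (x / (n + 1))] brings a factor [harmonic n],
    so the limit of the equations is the positive number [cutoff 0] times the desired integral. *)
Lemma eqn_Binf f : Binf f -> \int[mu]_x gen (S x) (b x) f x = 0.
Proof.
move=> Bf; have Bb := Binf_cutoff R d.
pose F n x := f x * dil n x.
have BF n : Binf (F n) by exact: BinfM.
have tF n : test_fun (F n).
  split; first exact: Binf_smooth.
  apply: (@subclosed_compact _ _ [set x | `|x| <= 2 * n.+1%:R]).
  - exact: closed_closure.
  - exact: compact_rV_ball.
  apply: (@subset_trans _ (closure [set x | `|x| <= 2 * n.+1%:R])).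
    apply: closureS => x /=; apply: contraNT; rewrite -ltNge => x2.
    rewrite /F /dil add0r cutoff_out ?mulr0// normrZ.
    have [h0 _] := harm01 n; rewrite gtr0_norm// /harmonic /= mulrC ler_pdivlMr ?ltr0n//.
    exact: ltW.
  by rewrite -(iffLR (closure_id _) (@closed_rV_ball _ _ _)).
have Bp i : Binf (pder i f) by exact: Binf_pder.
have Ed n i : pder i (dil n) = fun x => harmonic n * pder i (@cutoff R d) (0 + harmonic n *: x).
  by rewrite /dil pder_affine.
have Bd i n : Binf (fun x => pder i (@cutoff R d) (0 + harmonic n *: x)).
  by apply: Binf_affine; exact: Binf_pder.
have EF n i : pder i (F n) = fun x => pder i f x * dil n x
    + harmonic n * (f x * pder i (@cutoff R d) (0 + harmonic n *: x)).
  by rewrite /F pderM// Ed; apply/funext => x; ring.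
have EFF n i j : pder i (pder j (F n)) = fun x => pder i (pder j f) x * dil n x
    + harmonic n * (pder j f x * pder i (@cutoff R d) (0 + harmonic n *: x)
       + pder i f x * pder j (@cutoff R d) (0 + harmonic n *: x)
       + harmonic n * (f x * pder i (pder j (@cutoff R d)) (0 + harmonic n *: x))).
  rewrite EF pderD; [|exact: BinfM|by apply: BinfZ; exact: BinfM].
  rewrite pderM// pderZ; last exact: BinfM.
  rewrite pderM// Ed pder_affine; last exact: Binf_pder.
  apply/funext => x; move: (0 + _) => y; move: (pder i (pder j (@cutoff R d)) y)
    (pder i (@cutoff R d) y) (pder j (@cutoff R d) y) (pder i (pder j f) x) => b2 bi bj f2.
  by move: (pder i f x) (pder j f x) (f x) (dil n x) (harmonic n) => fi fj f0 w e; ring.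
have [C0 C00 h0] : exists2 C : R, 0 < C & forall x, `|f x| <= C.
  exact: bnd_gt0 (Binf_bnd Bf).
have bound (I : finType) (g : I -> 'rV[R]_d -> R) (Bg : forall i, Binf (g i)) :=
  finite_bound (fun i => Binf_bnd (Bg i)).
have [C1 C10 h1] := bound _ _ Bp.
have [C2 C20 h2] := bound _ (fun ij : 'I_d * 'I_d => pder ij.1 (pder ij.2 f))
  (fun ij => Binf_pder ij.1 (Bp ij.2)).
have [D0 D00 g0] := bound _ (fun _ : unit => @cutoff R d) (fun=> Bb).
have [D1 D10 g1] := bound _ _ (fun i => Binf_pder i Bb).
have [D2 D20 g2] := bound _ (fun ij : 'I_d * 'I_d => pder ij.1 (pder ij.2 (@cutoff R d)))
  (fun ij => Binf_pder ij.1 (Binf_pder ij.2 Bb)).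
have hM n (u : R) : `|harmonic n * u| <= `|u|.
  have [p0 p1] := harm01 n.
  by rewrite normrM (gtr0_norm p0) ler_piMl.
have E : \int[mu]_x (\sum_i \sum_j (S x *m (S x)^T) i j * (pder i (pder j f) x * @cutoff R d 0)
    + \sum_i b x 0 i * (pder i f x * @cutoff R d 0)) = @cutoff R d 0 * \int[mu]_x gen (S x) (b x) f x.
  rewrite -intZ; last first.
    apply: L1D.
      apply: L1_sum => i; apply: L1_sum => j; apply: L1_mulb; last exact: cov_L1.
        by apply: Rd_continuous; apply: Binf_continuous; exact: Binf_pder.
      by apply: Binf_bnd; exact: Binf_pder.
    apply: L1_sum => i; apply: L1_mulb => //; last exact: Binf_bnd.
    by apply: Rd_continuous; exact: Binf_continuous.
  apply: eq_Rintegral => x _; rewrite /gen mulrDr !mulr_sumr; congr (_ + _).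
    apply: eq_bigr => i _; rewrite mulr_sumr; apply: eq_bigr => j _.
    by move: (pder i (pder j f) x) => u; ring.
  by apply: eq_bigr => i _; move: (pder i f x) => u; ring.
suff : @cutoff R d 0 * \int[mu]_x gen (S x) (b x) f x = 0.
  by move=> /eqP; rewrite mulf_eq0 (gt_eqF (cutoff0_gt0 R d)) => /eqP.
rewrite -E.
apply: (@gen_limit F (fun i x => pder i f x * @cutoff R d 0)
  (fun i j x => pder i (pder j f) x * @cutoff R d 0)
  (C2 * D0 + (C1 * D1 + C1 * D1 + C0 * D2)) (fun=> C1 * D0 + C0 * D1) BF).
- move=> n i x; rewrite EF (le_trans (ler_normD _ _))// lerD//.
    by rewrite normrM ler_pM// ?(g0 tt).
  by rewrite (le_trans (hM _ _))// normrM ler_pM.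
- move=> n i j x; rewrite EFF (le_trans (ler_normD _ _))// lerD//.
    by rewrite normrM ler_pM// ?(g0 tt) ?(h2 (i, j)).
  rewrite (le_trans (hM _ _))// (le_trans (ler_normD _ _))// lerD//.
    by rewrite (le_trans (ler_normD _ _))// lerD// normrM ler_pM.
  by rewrite (le_trans (hM _ _))// normrM ler_pM// (g2 (i, j)).
- move=> i; under eq_fun do rewrite mulrC.
  by apply: L1Z; apply: L1_norm.
- move=> i x; rewrite -[X in _ --> X]addr0; under eq_fun do rewrite EF.
  apply: cvgD.
    by apply: cvgM; [exact: cvg_cst|apply: cvg_contract; exact: Binf_continuous].
  rewrite -[X in _ --> X](mul0r (f x * pder i (@cutoff R d) 0)).
  apply: cvgM; first exact: cvg_harmonic.
  apply: cvgM; [exact: cvg_cst|apply: cvg_contract; apply: Binf_continuous; exact: Binf_pder].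
- move=> i j x; rewrite -[X in _ --> X]addr0; under eq_fun do rewrite EFF.
  apply: cvgD.
    by apply: cvgM; [exact: cvg_cst|apply: cvg_contract; exact: Binf_continuous].
  rewrite -[X in _ --> X](mul0r (pder j f x * pder i (@cutoff R d) 0 + pder i f x * pder j (@cutoff R d) 0
     + 0 * (f x * pder i (pder j (@cutoff R d)) 0))).
  have cc g : Binf g -> g (0 + harmonic n *: x) @[n --> \oo] --> g 0.
    by move=> Bg; apply: cvg_contract; exact: Binf_continuous.
  apply: cvgM; first exact: cvg_harmonic.
  apply: cvgD; [apply: cvgD|apply: cvgM; first exact: cvg_harmonic].
  + by apply: cvgM; [exact: cvg_cst|apply: cc; exact: Binf_pder].
  + by apply: cvgM; [exact: cvg_cst|apply: cc; exact: Binf_pder].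
  + by apply: cvgM; [exact: cvg_cst|apply: cc; do 2 apply: Binf_pder].
- by move=> n; apply: eq0.
Qed.

End bounded_tests.
End equation_extension.

(** * The case q > 0 *)

Lemma k0_0 (R : realType) (d : nat) : k0 (0 : 'rV[R]_d) = 1.
Proof. by rewrite /k0 /kden /dotv big1 ?mul0r ?addr0 ?invr1// => i _; rewrite mxE mul0r. Qed.

Lemma yk_0 (R : realType) (d : nat) i : yk i (0 : 'rV[R]_d) = 0.
Proof. by rewrite /yk mxE mul0r. Qed.

Section moment_identities.
Variables (R : realType) (d d1 : nat) (mu : probability (Rd R d) R).
Variables (S : 'rV[R]_d -> 'M[R]_(d, d1)) (b : 'rV[R]_d -> 'rV[R]_d).
Hypothesis mS : forall i k, measurable_fun setT (fun x : Rd R d => S x i k).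
Hypothesis mb : forall i, measurable_fun setT (fun x : Rd R d => b x 0 i).
Hypothesis IS : forall i k, L1 mu (fun x => S x i k ^+ 2).
Hypothesis Ib : forall i, L1 mu (fun x => b x 0 i).
Hypothesis Ibx : forall i, L1 mu (fun x => `|b x 0 i| * `|x : 'rV[R]_d|).
Hypothesis eqB : forall f : 'rV[R]_d -> R, Binf f ->
  \int[mu]_x gen (S x) (b x) f x = 0.

Let harm_gt0 n : 0 < harmonic n :> R. Proof. by rewrite /harmonic /= invr_gt0. Qed.

Let harm_le1 n : harmonic n <= 1 :> R.
Proof. by rewrite /harmonic /= invf_le1 ?ler1n. Qed.

Let cc (g : 'rV[R]_d -> R) x : Binf g -> g (0 + harmonic n *: x) @[n --> \oo] --> g 0.
Proof. by move=> Bg; apply: cvg_contract; exact: Binf_continuous. Qed.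

(** The test functions [h^-1 yk i (h x)] are bounded approximations of [x_i]: as [h] tends to 0
    their gradients [cmat i j (h x)], bounded by 2, tend to the unit vector, and their Hessians
    carry a factor [h]. *)
Lemma mean_drift i : \int[mu]_x b x 0 i = 0.
Proof.
pose F n (x : 'rV[R]_d) : R := (harmonic n)^-1 * yk i (0 + harmonic n *: x).
have By n : Binf (fun x : 'rV[R]_d => yk i (0 + harmonic n *: x)).
  by apply: Binf_affine; exact: Binf_yk.
have EF n j : pder j (F n) = fun x => cmat i j (0 + harmonic n *: x).
  rewrite /F pderZ// pder_affine; last exact: Binf_yk.
  apply/funext => x; rewrite mulKf ?gt_eqF// pder_yk; reflexivity.
have EFF n l j : pder l (pder j (F n)) =
    fun x => harmonic n * pder l (cmat i j) (0 + harmonic n *: x).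
  by rewrite EF pder_affine//; exact: Binf_cmat.
have [C _ hC] := finite_bound (fun lj : 'I_d * 'I_d =>
  Binf_bnd (Binf_pder lj.1 (@Binf_cmat R d i lj.2))).
have := @gen_limit _ _ _ mu S b mS mb IS F (fun j _ => (i == j)%:R) (fun _ _ _ => 0) C (fun=> 2).
have -> : \int[mu]_x (\sum_(i0 < d) \sum_(j < d) (S x *m (S x)^T) i0 j * 0
     + \sum_(i0 < d) b x 0 i0 * (i == i0)%:R) = \int[mu]_x b x 0 i.
  apply: eq_Rintegral => x _; rewrite big1 ?add0r => [|j _]; last first.
    by rewrite big1// => k _; rewrite mulr0.
  rewrite (bigD1 i)//= eqxx mulr1 big1 ?addr0// => j ji.
  by rewrite eq_sym (negbTE ji) mulr0.
apply.
- by move=> n; apply: BinfZ.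
- move=> n j x; rewrite EF /cmat (le_trans (ler_normB _ _))// lerD//.
    rewrite normrM (ger0_norm (ltW (k0_gt0 _))) mulr_ile1 ?normr_ge0 ?k0_le1 ?(ltW (k0_gt0 _))//.
    by case: eqP; rewrite ?normr1 ?normr0.
  by rewrite normrM mulr_ile1 ?yk_le1.
- move=> n l j x; rewrite EFF normrM (gtr0_norm (harm_gt0 n)) (le_trans _ (hC (l, j) (0 + harmonic n *: x)))//.
  by rewrite ler_piMl.
- by move=> j; under eq_fun do rewrite mulrC; apply: L1Z; exact: L1_norm.
- move=> j x; under eq_fun do rewrite EF.
  have -> : (i == j)%:R = cmat i j (0 : 'rV[R]_d) by rewrite /cmat k0_0 yk_0 mul0r subr0 mulr1.
  by apply: cc; exact: Binf_cmat.
- move=> l j x.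
  have -> : (fun n => pder l (pder j (F n)) x) =
      fun n => harmonic n * pder l (cmat i j) (0 + harmonic n *: x).
    by apply/funext => n; rewrite EFF.
  rewrite -[X in _ --> X](mul0r (pder l (cmat i j) (0 : 'rV[R]_d))).
  apply: cvgM; first exact: cvg_harmonic.
  by apply: cc; apply: Binf_pder; exact: Binf_cmat.
- by move=> n; apply: eqB; apply: BinfZ.
Qed.

(* The test functions are [- h^-2 k0(h x)], an approximation of [|x|^2 / 2] as [h -> 0]. *)
Lemma energy_identity :
  \int[mu]_x (\sum_i \sum_k S x i k ^+ 2 + \sum_i b x 0 i * (x : 'rV[R]_d) 0 i) = 0.
Proof.
pose h n : R := harmonic n.
have h0 n : h n != 0 by rewrite gt_eqF.
pose F n (x : 'rV[R]_d) : R := - (h n ^- 2) * k0 (0 + h n *: x).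
pose g i (x : 'rV[R]_d) : R := yk i x * k0 x.
have Bg i : Binf (g i) by apply: BinfM; [exact: Binf_yk|exact: Binf_k0].
have Bk n : Binf (fun x : 'rV[R]_d => k0 (0 + h n *: x)).
  by apply: Binf_affine; exact: Binf_k0.
have EF n i : pder i (F n) = fun x => (h n)^-1 * g i (0 + h n *: x).
  rewrite /F pderZ// pder_affine; last exact: Binf_k0.
  apply/funext => x; rewrite pder_k0 /g; move: (yk _ _) (k0 _) => u v.
  by field; exact: h0.
have EFF n j i : pder j (pder i (F n)) = fun x => pder j (g i) (0 + h n *: x).
  rewrite EF pderZ; last by apply: Binf_affine.
  rewrite pder_affine//; apply/funext => x; rewrite mulKf//.
(* In this form the gradient is dominated by [|x|] uniformly in [n], so that integrability of
   [|b| |x|] applies. *)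
have EF' n i x : pder i (F n) x = x 0 i * k0 (0 + h n *: x) ^+ 2.
  rewrite EF /g /yk; move: (k0 _) => u; rewrite !mxE add0r.
  by field; exact: h0.
have [C _ hC] := finite_bound (fun ij : 'I_d * 'I_d => Binf_bnd (Binf_pder ij.1 (Bg ij.2))).
have := @gen_limit _ _ _ mu S b mS mb IS F (fun i x => x 0 i) (fun i j _ => (j == i)%:R) C (fun x => `|x|).
have -> : \int[mu]_x (\sum_(i < d) \sum_(j < d) (S x *m (S x)^T) i j * (j == i)%:R
     + \sum_(i < d) b x 0 i * (x : 'rV[R]_d) 0 i) =
   \int[mu]_x (\sum_i \sum_k S x i k ^+ 2 + \sum_i b x 0 i * (x : 'rV[R]_d) 0 i).
  apply: eq_Rintegral => x _; congr (_ + _); apply: eq_bigr => i _.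
  rewrite (bigD1 i)//= eqxx mulr1 big1 ?addr0 => [|j ji]; last by rewrite (negbTE ji) mulr0.
  by rewrite cov_entry; apply: eq_bigr => k _; rewrite expr2.
apply => //.
- by move=> n; apply: BinfZ.
- move=> n i x; rewrite EF' normrM -[leRHS]mulr1 ler_pM ?coord_le//.
  by rewrite normrX (ger0_norm (ltW (k0_gt0 _))) exprn_ile1 ?k0_le1 ?(ltW (k0_gt0 _)).
- by move=> n i j x; rewrite EFF (hC (i, j)).
- move=> i x.
  have -> : (fun n => pder i (F n) x) = fun n => x 0 i * k0 (0 + h n *: x) ^+ 2.
    by apply/funext => n; rewrite EF'.
  rewrite -[X in _ --> X]mulr1; apply: cvgM; first exact: cvg_cst.
  have -> : 1 = k0 (0 : 'rV[R]_d) ^+ 2 by rewrite k0_0 expr1n.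
  by apply: (cc (g := fun x => k0 x ^+ 2)); apply: BinfX; exact: Binf_k0.
- move=> i j x.
  have -> : (fun n => pder i (pder j (F n)) x) = fun n => pder i (g j) (0 + h n *: x).
    by apply/funext => n; rewrite EFF.
  have -> : (j == i)%:R = pder i (g j) (0 : 'rV[R]_d).
    rewrite /g pderM; [|exact: Binf_yk|exact: Binf_k0].
    by rewrite pder_yk !k0_0 !yk_0 !mul0r subr0 !mulr1 addr0.
  by apply: cc; exact: Binf_pder.
- by move=> n; apply: eqB; apply: BinfZ.
Qed.

End moment_identities.

Lemma enorm_coord_le (R : realType) (d : nat) (x : 'rV[R]_d) i : `|x 0 i| <= enorm x.
Proof. by rewrite -sqrtr_sqr ler_wsqrtr// coord_sqr_le. Qed.

Lemma enorm_norm_le (R : realType) (d : nat) (x : 'rV[R]_d) : `|x| <= enorm x.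
Proof. by rewrite -[leLHS]ger0_norm// -sqrtr_sqr ler_wsqrtr// norm_sqr_le. Qed.

Lemma measurable_sqrt_comp dT (T : measurableType dT) (R : realType) (f : T -> R) :
  measurable_fun setT f -> measurable_fun setT (fun e => Num.sqrt (f e)).
Proof.
move=> mf; apply: (measurableT_comp _ mf); apply: continuous_measurable_fun.
exact: sqrt_continuous.
Qed.

Section solution_integrability.
Variables (R : realType) (d d1 : nat) (mu : probability (Rd R d) R).
Variables (S : 'rV[R]_d -> 'M[R]_(d, d1)) (b : 'rV[R]_d -> 'rV[R]_d).
Hypothesis mS : forall i k, measurable_fun setT (fun x : Rd R d => S x i k).
Hypothesis mb : forall i, measurable_fun setT (fun x : Rd R d => b x 0 i).
Hypothesis sol : prob_solution S b mu.
Hypothesis fin : (\int[mu]_(x in [set: Rd R d])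
  ((frob (S x)) ^+ 2 + enorm (b x) * enorm (x : 'rV[R]_d))%:E < +oo)%E.

Let G (x : Rd R d) : R := frob (S x) ^+ 2 + enorm (b x) * enorm (x : 'rV[R]_d).

Let frobE x : frob (S x) ^+ 2 = \sum_i \sum_k S x i k ^+ 2.
Proof.
by rewrite sqr_sqrtr//; apply: sumr_ge0 => i _; apply: sumr_ge0 => k _; exact: sqr_ge0.
Qed.

Let bx_ge0 (x : Rd R d) : 0 <= enorm (b x) * enorm (x : 'rV[R]_d).
Proof. by rewrite mulr_ge0 ?sqrtr_ge0. Qed.

Let IG : L1 mu G.
Proof.
have mG : measurable_fun setT G.
  apply: measurable_funD.
    under eq_fun do rewrite frobE.
    apply: measurable_sum => i; apply: measurable_sum => k.
    by apply: measurable_funX.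
  apply: measurable_funM; apply: measurable_sqrt_comp; apply: measurable_sum => i.
    exact: measurable_funM.
  by apply: measurable_funM; exact: (@Rd_cmeas R d i).
apply/integrableP; split; first exact/measurable_EFinP.
rewrite (eq_integral (fun x => (G x)%:E)) // => x _ /=.
by rewrite ger0_norm// addr_ge0 ?sqr_ge0.
Qed.

Lemma sol_S2 i k : L1 mu (fun x => S x i k ^+ 2).
Proof.
apply: (L1_le (g := G)) => //; first exact: measurable_funX.
move=> x; rewrite ger0_norm ?sqr_ge0// (@le_trans _ _ (frob (S x) ^+ 2)) ?lerDl//.
rewrite frobE (bigD1 i)//= (bigD1 k)//= -addrA lerDl addr_ge0//.
  by apply: sumr_ge0 => *; exact: sqr_ge0.
by apply: sumr_ge0 => *; apply: sumr_ge0 => *; exact: sqr_ge0.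
Qed.

Lemma sol_bx i : L1 mu (fun x => `|b x 0 i| * `|x : 'rV[R]_d|).
Proof.
apply: (L1_le (g := G)) => //.
  apply: measurable_funM; first exact: measurableT_comp.
  by apply: Rd_continuous => x; exact: norm_continuous.
move=> x; rewrite ger0_norm ?mulr_ge0// (@le_trans _ _ (enorm (b x) * enorm (x : 'rV[R]_d)))//.
  by rewrite ler_pM// ?enorm_coord_le ?enorm_norm_le.
by rewrite lerDr sqr_ge0.
Qed.

(** On the unit ball this is the local integrability in the definition of a solution; outside it
    [|b|] is at most [|b| |x|]. *)
Lemma sol_b i : L1 mu (fun x => b x 0 i).
Proof.
pose B := [set x : 'rV[R]_d | `|x| <= 1].
have mB : measurable (B : set (Rd R d)).
  exact: (Rd_closed (@closed_rV_ball R d 1)).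
have /(integrable_mkcond _ mB) IB := ((sol.1 B (@compact_rV_ball R d 1)).2 i).
pose bB (x : Rd R d) : R := fine (((fun x : Rd R d => (b x 0 i)%:E) \_ B) x).
apply: (@L1_le _ _ _ mu _ (fun x : Rd R d => `|bB x| + `|b x 0 i| * `|x : 'rV[R]_d|)) => //.
  move=> x; rewrite /bB patchE; case: ifPn => [_|] /=.
    by rewrite lerDl mulr_ge0.
  rewrite notin_setE /B /= => /negP; rewrite -ltNge => x1.
  by rewrite normr0 add0r ler_peMr// ltW.
apply: L1D; last exact: sol_bx.
suff IbB : L1 mu bB by exact: L1_norm IbB.
apply: eq_integrable IB => // x _ /=; rewrite /bB patchE.
by case: ifP.
Qed.

Lemma sol_eqn f : Binf f -> \int[mu]_x gen (S x) (b x) f x = 0.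
Proof.
move=> Bf; apply: eqn_Binf => //; [exact: sol_S2|exact: sol_b|].
by move=> g /sol.2 h; rewrite /Rintegral -[RHS]/(fine 0%E) -h.
Qed.

End solution_integrability.

Lemma int0_null dT (T : measurableType dT) (R : realType) (M : {measure set T -> \bar R})
    (f : T -> R) : L1 M f -> (forall e, 0 <= f e) -> \int[M]_e f e = 0 ->
  M [set e | f e != 0] = 0%E.
Proof.
move=> If f0 int0.
have mf := L1_meas If.
have /(ae_eq_integral_abs _ measurableT) : measurable_fun setT (EFin \o f).
  exact/measurable_EFinP.
move=> /(_ M)[+ _] => /(_ _)[|N [mN N0 fN]].
  rewrite (eq_integral (EFin \o f)) => [|e _]; last by rewrite /= ger0_norm.
  by rewrite (int_EFin If) int0.
apply/eqP; rewrite eq_le measure_ge0 andbT -N0.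
apply: le_measure; rewrite ?inE//.
  rewrite (_ : [set e | f e != 0] = setT `&` f @^-1` [set~ 0]).
    by apply: mf => //; exact: measurableC.
  by rewrite setTI; apply/seteqP; split => e /= /eqP.
move=> e /= fe; apply: fN => /= h; move/eqP: fe; apply.
by have /(congr1 fine) := h I.
Qed.

Lemma Rd_set1 (R : realType) (d : nat) (p : 'rV[R]_d) : measurable ([set p] : set (Rd R d)).
Proof. by apply: Rd_closed; apply: accessible_closed_set1; exact: hausdorff_accessible (@norm_hausdorff _ _). Qed.

Lemma int_concentrated (R : realType) (d : nat) (mu : probability (Rd R d) R) (p : 'rV[R]_d) f :
  mu (~` [set p] : set (Rd R d)) = 0%E -> L1 mu f -> \int[mu]_x f x = f p.
Proof.
move=> mup If; rewrite -[RHS](int_cst mu); congr fine.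
apply: ae_eq_integral => //.
  exact: measurable_int If.
exists (~` [set p]); split => //; first by apply: measurableC; exact: Rd_set1.
by move=> x /= h xp; apply: h => _; rewrite xp.
Qed.

(** * Integrating a positive form against the product measure *)

Section positive_form.
Variables (R : realType) (d d1 : nat) (mu : probability (Rd R d) R).
Variables (S : 'rV[R]_d -> 'M[R]_(d, d1)) (b : 'rV[R]_d -> 'rV[R]_d).
Hypothesis mS : forall i k, measurable_fun setT (fun x : Rd R d => S x i k).
Hypothesis mb : forall i, measurable_fun setT (fun x : Rd R d => b x 0 i).
Hypothesis IS : forall i k, L1 mu (fun x => S x i k ^+ 2).
Hypothesis Ib : forall i, L1 mu (fun x => b x 0 i).
Hypothesis Ibx : forall i, L1 mu (fun x => `|b x 0 i| * `|x : 'rV[R]_d|).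

Definition sqS (x : 'rV[R]_d) : R := \sum_i \sum_k S x i k ^+ 2.
Definition bx (x : 'rV[R]_d) : R := \sum_i b x 0 i * x 0 i.

Hypothesis drift0 : forall i, \int[mu]_x b x 0 i = 0.
Hypothesis energy0 : \int[mu]_x (sqS x + bx x) = 0.

Lemma qfunE x y : qfun S b x y =
  \sum_i \sum_k (S x i k - S y i k) ^+ 2 + \sum_i (b x 0 i - b y 0 i) * (x - y) 0 i.
Proof.
rewrite /qfun addrC /mxtrace; congr (_ + _); apply: eq_bigr => i _; last first.
  by rewrite !mxE mulrC.
by rewrite mxE; apply: eq_bigr => k _; rewrite !mxE expr2.
Qed.

Lemma qfun_expand x y : qfun S b x y = (sqS x + bx x) + (sqS y + bx y)
  - 2 * (\sum_i \sum_k S x i k * S y i k) - \sum_i (b x 0 i * y 0 i + x 0 i * b y 0 i).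
Proof.
rewrite qfunE /sqS /bx mulr_sumr.
rewrite (eq_bigr (fun i => \sum_k S x i k ^+ 2 + \sum_k S y i k ^+ 2
  - 2 * \sum_k S x i k * S y i k)) => [|i _]; last first.
  by rewrite mulr_sumr -sumrN -!big_split/=; apply: eq_bigr => k _; ring.
rewrite [X in _ + X](eq_bigr (fun i => b x 0 i * x 0 i + b y 0 i * y 0 i
  - (b x 0 i * y 0 i + x 0 i * b y 0 i))) => [|i _]; last by rewrite !mxE; ring.
by rewrite !big_split/= !sumrN !big_split/=; ring.
Qed.

(** The cross terms [b(x) y] are not known to be integrable for the product measure, as [x] itself
    has no assumed moment. The weight makes [w x] bounded, by [1 / harmonic n], and tends to 1. *)
Let w n (x : 'rV[R]_d) : R := k0 (0 + harmonic n *: x).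

Let Bw n : Binf (w n).
Proof. by apply: Binf_affine; exact: Binf_k0. Qed.

Let mw n : measurable_fun setT (w n : Rd R d -> R).
Proof. by apply: Rd_continuous; exact: Binf_continuous. Qed.

Let w0 n x : 0 <= w n x. Proof. exact: ltW (k0_gt0 _). Qed.

Let w1 n x : w n x <= 1. Proof. exact: k0_le1. Qed.

Let harm_gt0 n : 0 < harmonic n :> R. Proof. by rewrite /harmonic /= invr_gt0. Qed.

Let wx n x i : `|w n x * x 0 i| <= (harmonic n)^-1.
Proof.
have := yk_le1 i (0 + harmonic n *: x); rewrite /yk -/(w n x) mxE mxE mxE add0r.
by rewrite mulrC mulrCA normrM (gtr0_norm (harm_gt0 n)) -ler_pdivlMl// mulr1.
Qed.

Let mx i : measurable_fun setT (fun x : Rd R d => (x : 'rV[R]_d) 0 i).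
Proof. exact: (@Rd_cmeas R d i). Qed.

Let Ie : L1 mu (fun x => sqS x + bx x).
Proof.
apply: L1D; first by apply: L1_sum => i; apply: L1_sum => k.
apply: L1_sum => i; apply: (L1_le _ _ (Ibx i)); first exact: measurable_funM.
by move=> x; rewrite normrM ler_wpM2l// coord_le.
Qed.

Let Iw n : L1 mu (w n).
Proof. by apply: L1_bnd => //; exact: Binf_bnd. Qed.

Let bw n : bnd (w n). Proof. exact: Binf_bnd. Qed.

Let IwM n f : L1 mu f -> L1 mu (fun x => w n x * f x).
Proof. exact: L1_bM. Qed.

Let IS1 i k : L1 mu (fun x => S x i k).
Proof. by apply: L1_sqr_bound. Qed.

Let Iwx n i : L1 mu (fun x => w n x * (x : 'rV[R]_d) 0 i).
Proof. by apply: L1_bnd; [exact: measurable_funM|exists (harmonic n)^-1 => x; exact: wx]. Qed.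

Let J n (z : Rd R d * Rd R d) : R := w n z.1 * w n z.2 * qfun S b z.1 z.2.

Let JE n z : J n z =
  (w n z.1 * (sqS z.1 + bx z.1)) * w n z.2 + w n z.1 * (w n z.2 * (sqS z.2 + bx z.2))
  + (- 2) * (\sum_i \sum_k (w n z.1 * S z.1 i k) * (w n z.2 * S z.2 i k))
  + (-1) * \sum_i ((w n z.1 * b z.1 0 i) * (w n z.2 * (z.2 : 'rV[R]_d) 0 i)
     + (w n z.1 * (z.1 : 'rV[R]_d) 0 i) * (w n z.2 * b z.2 0 i)).
Proof.
rewrite /J qfun_expand.
move: (sqS z.1 + bx z.1) (sqS z.2 + bx z.2) => e1 e2.
have -> : \sum_i \sum_k w n z.1 * S z.1 i k * (w n z.2 * S z.2 i k) =
    w n z.1 * w n z.2 * \sum_i \sum_k S z.1 i k * S z.2 i k.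
  rewrite mulr_sumr; apply: eq_bigr => i _; rewrite mulr_sumr.
  by apply: eq_bigr => k _; rewrite mulrACA.
have -> : \sum_i ((w n z.1 * b z.1 0 i) * (w n z.2 * (z.2 : 'rV[R]_d) 0 i)
     + (w n z.1 * (z.1 : 'rV[R]_d) 0 i) * (w n z.2 * b z.2 0 i)) =
    w n z.1 * w n z.2 * \sum_i (b z.1 0 i * (z.2 : 'rV[R]_d) 0 i + (z.1 : 'rV[R]_d) 0 i * b z.2 0 i).
  by rewrite mulr_sumr; apply: eq_bigr => i _; rewrite mulrDr; congr (_ + _); rewrite mulrACA.
by ring.
Qed.

Let D1 n : DP mu mu (fun z => (w n z.1 * (sqS z.1 + bx z.1)) * w n z.2).
Proof. exact: (DP_12 (IwM n Ie) (Iw n)). Qed.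

Let D2 n : DP mu mu (fun z => w n z.1 * (w n z.2 * (sqS z.2 + bx z.2))).
Proof. exact: (DP_12 (Iw n) (IwM n Ie)). Qed.

Let D3 n i k : DP mu mu (fun z => (w n z.1 * S z.1 i k) * (w n z.2 * S z.2 i k)).
Proof. exact: (DP_12 (IwM n (IS1 i k)) (IwM n (IS1 i k))). Qed.

Let D4 n i : DP mu mu (fun z => (w n z.1 * b z.1 0 i) * (w n z.2 * (z.2 : 'rV[R]_d) 0 i)).
Proof. exact: (DP_12 (IwM n (Ib i)) (Iwx n i)). Qed.

Let D5 n i : DP mu mu (fun z => (w n z.1 * (z.1 : 'rV[R]_d) 0 i) * (w n z.2 * b z.2 0 i)).
Proof. exact: (DP_12 (Iwx n i) (IwM n (Ib i))). Qed.

Let int12 (f g : Rd R d -> R) : L1 mu f -> L1 mu g ->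
  \int[(mu \x mu)%E]_z (f z.1 * g z.2) = \int[mu]_x f x * \int[mu]_x g x.
Proof.
move=> If Ig; rewrite (DP_fub1 (DP_12 If Ig)).2 /=.
under eq_Rintegral do rewrite (intZ _ Ig) mulrC.
by rewrite (intZ _ If) mulrC.
Qed.

Let DJ n : DP mu mu (J n).
Proof.
rewrite (funext (JE n)).
apply: DPD; last first.
  by apply: DPZ; apply: DP_sum => i; apply: DPD; [exact: D4|exact: D5].
apply: DPD; last by apply: DPZ; apply: DP_sum => i; apply: DP_sum => k; exact: D3.
by apply: DPD; [exact: D1|exact: D2].
Qed.

(** Since [b] has mean zero, the mean of [w b] is [- harmonic n] times this quantity; the factor
    [harmonic n] offsets the bound [1 / harmonic n] on the mean of [w x]. *)
Let rest n i := \int[mu]_x ((harmonic n)^-1 * (1 - w n x) * b x 0 i).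

Let Irest n i : L1 mu (fun x => (harmonic n)^-1 * (1 - w n x) * b x 0 i).
Proof.
apply: L1_bM => //.
  by apply: measurable_funM => //; apply: measurable_funB.
by apply: bndZ; apply: bndD; [exact: bnd_cst|apply: bndN].
Qed.

(** After expansion every term is a product of two means. The term in [S] is minus a sum of squares
    and is dropped, the energy terms are multiplied by the mean of [w], which is at most 1, and each
    cross term is at most [|rest|]. *)
Let J_le n : \int[(mu \x mu)%E]_z J n z <=
  2 * `|\int[mu]_x (w n x * (sqS x + bx x))| + 2 * \sum_i `|rest n i|.
Proof.
have E : \int[(mu \x mu)%E]_z J n z =
  \int[mu]_x (w n x * (sqS x + bx x)) * \int[mu]_x w n x
  + \int[mu]_x w n x * \int[mu]_x (w n x * (sqS x + bx x))
  + (-2) * (\sum_i \sum_k \int[mu]_x (w n x * S x i k) * \int[mu]_x (w n x * S x i k))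
  + (-1) * \sum_i (\int[mu]_x (w n x * b x 0 i) * \int[mu]_x (w n x * (x : 'rV[R]_d) 0 i)
     + \int[mu]_x (w n x * (x : 'rV[R]_d) 0 i) * \int[mu]_x (w n x * b x 0 i)).
  under eq_Rintegral do rewrite JE.
  have L3 : L1 (mu \x mu)%E (fun z => \sum_i \sum_k (w n z.1 * S z.1 i k) * (w n z.2 * S z.2 i k)).
    by apply: L1_sum => i; apply: L1_sum => k; exact: DP_L1 (D3 n i k).
  have L4 i := DP_L1 (D4 n i); have L5 i := DP_L1 (D5 n i).
  have L45 i := L1D (L4 i) (L5 i).
  rewrite intD; [|apply: L1D; [apply: L1D; apply: DP_L1; [exact: D1|exact: D2]|exact: L1Z]
    |by apply: L1Z; exact: L1_sum].
  rewrite intD; [|by apply: L1D; apply: DP_L1; [exact: D1|exact: D2]|exact: L1Z].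
  rewrite intD; [|exact: DP_L1 (D1 n)|exact: DP_L1 (D2 n)].
  rewrite (intZ _ L3) intZ; last exact: L1_sum.
  rewrite (int12 (IwM n Ie) (Iw n)) (int12 (Iw n) (IwM n Ie)).
  congr (_ + _ * _ + _ * _).
    rewrite int_sum => [|i]; last by apply: L1_sum => k; exact: DP_L1 (D3 n i k).
    apply: eq_bigr => i _; rewrite int_sum => [|k]; last exact: DP_L1 (D3 n i k).
    by apply: eq_bigr => k _; rewrite (int12 (IwM n (IS1 i k)) (IwM n (IS1 i k))).
  rewrite int_sum//; apply: eq_bigr => i _; rewrite (intD (L4 i) (L5 i)).
  by rewrite (int12 (IwM n (Ib i)) (Iwx n i)) (int12 (Iwx n i) (IwM n (Ib i))).
rewrite E; set e := \int[mu]_x (w n x * (sqS x + bx x)); set m := \int[mu]_x w n x.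
have m0 : 0 <= m by apply: int_ge0.
have m1 : m <= 1.
  rewrite -(int_cst mu 1); apply: int_le => //.
  exact: finite_measure_integrable_cst.
have h1 : e * m <= `|e|.
  by rewrite (le_trans (ler_norm _))// normrM (ger0_norm m0) ler_piMr.
have h2 : 0 <= \sum_i \sum_k \int[mu]_x (w n x * S x i k) * \int[mu]_x (w n x * S x i k).
  by apply: sumr_ge0 => i _; apply: sumr_ge0 => k _; rewrite -expr2 sqr_ge0.
suff h3 : - (\sum_i (\int[mu]_x (w n x * b x 0 i) * \int[mu]_x (w n x * (x : 'rV[R]_d) 0 i)
     + \int[mu]_x (w n x * (x : 'rV[R]_d) 0 i) * \int[mu]_x (w n x * b x 0 i))) <=
     2 * \sum_i `|rest n i|.
  by rewrite (mulrC m e); lra.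
rewrite -sumrN mulr_sumr; apply: ler_sum => i _.
suff h : `|\int[mu]_x (w n x * b x 0 i) * \int[mu]_x (w n x * (x : 'rV[R]_d) 0 i)| <= `|rest n i|.
  by rewrite [X in - (_ + X)]mulrC; move: h; rewrite -normrN; set u := - _;
    have := ler_norm u; rewrite /u; lra.
rewrite normrM.
have -> : \int[mu]_x (w n x * b x 0 i) = - (harmonic n * rest n i).
  rewrite /rest -(intZ _ (Irest n i)) -sub0r -(drift0 i) -intB//; last first.
    by apply: L1Z.
  apply: eq_Rintegral => x _; rewrite mulrA mulrA divff ?gt_eqF// mul1r.
  by rewrite mulrBl mul1r opprB addrC subrK.
rewrite normrN normrM (gtr0_norm (harm_gt0 n)) mulrAC -[leRHS]mul1r ler_wpM2r//.
rewrite mulrC -ler_pdivlMr// mul1r.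
rewrite -(int_cst mu (harmonic n)^-1); apply: int_norm_le => //.
exact: finite_measure_integrable_cst.
Qed.

Let w_cvg x : w n x @[n --> \oo] --> (1 : R).
Proof.
rewrite -(k0_0 R d).
by apply: cvg_contract; apply: Binf_continuous; exact: Binf_k0.
Qed.

Let energy_cvg : \int[mu]_x (w n x * (sqS x + bx x)) @[n --> \oo] --> (0 : R).
Proof.
rewrite -energy0.
have [||||_ //] := @int_cvg _ (Rd R d) R mu (fun n x => w n x * (sqS x + bx x))
  (fun x => sqS x + bx x) (fun x => `|sqS x + bx x|).
- by move=> n; apply: measurable_funM => //; exact: L1_meas Ie.
- by move=> n x; rewrite normrM (ger0_norm (w0 n x)) ler_piMl.
- exact: L1_norm.
- move=> x; rewrite -[X in _ --> X]mul1r.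
  by apply: cvgM; [exact: w_cvg|exact: cvg_cst].
Qed.

(** The Lipschitz bound for [k0] gives the majorant [L |b| |x|]; pointwise convergence uses that the
    gradient of [k0] vanishes at 0, so that [1 - w] is of order [harmonic n ^ 2]. *)
Let rest_cvg i : rest n i @[n --> \oo] --> (0 : R).
Proof.
have [C C0 hC] := qremP (@qrem_k0 R d).
have [L L0 hL] := qrem_lip (Binf_bnd (@Binf_k0 R d))
  (fun i => Binf_bnd (Binf_pder i (@Binf_k0 R d))) (Binf_qrem (@Binf_k0 R d)).
have wL n x : `|1 - w n x| <= harmonic n * (L * `|x|).
  rewrite /w -(k0_0 R d) distrC (le_trans (hL _ _))// normrZ (gtr0_norm (harm_gt0 n)).
  by rewrite mulrCA.
have wC n x : `|1 - w n x| <= harmonic n ^+ 2 * (C * `|x| ^+ 2).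
  have := hC 0 (harmonic n *: x); rewrite k0_0 -/(w n x) /lin big1 => [|j _]; last first.
    by rewrite yk_0 mul0r oppr0 mulr0.
  by rewrite subr0 distrC normrZ (gtr0_norm (harm_gt0 n)) exprMn mulrCA.
have [||||_] := @int_cvg _ (Rd R d) R mu (fun n x => (harmonic n)^-1 * (1 - w n x) * b x 0 i)
  (fun x => 0) (fun x => L * (`|b x 0 i| * `|x : 'rV[R]_d|)).
- by move=> n; exact: L1_meas (Irest n i).
- move=> n x; rewrite normrM mulrCA mulrC ler_wpM2l// normrM ger0_norm ?invr_ge0 ?(ltW (harm_gt0 n))//.
  by rewrite ler_pdivrMl.
- by apply: L1Z.
- move=> x; rewrite -[X in _ --> X](mul0r (b x 0 i)); apply: cvgM; last exact: cvg_cst.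
  apply/cvgr0Pnorm_le => e e0; near=> n.
  rewrite normrM ger0_norm ?invr_ge0 ?(ltW (harm_gt0 n))// ler_pdivrMl// (le_trans (wC n x))//.
  rewrite expr2 -mulrA ler_wpM2l ?(ltW (harm_gt0 n))//.
  near: n; apply: (cvgr_le 0) e0; rewrite -(mul0r (C * `|x| ^+ 2)).
  by apply: cvgM; [exact: cvg_harmonic|exact: cvg_cst].
by rewrite Rintegral_cst// mul0r.
Unshelve. all: by end_near.
Qed.

Hypothesis qpos : forall x y, x != y -> 0 < qfun S b x y.

Let qdiag x : qfun S b x x = 0.
Proof.
rewrite qfunE big1 ?add0r => [|i _]; last by rewrite big1// => k _; rewrite subrr expr0n.
by rewrite big1// => i _; rewrite subrr mul0r.
Qed.

Let q0 x y : 0 <= qfun S b x y.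
Proof. by have [->|/qpos/ltW//] := eqVneq x y; rewrite qdiag. Qed.

Let J0 n z : 0 <= J n z. Proof. by rewrite !mulr_ge0. Qed.

Let w_mono n x : w 0 x <= w n x.
Proof.
rewrite /w !add0r /k0 lef_pV2 ?posrE ?kden_gt0// /kden lerD2l ler_pM2r ?invr_gt0//.
apply: ler_sum => i _; rewrite !mxE -!expr2 !exprMn ler_wpM2r ?sqr_ge0//.
rewrite lerXn2r ?nnegrE ?(ltW (harm_gt0 _))//.
by rewrite /harmonic/= invr1 invf_le1 ?ler1n.
Qed.

(** As [q >= 0] and the weights satisfy [w 0 <= w n], the integral of [J 0] is at most that of
    [J n], whose upper bound tends to 0. *)
Let J_null : \int[(mu \x mu)%E]_z J 0 z = 0.
Proof.
apply/eqP; rewrite eq_le int_ge0// andbT.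
have cv : 2 * `|\int[mu]_x (w n x * (sqS x + bx x))| + 2 * \sum_i `|rest n i|
    @[n --> \oo] --> 2 * `|0 : R| + 2 * \sum_(i < d) `|0 : R|.
  apply: cvgD; (apply: cvgM; first exact: cvg_cst); first exact: cvg_norm energy_cvg.
  by apply: cvg_sumR => i; apply: cvg_norm; exact: rest_cvg.
have -> : 0 = 2 * `|0 : R| + 2 * \sum_(i < d) `|0 : R|.
  by rewrite big1 => [|i _]; rewrite normr0 ?mulr0 ?addr0.
apply: (seq_cvg_ge _ cv) => n; apply: le_trans (J_le n).
apply: int_le; [exact: DP_L1 (DJ 0)|exact: DP_L1 (DJ n)|move=> z].
by rewrite /J ler_wpM2r// ler_pM.
Qed.

(** Some section of [J 0] has integral zero, for otherwise the whole space would be null. Positivity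
    off the diagonal then puts all mass at that [p]; the zero mean of [b] gives [b p = 0], and the
    energy identity leaves only squares of entries of [S p]. *)
Lemma positive_form_point : exists p : 'rV[R]_d,
  [/\ mu (~` [set p] : set (Rd R d)) = 0%E, b p = 0 & S p = 0].
Proof.
have [IJ EJ] := DP_fub1 (DJ 0).
have [p gp] : exists p : Rd R d, \int[mu]_y J 0 (p, y) = 0.
  apply: contrapT => H.
  have := int0_null IJ (fun x => int_ge0 mu (fun y => J0 0 (x, y))).
  rewrite -EJ J_null => /(_ erefl).
  rewrite (_ : [set e | _] = setT) => [|].
    by move=> m0; have := probability_setT mu; rewrite m0 => /eqP; rewrite eq_sym onee_eq0.
  by apply/seteqP; split => // x _ /=; apply/eqP => h; apply: H; exists x.
have mup : mu (~` [set p] : set (Rd R d)) = 0%E.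
  rewrite -(int0_null (DP_fst p (DJ 0)) (fun y => J0 0 (p, y)) gp); congr (mu _).
  apply/seteqP; split => y /=; last first.
    by move=> /eqP h yp; apply: h; rewrite yp /J qdiag mulr0.
  move=> /eqP; rewrite eq_sym => /qpos qp.
  by rewrite /J /= gt_eqF// !mulr_gt0// k0_gt0.
have bp : b p = 0.
  by apply/rowP => i; rewrite mxE -(drift0 i) (int_concentrated mup (Ib i)).
exists p; split => //.
have := energy0; rewrite (int_concentrated mup Ie) /sqS /bx bp.
rewrite [X in _ + X]big1 ?addr0 => [|i _]; last by rewrite mxE mul0r.
have S0 i : 0 <= \sum_k S p i k ^+ 2 by apply: sumr_ge0 => k _; exact: sqr_ge0.
move=> /(psumr_eq0P (fun i _ => S0 i)) h; apply/matrixP => i k; rewrite mxE.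
have /(psumr_eq0P (fun k _ => sqr_ge0 _)) := h i isT.
by move=> /(_ k isT)/eqP; rewrite sqrf_eq0 => /eqP.
Qed.

End positive_form.

(** * Regularity and Lusin's theorem *)

Section closed_approximation.
Variables (R : realType) (d : nat) (mu : probability (Rd R d) R).
Implicit Types (B F D : set 'rV[R]_d) (G : nat -> set 'rV[R]_d).

Let meas (B : set 'rV[R]_d) : Prop := measurable (B : set (Rd R d)).

Lemma small_tail G (eta : R) : (forall n, meas (G n)) ->
  (forall n, G n.+1 `<=` G n) -> \bigcap_n G n = set0 -> 0 < eta ->
  exists n, (mu (G n) <= eta%:E)%E.
Proof.
move=> mG dG G0 eta0.
have homoG : {homo G : n m / (n <= m)%N >-> (m <= n)%O}.
  by apply: homo_leq => [A|A B C AB BC|n]; [exact: lexx|exact: le_trans BC AB|apply/subsetPset].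
have cv : (mu \o (G : nat -> set (Rd R d))) x @[x --> \oo] --> mu (set0 : set (Rd R d)).
  rewrite -G0; apply: nonincreasing_cvg_mu => //.
  - by rewrite (le_lt_trans (probability_le1 mu (mG 0%N))) ?ltry.
  - by rewrite G0; exact: measurable0.
move: cv; rewrite measure0 => /fine_cvgP[_ /cvgrPdist_le /(_ _ eta0)[n _ /(_ n (leqnn n))]].
rewrite /= sub0r normrN ger0_norm ?fine_ge0// => h; exists n.
by rewrite -(fineK (fin_num_measure mu (G n) (mG n))) lee_fin.
Qed.

Lemma small_union G (eta : R) : 0 <= eta -> (forall n, meas (G n)) ->
  (forall n, (mu (G n) <= (eta / (2 ^ n.+1)%:R)%:E)%E) ->
  (mu (\bigcup_n G n : set (Rd R d)) <= eta%:E)%E.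
Proof.
move=> eta0 mG hG.
apply: (le_trans (measure_sigma_subadditive (A := \bigcup_n G n) (F := G) mu mG _ _)) => //.
  exact: bigcupT_measurable.
apply: le_trans (@epsilon_trick0 R eta xpredT eta0).
by apply: lee_nneseries => n *; [exact: measure_ge0|exact: hG].
Qed.

(** Inner closed approximation of a set and of its complement at once: the condition is symmetric,
    so stability under complements is immediate. *)
Definition closed_split B := forall eta : R, 0 < eta -> exists F D,
  [/\ closed F /\ closed D, F `<=` B, D `<=` ~` B & (mu (~` (F `|` D) : set (Rd R d)) <= eta%:E)%E].

Lemma closed_splitC B : closed_split B -> closed_split (~` B).
Proof.
move=> sB eta /sB[F [D [[cF cD] FB DB h]]]; exists D, F.
by split => //; [rewrite setCK|rewrite setUC].
Qed.

Lemma closed_split_open O : open O -> closed_split O.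
Proof.
move=> oO eta eta0.
(* The points at distance at least [1 / (n + 1)] from the complement of [O]; these closed sets
   increase to [O]. *)
pose F n : set 'rV[R]_d := \bigcap_(y in ~` O) [set x | n.+1%:R^-1 <= `|y - x|].
have cF n : closed (F n).
  apply: closed_bigI => y _.
  rewrite (_ : [set x | _] = ~` ball y n.+1%:R^-1).
    by apply: open_closedC; apply: ball_open; rewrite invr_gt0.
  by rewrite -ball_normE; apply/seteqP; split => x /=; rewrite leNgt => /negP.
have cD : closed (~` O) by exact: open_closedC.
have FO n : F n `<=` O.
  move=> x Fx; apply: contrapT => nO; have := Fx x nO.
  by rewrite /= subrr normr0 leNgt invr_gt0 ltr0n.
have [||||n hn] := @small_tail (fun n => ~` (F n `|` ~` O)) eta.
- by move=> n; apply: measurableC; apply: Rd_closed; exact: closedU.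
- move=> n; apply: subsetC; apply: setSU => x Fx y nO.
  by rewrite /= (le_trans _ (Fx y nO))// lef_pV2 ?posrE// ler_nat.
- apply/seteqP; split => // x /= h.
  have Ox : O x by apply: contrapT => nO; have := h 0%N I; apply; right.
  have /nbhs_ballP[r /= r0 rO] : nbhs x O by exact: open_nbhs_nbhs.
  pose n := Num.truncn r^-1; have := h n I; apply; left => y nO /=.
  rewrite leNgt; apply/negP => xy; apply: nO; apply: rO.
  rewrite -ball_normE /= distrC (lt_le_trans xy)// -[leRHS]invrK lef_pV2 ?posrE ?invr_gt0//.
  exact: ltW (truncnS_gt _).
- by [].
by exists (F n), (~` O); split.
Qed.

Lemma closed_split_bigcup G : (forall n, closed_split (G n)) -> closed_split (\bigcup_n G n).
Proof.
move=> sG eta eta0.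
have e20 : 0 < eta / 2 by rewrite divr_gt0.
have /choice[FD hFD] : forall n, exists FD : set 'rV[R]_d * set 'rV[R]_d,
    [/\ closed FD.1 /\ closed FD.2, FD.1 `<=` G n, FD.2 `<=` ~` G n &
    (mu (~` (FD.1 `|` FD.2) : set (Rd R d)) <= (eta / 2 / (2 ^ n.+1)%:R)%:E)%E].
  move=> n; have [|F [D h]] := sG n (eta / 2 / (2 ^ n.+1)%:R).
    by rewrite divr_gt0// ltr0n expn_gt0.
  by exists (F, D).
pose F n := (FD n).1; pose D n := (FD n).2.
have cF n : closed (F n) by case: (hFD n) => -[].
have cD n : closed (D n) by case: (hFD n) => -[].
(* A countable union of closed sets need not be closed, so it is cut at a finite [N]. Half of [eta]
   pays for the cut, the other half for the points missed by some pair [F n], [D n]. *)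
pose U N := \bigcup_(n in `I_N) F n.
have cU N : closed (U N) by apply: closed_bigcup => //; exact: finite_II.
have [||||N hN] := @small_tail (fun N => \bigcup_n F n `\` U N) (eta / 2).
- move=> N; apply: measurableD; last exact: Rd_closed.
  by apply: bigcupT_measurable => n; exact: Rd_closed.
- move=> N; apply: setDS => x [n /= nN Fx]; exists n => //=.
  exact: leq_trans nN _.
- apply/seteqP; split => // x h; have [[n _ Fx] _] := h 0%N I.
  by have [_] := h n.+1 I; apply; exists n => /=.
- by [].
exists (U N), (\bigcap_n D n); split.
- by split => //; apply: closed_bigI => n _.
- by move=> x [n _ Fx]; exists n => //; case: (hFD n) => _ + _ _; apply.
- by move=> x Dx [n _ Gx]; case: (hFD n) => _ _ /(_ x) + _; apply => //; exact: Dx.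
have mW : (mu (\bigcup_n (~` (F n `|` D n)) : set (Rd R d)) <= (eta / 2)%:E)%E.
  apply: small_union; first exact: ltW.
    by move=> n; apply: measurableC; apply: Rd_closed; exact: closedU.
  by move=> n; case: (hFD n).
have mF : meas (\bigcup_n F n `\` U N).
  apply: measurableD; last exact: Rd_closed.
  by apply: bigcupT_measurable => n; exact: Rd_closed.
have mE : meas (\bigcup_n (~` (F n `|` D n))).
  by apply: bigcupT_measurable => n; apply: measurableC; apply: Rd_closed; exact: closedU.
rewrite [eta in leRHS]splitr EFinD; apply: le_trans (leeD hN mW).
apply: le_trans (measureU2 _ mF mE).
apply: le_measure; rewrite ?inE//.
- apply: measurableC; apply: Rd_closed; apply: closedU => //.
  by apply: closed_bigI => n _.
- exact: measurableU.
move=> x /not_orP[nU nD]; have [n nDn] : exists n, ~ D n x.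
  by apply: contrapT => h; apply: nD => n _; apply: contrapT => k; apply: h; exists n.
have [Fx|nF] := pselect ((\bigcup_n F n) x); first by left.
by right; exists n => // -[Fx|//]; apply: nF; exists n.
Qed.

Lemma borel_closed_split B : meas B -> closed_split B.
Proof.
apply: (@smallest_sub _ (sigma_algebra setT) open closed_split).
  split.
  - move=> eta eta0; exists set0, setT; split.
    + by split; [exact: closed0|exact: closedT].
    + by [].
    + by rewrite setC0.
    + by rewrite setUT setCT measure0 lee_fin ltW.
  - by move=> A sA; rewrite setTD; exact: closed_splitC.
  - by move=> A; exact: closed_split_bigcup.
exact: closed_split_open.
Qed.

(** On [K] each set [g i < q] with rational [q] coincides with a closed set whose complement in [K]
    is also the trace of a closed set, which makes the restrictions of all [g i] continuous. The
    thirds of [eta] pay for a closed subset of [B], for the points missed by some pair, and for the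
    outside of a large ball. *)
Lemma lusin_compact (J : countType) (g : J -> 'rV[R]_d -> R) B (eta : R) :
  (forall i, measurable_fun setT (g i : Rd R d -> R)) -> meas B -> 0 < eta ->
  exists K : set 'rV[R]_d, [/\ compact K, K `<=` B,
    (mu (B `\` K : set (Rd R d)) <= eta%:E)%E &
    forall i x, K x -> g i y @[y --> within K (nbhs x)] --> g i x].
Proof.
move=> mg mB eta0.
(* The number [n] encodes a pair of an index and a rational threshold; numbers that decode to no
   pair get the whole space. *)
pose A (n : nat) : set 'rV[R]_d :=
  if unpickle n is Some iq then [set x | g iq.1 x < ratr iq.2] else setT.
have mA n : meas (A n).
  rewrite /A; case: unpickle => [[i q]|]; last exact: measurableT.
  have -> : [set x | g i x < ratr q] = setT `&` g i @^-1` `]-oo, (ratr q)[.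
    by rewrite setTI; apply/seteqP; split => x /=; rewrite in_itv.
  exact: (mg i measurableT).
have e30 : 0 < eta / 3 by rewrite divr_gt0.
have /choice[FD hFD] : forall n, exists FD : set 'rV[R]_d * set 'rV[R]_d,
    [/\ closed FD.1 /\ closed FD.2, FD.1 `<=` A n, FD.2 `<=` ~` A n &
    (mu (~` (FD.1 `|` FD.2) : set (Rd R d)) <= (eta / 3 / (2 ^ n.+1)%:R)%:E)%E].
  move=> n; have [|F [D h]] := borel_closed_split (mA n) (eta := eta / 3 / (2 ^ n.+1)%:R).
    by rewrite divr_gt0// ltr0n expn_gt0.
  by exists (F, D).
pose F n := (FD n).1; pose D n := (FD n).2.
have cF n : closed (F n) by case: (hFD n) => -[].
have cD n : closed (D n) by case: (hFD n) => -[].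
have [C [C' [[cC cC'] CB C'B hC]]] := borel_closed_split mB e30.
have [||||N hN] := @small_tail (fun N => ~` [set x | `|x| <= N%:R]) (eta / 3).
- by move=> N; apply: measurableC; apply: Rd_closed; exact: closed_rV_ball.
- by move=> N; apply: subsetC => x /= /le_trans; apply; rewrite ler_nat.
- apply/seteqP; split => // x h; apply: (h (Num.truncn `|x|).+1 I).
  exact: ltW (truncnS_gt _).
- by [].
pose L := [set x : 'rV[R]_d | `|x| <= N%:R].
pose E := \bigcap_n (F n `|` D n).
have cE : closed E by apply: closed_bigI => n _; exact: closedU.
have cL : closed L by exact: closed_rV_ball.
have cK : closed (C `&` E `&` L) by do 2 apply: closedI => //.
have mW : (mu (\bigcup_n (~` (F n `|` D n)) : set (Rd R d)) <= (eta / 3)%:E)%E.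
  apply: small_union; first exact: ltW.
    by move=> n; apply: measurableC; apply: Rd_closed; exact: closedU.
  by move=> n; case: (hFD n).
have mC : meas (B `\` C) by apply: measurableD => //; exact: Rd_closed.
exists (C `&` E `&` L); split.
- apply: (@subclosed_compact _ _ L) => //; first exact: compact_rV_ball.
- by move=> x [[/CB]].
- have hBC : (mu (B `\` C : set (Rd R d)) <= (eta / 3)%:E)%E.
    apply: le_trans hC; apply: le_measure; rewrite ?inE//.
      by apply: measurableC; apply: Rd_closed; exact: closedU.
    by move=> x [Bx nC] [//|/C'B].
  have mE : meas (\bigcup_n (~` (F n `|` D n))).
    by apply: bigcupT_measurable => n; apply: measurableC; apply: Rd_closed; exact: closedU.
  have mL : meas (~` L) by apply: measurableC; exact: Rd_closed.
  have -> : eta%:E = ((eta / 3)%:E + (eta / 3)%:E + (eta / 3)%:E)%E.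
    by rewrite -!EFinD; congr EFin; field.
  apply: le_trans (leeD (leeD hBC mW) hN).
  apply: le_trans (leeD (measureU2 _ mC mE) (le_refl _)).
  have mCE : meas ((B `\` C) `|` \bigcup_n (~` (F n `|` D n))) by exact: measurableU.
  apply: le_trans (measureU2 _ mCE mL).
  apply: le_measure; rewrite ?inE//.
  + by apply: measurableD => //; exact: Rd_closed.
  + by apply: measurableU => //; exact: measurableU.
  move=> x [Bx nK]; have [Cx|nC] := pselect (C x); last by left; left.
  have [Lx|nL] := pselect (L x); last by right.
  left; right; apply: contrapT => h; apply: nK; split => //; split => // n _.
  by apply: contrapT => k; apply: h; exists n.
move=> i x [[_ Ex] _]; apply/cvgrPdist_lt => e e0.
have /rat_in_itvoo[q1] : g i x - e < g i x by rewrite gtrBl.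
have /rat_in_itvoo[q2] : g i x < g i x + e by rewrite ltrDl.
rewrite !inE /= => /itvP q2x /itvP q1x.
(* Near [x] the closed sets [D n2] and [F n1], which miss [x], are avoided; a point of [K] there
   must lie in [F n2] and [D n1], so its value is between [q1] and [q2]. *)
pose n1 := pickle (i, q1); pose n2 := pickle (i, q2).
have AE q : A (pickle (i, q)) = [set x | g i x < ratr q] by rewrite /A pickleK.
have FA n : F n `<=` A n by case: (hFD n).
have DA n : D n `<=` ~` A n by case: (hFD n).
have nDx : ~ D n2 x by move=> /DA; rewrite AE /= q2x.
have nFx : ~ F n1 x by move=> /FA; rewrite AE /= ltNge q1x.
have : nbhs x (~` D n2 `&` ~` F n1).
  by apply: filterI; apply: open_nbhs_nbhs; split => //; exact: closed_openC.
apply: filterS => y [nDy nFy] [[_ Ey] _].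
have : A n2 y by apply: FA; case: (Ey n2 I).
have : ~ A n1 y by apply: DA; case: (Ey n1 I).
rewrite /n1 /n2 !AE /= => /negP; rewrite -leNgt => h1 h2.
rewrite ltr_distl; apply/andP; split.
  by rewrite ltrBlDr (lt_trans h2)// q2x.
by rewrite -ltrBlDr (lt_le_trans _ h1)// q1x.
Qed.

End closed_approximation.

(** * The case q < 0 *)

Lemma sqrB_le (R : realType) (u v : R) : (u - v) ^+ 2 <= 2 * u ^+ 2 + 2 * v ^+ 2.
Proof. by have := sqr_ge0 (u + v); nra. Qed.

Lemma error_split (R : realType) (p p' A s s' t k w w' v v' D : R) :
  0 <= k -> A <= w + w' -> D * A <= k * A -> t <= k * (v + v') ->
  p' * A + s' - (p * A + s) = D * A + t ->
  - (p * A + s) <= - (p' * A + s') + k * (w + v + (w' + v')).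
Proof. by move=> k0 /(ler_wpM2l k0); lra. Qed.

Lemma marginal1_le dT1 dT2 (T1 : measurableType dT1) (T2 : measurableType dT2)
    (R : realType) (M1 : probability T1 R) (M2 : probability T2 R)
    (P : T1 * T2 -> R) (g : T1 -> R) :
  measurable_fun setT P -> bnd P -> (forall x, \int[M2]_y P (x, y) <= 1) ->
  L1 M1 g -> (forall x, 0 <= g x) ->
  DP M1 M2 (fun z => P z * g z.1) /\ \int[(M1 \x M2)%E]_z (P z * g z.1) <= \int[M1]_x g x.
Proof.
move=> mP bP P1 Ig g0.
have D : DP M1 M2 (fun z => P z * g z.1) by apply: DP_bM => //; exact: (DP_1 M2 Ig).
split => //; have [I E] := DP_fub1 D; rewrite E; apply: int_le => // x /=.
have IP : L1 M2 (fun y => P (x, y)) by exact: (DP_fst x (DP_bnd M1 M2 mP bP)).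
under eq_Rintegral do rewrite mulrC.
by rewrite (intZ _ IP) ler_piMr.
Qed.

Lemma marginal2_le dT1 dT2 (T1 : measurableType dT1) (T2 : measurableType dT2)
    (R : realType) (M1 : probability T1 R) (M2 : probability T2 R)
    (P : T1 * T2 -> R) (g : T2 -> R) :
  measurable_fun setT P -> bnd P -> (forall y, \int[M1]_x P (x, y) <= 1) ->
  L1 M2 g -> (forall x, 0 <= g x) ->
  DP M1 M2 (fun z => P z * g z.2) /\ \int[(M1 \x M2)%E]_z (P z * g z.2) <= \int[M2]_y g y.
Proof.
move=> mP bP P1 Ig g0.
have D : DP M1 M2 (fun z => P z * g z.2) by apply: DP_bM => //; exact: (DP_2 M1 Ig).
split => //; have [I E] := DP_fub2 D; rewrite E; apply: int_le => // y /=.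
have IP : L1 M1 (fun x => P (x, y)) by exact: (DP_snd y (DP_bnd M1 M2 mP bP)).
under eq_Rintegral do rewrite mulrC.
by rewrite (intZ _ IP) ler_piMr.
Qed.

Section negative_form.
Variables (R : realType) (d d1 : nat) (mu1 mu2 : probability (Rd R d) R).
Variables (S : 'rV[R]_d -> 'M[R]_(d, d1)) (b : 'rV[R]_d -> 'rV[R]_d).
Hypothesis mS : forall i k, measurable_fun setT (fun x : Rd R d => S x i k).
Hypothesis mb : forall i, measurable_fun setT (fun x : Rd R d => b x 0 i).
Hypothesis IS1 : forall i k, L1 mu1 (fun x => S x i k ^+ 2).
Hypothesis IS2 : forall i k, L1 mu2 (fun x => S x i k ^+ 2).
Hypothesis Ib1 : forall i, L1 mu1 (fun x => b x 0 i).
Hypothesis Ib2 : forall i, L1 mu2 (fun x => b x 0 i).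
Hypothesis eqB1 : forall f : 'rV[R]_d -> R, Binf f -> \int[mu1]_x gen (S x) (b x) f x = 0.
Hypothesis eqB2 : forall f : 'rV[R]_d -> R, Binf f -> \int[mu2]_x gen (S x) (b x) f x = 0.

Context dT (T : measurableType dT) (PT : probability T R).
Variables (Z : T -> 'rV[R]_d) (sc : 'I_d -> T -> R).
Hypothesis Hs : smoother PT Z sc d.

Let M1 : probability _ R := (mu1 \x PT)%E.
Let M2 : probability _ R := (mu2 \x PT)%E.
Let E := (Rd R d * T)%type.

Definition dissip (x y : 'rV[R]_d) : R := - (k0 (x - y) * qfun S b x y).

Let fst1 (mu : probability (Rd R d) R) (g : Rd R d -> R) : L1 mu g ->
  L1 (mu \x PT)%E (fun e => g e.1) /\ \int[(mu \x PT)%E]_e g e.1 = \int[mu]_x g x.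
Proof.
move=> Ig; have D := DP_1 PT Ig; split; first exact: DP_L1.
by rewrite (DP_fub1 D).2; apply: eq_Rintegral => x _ /=; rewrite int_cst.
Qed.

(** A weight with [W x + W y] above both [|S x - S y|^2] and the sum of the [|b_i x - b_i y|]; the
    factor 2 comes from [sqrB_le]. *)
Let W (x : 'rV[R]_d) : R := \sum_i \sum_k 2 * S x i k ^+ 2 + \sum_i `|b x 0 i|.

Let W0 x : 0 <= W x.
Proof.
rewrite addr_ge0//; last exact: sumr_ge0.
by apply: sumr_ge0 => i _; apply: sumr_ge0 => k _; rewrite mulr_ge0 ?sqr_ge0.
Qed.

Let IW1 : L1 mu1 W.
Proof.
apply: L1D; last by apply: L1_sum => i; exact: L1_norm.
by apply: L1_sum => i; apply: L1_sum => k; apply: L1Z.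
Qed.

Let IW2 : L1 mu2 W.
Proof.
apply: L1D; last by apply: L1_sum => i; exact: L1_norm.
by apply: L1_sum => i; apply: L1_sum => k; apply: L1Z.
Qed.

Let dissip_expand x y : dissip x y = - (k0 (x - y) * \sum_i \sum_k (S x i k - S y i k) ^+ 2
  + \sum_i (b x 0 i - b y 0 i) * yk i (x - y)).
Proof.
rewrite /dissip qfunE mulrDr; congr (- (_ + _)); rewrite mulr_sumr.
by apply: eq_bigr => i _; rewrite /yk mulrCA [in RHS](mulrC _ (k0 _)).
Qed.

Let mdif : cmeas (fun z : E * E => (z.1.1 : 'rV[R]_d) - z.2.1).
Proof.
move=> i; rewrite (_ : (fun _ => _) =
    fun z => (z.1.1 : 'rV[R]_d) 0 i - (z.2.1 : 'rV[R]_d) 0 i); last first.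
  by apply/funext => z; rewrite !mxE.
have m1 : measurable_fun setT (fun e : E => (e.1 : 'rV[R]_d) 0 i).
  by apply: (measurableT_comp (@Rd_cmeas R d i)); exact: measurable_fst.
by apply: measurable_funB; apply: (measurableT_comp m1);
  [exact: measurable_fst|exact: measurable_snd].
Qed.

Let DPdissip : DP M1 M2 (fun z => dissip z.1.1 z.2.1).
Proof.
rewrite (funext (fun z : E * E => dissip_expand z.1.1 z.2.1)).
have SL1 (mu : probability (Rd R d) R) (IS : forall i k, L1 mu (fun x : Rd R d => S x i k ^+ 2)) i k :
  L1 mu (fun x : Rd R d => S x i k) by exact: L1_sqr_bound.
apply: DPN; apply: DPD.
  have [mk bk] := smo_cmp mdif (@Binf_k0 R d).
  apply: DP_bM => //; apply: DP_sum => i; apply: DP_sum => k.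
  rewrite (_ : (fun z : E * E => _) = fun z => S z.1.1 i k ^+ 2 + S z.2.1 i k ^+ 2
     + (-2) * (S z.1.1 i k * S z.2.1 i k)); last by apply/funext => z; ring.
  apply: DPD; first apply: DPD.
  - exact: (DP_1 M2 (fst1 (IS1 i k)).1).
  - exact: (DP_2 M1 (fst1 (IS2 i k)).1).
  - apply: DPZ; exact: (DP_12 (fst1 (SL1 _ IS1 i k)).1 (fst1 (SL1 _ IS2 i k)).1).
apply: DP_sum => i; have [mk bk] := smo_cmp mdif (@Binf_yk R d i).
apply: DP_Mb => //; apply: DPD; first exact: (DP_1 M2 (fst1 (Ib1 i)).1).
by apply: DPN; exact: (DP_2 M1 (fst1 (Ib2 i)).1).
Qed.

(** Undoing the displacement changes [k0] and [yk] by at most a constant times [del], by their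
    Lipschitz bounds, and these changes are multiplied by coefficients controlled by [W]. As the
    marginals of [P] are dominated, the error is at most [del] times a constant independent of
    [P]. *)
Lemma near_coupling_dissip (eps : R) : 0 < eps -> exists P : E * E -> R,
  [/\ measurable_fun setT P /\ bnd P, forall z, 0 <= P z,
      (forall x, \int[M2]_y P (x, y) <= 1) /\ (forall y, \int[M1]_x P (x, y) <= 1),
      1 - eps <= \int[(M1 \x M2)%E]_z P z &
      DP M1 M2 (fun z => P z * dissip z.1.1 z.2.1) /\
      \int[(M1 \x M2)%E]_z (P z * dissip z.1.1 z.2.1) <= 2 * eps].
Proof.
move=> eps0.
have lip (f : 'rV[R]_d -> R) : Binf f -> exists2 L : R, 0 <= L & forall x h, `|f (x + h) - f x| <= L * `|h|.
  move=> Bf; apply: (@qrem_lip _ _ f (fun i => pder i f)); first exact: Binf_bnd.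
    by move=> i; apply: Binf_bnd; exact: Binf_pder.
  exact: Binf_qrem.
have [L [L0 hk hy]] : exists L : R, [/\ 0 <= L,
    forall x h : 'rV[R]_d, `|k0 (x + h) - k0 x| <= L * `|h| &
    forall i (x h : 'rV[R]_d), `|yk i (x + h) - yk i x| <= L * `|h|].
  have [L1 L10 h1] := lip _ (@Binf_k0 R d).
  have /choice[l hl] : forall i, exists l : R, 0 <= l /\
      forall x h : 'rV[R]_d, `|yk i (x + h) - yk i x| <= l * `|h|.
    by move=> i; have [l l0 h] := lip _ (@Binf_yk R d i); exists l.
  have sl0 : 0 <= \sum_i l i by apply: sumr_ge0 => i _; case: (hl i).
  exists (L1 + \sum_i l i); split; first exact: addr_ge0.
    by move=> x h; rewrite (le_trans (h1 x h))// ler_wpM2r// lerDl.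
  move=> i x h; have [_ /(_ x h) hi] := hl i; rewrite (le_trans hi)// ler_wpM2r//.
  rewrite (bigD1 i)//= addrCA lerDl addr_ge0//.
  by apply: sumr_ge0 => j _; case: (hl j).
pose C := \int[mu1]_x W x + \int[mu2]_x W x.
have C0 : 0 <= C by rewrite addr_ge0// int_ge0.
(* Not the regularization parameter: a Lipschitz constant times [2 d], the maximal distance of two
   values of [Z]. *)
pose kap := L * (2 * d%:R).
have kap0 : 0 <= kap by rewrite !mulr_ge0.
pose del := eps / (kap * C + 1).
have den0 : 0 < kap * C + 1 by rewrite ltr_wpDl// mulr_ge0.
have del0 : 0 < del by rewrite divr_gt0.
have hdel : del * (kap * C) <= eps.
  by rewrite /del mulrAC ler_pdivrMr// ler_wpM2l ?(ltW eps0)// lerDl.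
have H1 := lifted_smooth mS IS1 Ib1 eqB1 Hs del0.
have H2 := lifted_smooth mS IS2 Ib2 eqB2 Hs del0.
have [P [[mP bP] P0 [P1 P2] Pm [DQ hQ]]] := near_coupling H1 H2 eps0.
exists P; split => //.
have DD : DP M1 M2 (fun z => P z * dissip z.1.1 z.2.1) by exact: DP_bM.
split => //.
set q := (X in _ <= \int[_]_z (P z * X z)) in hQ.
have comp0 z : dissip z.1.1 z.2.1 <= - q z + kap * del * (W z.1.1 + W z.2.1).
  pose u := (z.1.1 : 'rV[R]_d) - z.2.1; pose h := del *: (Z z.1.2 - Z z.2.2).
  have Eu : sm_pt Z del z.1 - sm_pt Z del z.2 = u + h.
    by rewrite /sm_pt /u /h scalerBr opprD addrACA.
  have hh : L * `|h| <= kap * del.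
    rewrite /kap -mulrA ler_wpM2l// normrZ gtr0_norm// [leRHS]mulrC ler_wpM2l ?(ltW del0)//.
    rewrite (le_trans (ler_normB _ _))//.
    by have := smo_le Hs z.1.2; have := smo_le Hs z.2.2; lra.
  have kd0 : 0 <= kap * del by rewrite mulr_ge0// ltW.
  have -> : q z = k0 (u + h) * \sum_i \sum_k (S z.1.1 i k - S z.2.1 i k) ^+ 2
      + \sum_i (b z.1.1 0 i - b z.2.1 0 i) * yk i (u + h).
    rewrite /q Eu /qhat Eu mulrDr exchange_big/=; congr (_ + _); rewrite mulr_sumr.
    by apply: eq_bigr => i _; rewrite /yk mulrCA [in RHS](mulrC _ (k0 _)).
  rewrite dissip_expand -/u.
  set A := \sum_i \sum_k _.
  have A0 : 0 <= A by apply: sumr_ge0 => i _; apply: sumr_ge0 => k _; exact: sqr_ge0.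
  have E1 : k0 (u + h) * A + \sum_i (b z.1.1 0 i - b z.2.1 0 i) * yk i (u + h)
    - (k0 u * A + \sum_i (b z.1.1 0 i - b z.2.1 0 i) * yk i u) =
    (k0 (u + h) - k0 u) * A + \sum_i (b z.1.1 0 i - b z.2.1 0 i) * (yk i (u + h) - yk i u).
    rewrite opprD addrACA mulrBl; congr (_ + _); rewrite -sumrB; apply: eq_bigr => i _.
    by rewrite mulrBr.
  have hA : A <= \sum_i \sum_k 2 * S z.1.1 i k ^+ 2 + \sum_i \sum_k 2 * S z.2.1 i k ^+ 2.
    rewrite -big_split/=; apply: ler_sum => i _; rewrite -big_split/=; apply: ler_sum => k _.
    exact: sqrB_le.
  have hB : \sum_i (b z.1.1 0 i - b z.2.1 0 i) * (yk i (u + h) - yk i u) <=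
      kap * del * (\sum_i `|b z.1.1 0 i| + \sum_i `|b z.2.1 0 i|).
    rewrite -big_split/= mulr_sumr; apply: ler_sum => i _.
    rewrite (le_trans (ler_norm _))// normrM mulrC ler_pM//.
      exact: le_trans (hy i u h) hh.
    exact: ler_normB.
  have hA' : (k0 (u + h) - k0 u) * A <= kap * del * A.
    by rewrite ler_wpM2r// (le_trans (ler_norm _))// (le_trans (hk u h)).
  exact: (error_split kd0 hA hA' hB E1).
have comp z : P z * dissip z.1.1 z.2.1 <=
    - (P z * q z) + kap * del * (P z * W z.1.1 + P z * W z.2.1).
  apply: le_trans (ler_wpM2l (P0 z) (comp0 z)) _; rewrite le_eqVlt; apply/orP; left.
  by apply/eqP; move: (P z) (q z) (W z.1.1) (W z.2.1) => p' q' w w'; ring.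
have [DW1 hW1] := marginal1_le mP bP P1 (fst1 IW1).1 (fun e => W0 e.1).
have [DW2 hW2] := marginal2_le mP bP P2 (fst1 IW2).1 (fun e => W0 e.1).
rewrite (fst1 IW1).2 in hW1; rewrite (fst1 IW2).2 in hW2.
have DWW := DPD DW1 DW2.
apply: (le_trans (int_le (DP_L1 DD) (L1D (L1N (DP_L1 DQ)) (L1Z (kap * del) (DP_L1 DWW))) comp)).
rewrite (intD (L1N (DP_L1 DQ)) (L1Z (kap * del) (DP_L1 DWW))) (intN (DP_L1 DQ)).
rewrite (intZ _ (DP_L1 DWW)) (intD (DP_L1 DW1) (DP_L1 DW2)).
have : kap * del * (\int[(M1 \x M2)%E]_z (P z * W z.1.1) + \int[(M1 \x M2)%E]_z (P z * W z.2.1)) <= eps.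
  apply: le_trans hdel; rewrite [kap * del]mulrC -mulrA ler_wpM2l ?(ltW del0)// ler_wpM2l//.
  exact: lerD.
move=> h; rewrite mulr_natl mulr2n; apply: lerD h.
by rewrite lerNl.
Qed.

End negative_form.

Lemma error_bound (R : realType) (eps e c2 i a1 a2 a3 a4 q m1 m2 r1 r2 : R) :
  eps + c2 = e / 4 -> i <= a1 + a2 + a3 + a4 + q -> 1 - eps <= i ->
  a1 <= m1 -> a2 <= m2 -> a3 <= r1 -> a4 <= r2 -> q <= c2 ->
  r1 <= e / 4 -> r2 <= e / 4 -> 0 < e -> 1 - m1 <= m2 + e.
Proof. by lra. Qed.

Lemma int_le5 dT (T : measurableType dT) (R : realType) (M : {measure set T -> \bar R})
    (f f1 f2 f3 f4 f5 : T -> R) :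
  L1 M f -> L1 M f1 -> L1 M f2 -> L1 M f3 -> L1 M f4 -> L1 M f5 ->
  (forall x, f x <= f1 x + f2 x + f3 x + f4 x + f5 x) ->
  \int[M]_x f x <= \int[M]_x f1 x + \int[M]_x f2 x + \int[M]_x f3 x
    + \int[M]_x f4 x + \int[M]_x f5 x.
Proof.
move=> I I1 I2 I3 I4 I5 le5.
have I12 := L1D I1 I2; have I123 := L1D I12 I3; have I1234 := L1D I123 I4.
by rewrite -(intD I1 I2) -(intD I12 I3) -(intD I123 I4) -(intD I1234 I5);
  apply: int_le => //; exact: L1D.
Qed.

(** * Dissipation away from the diagonal *)

Section dissipation_lower_bound.
Variables (R : realType) (d d1 : nat).
Variables (S : 'rV[R]_d -> 'M[R]_(d, d1)) (b : 'rV[R]_d -> 'rV[R]_d).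
Hypothesis qneg : forall x y, x != y -> qfun S b x y < 0.

Lemma dissip_diag x : dissip S b x x = 0.
Proof.
rewrite /dissip qfunE big1 ?add0r => [|i _]; last by rewrite big1// => k _; rewrite subrr expr0n.
by rewrite big1 ?mulr0 ?oppr0// => i _; rewrite subrr mul0r.
Qed.

Lemma dissip_gt0 x y : x != y -> 0 < dissip S b x y.
Proof. by move=> xy; rewrite /dissip -mulrN mulr_gt0 ?k0_gt0// oppr_gt0 qneg. Qed.

Lemma dissip_ge0 x y : 0 <= dissip S b x y.
Proof. by have [->|/dissip_gt0/ltW//] := eqVneq x y; rewrite dissip_diag. Qed.

Definition rel_continuous (K : set 'rV[R]_d) (f : 'rV[R]_d -> R) :=
  forall x, K x -> f y @[y --> within K (nbhs x)] --> f x.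

(** Continuity holds only for the restrictions of the coefficients, so the minimum is taken in the
    subspace topology of the compact product; it is positive because the disjoint sets keep the
    minimizer off the diagonal. *)
Lemma dissip_lower_bound (K1 K2 : set 'rV[R]_d) : compact K1 -> compact K2 ->
  (forall x, K1 x -> ~ K2 x) ->
  (forall i k, rel_continuous K1 (fun x => S x i k)) ->
  (forall i k, rel_continuous K2 (fun x => S x i k)) ->
  (forall i, rel_continuous K1 (fun x => b x 0 i)) ->
  (forall i, rel_continuous K2 (fun x => b x 0 i)) ->
  exists2 c : R, 0 < c & forall x y, K1 x -> K2 y -> c <= dissip S b x y.
Proof.
move=> cK1 cK2 dK cS1 cS2 cb1 cb2.
have [[z0 K0]|nK] := pselect (exists z, (K1 `*` K2) z); last first.
  by exists 1 => // x y K1x K2y; exfalso; apply: nK; exists (x, y).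
have [|c cK hc] := @compact_EVT_min _ R (fun z => dissip S b z.1 z.2) (K1 `*` K2)
    (ex_intro _ z0 K0) (compact_setX cK1 cK2).
  apply/subspace_continuousP => z [K1z K2z].
  set F := within _ _.
  have fF : Filter F by apply: within_filter.
  have c1 f : rel_continuous K1 f -> f w.1 @[w --> F] --> f z.1.
    move=> cf; apply: cvg_trans (cf z.1 K1z); move=> P /= hP.
    have h : nbhs z [set w | K1 w.1 -> P (f w.1)].
      exists ([set x | K1 x -> P (f x)], setT); first by split=> //; exact: filterT.
      by move=> [u v] [].
    by apply: filterS h => w /= h [Kw _]; exact: h.
  have c2 f : rel_continuous K2 f -> f w.2 @[w --> F] --> f z.2.
    move=> cf; apply: cvg_trans (cf z.2 K2z); move=> P /= hP.
    have h : nbhs z [set w | K2 w.2 -> P (f w.2)].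
      exists (setT, [set x | K2 x -> P (f x)]); first by split=> //; exact: filterT.
      by move=> [u v] [].
    by apply: filterS h => w /= h [_ Kw]; exact: h.
  have co K i : rel_continuous K (fun x => x 0 i).
    move=> x _; apply: cvg_within_filter; exact: coord_continuous.
  pose dd i (w : 'rV[R]_d * 'rV[R]_d) : R := w.1 0 i - w.2 0 i.
  have cd i : dd i w @[w --> F] --> dd i z.
    by apply: cvgB; [exact: (c1 _ (co _ _))|exact: (c2 _ (co _ _))].
  pose h (w : 'rV[R]_d * 'rV[R]_d) := - ((1 + (\sum_i dd i w * dd i w) / 2)^-1 *
    (\sum_i \sum_k (S w.1 i k - S w.2 i k) * (S w.1 i k - S w.2 i k)
     + \sum_i (b w.1 0 i - b w.2 0 i) * dd i w)).
  have Eh : (fun w => dissip S b w.1 w.2) = h.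
    apply/funext => w; rewrite /dissip qfunE /h /k0 /kden /dotv /dd.
    under eq_bigr do rewrite !mxE.
    under [X in _ * (_ + X)]eq_bigr do rewrite !mxE.
    by under [X in _ * (X + _)]eq_bigr do under eq_bigr do rewrite expr2.
  rewrite Eh /h; apply: cvgN; apply: cvgM.
    apply: cvgV.
      rewrite gt_eqF// ltr_pwDl// divr_ge0//.
      by apply: sumr_ge0 => i _; rewrite -expr2 sqr_ge0.
    apply: cvgD; first exact: cvg_cst.
    apply: cvgM; last exact: cvg_cst.
    by apply: cvg_sumR => i; apply: cvgM; exact: cd.
  apply: cvgD; apply: cvg_sumR => i.
    by apply: cvg_sumR => k; apply: cvgM; apply: cvgB;
      [exact: (c1 _ (cS1 i k))|exact: (c2 _ (cS2 i k))|
       exact: (c1 _ (cS1 i k))|exact: (c2 _ (cS2 i k))].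
  apply: cvgM; last exact: cd.
  by apply: cvgB; [exact: (c1 _ (cb1 i))|exact: (c2 _ (cb2 i))].
exists (dissip S b c.1 c.2) => [|x y K1x K2y].
  move: cK; rewrite inE => -[K1c K2c]; apply: dissip_gt0.
  by apply/eqP => E; apply: (dK _ K1c); rewrite E.
by apply: (hc (x, y)); rewrite inE.
Qed.

(** One of five cases always holds: [x] is outside [A], [y] is inside [A], [x] lies in [A] but not
    in [K1], [y] lies outside [A] but not in [K2], or the pair is in [K1 x K2]. Each term is at
    least 1 in its case. *)
Lemma cover_le (A K1 K2 : set 'rV[R]_d) (c : R) x y : 0 < c ->
  (forall x y, K1 x -> K2 y -> c <= dissip S b x y) ->
  1 <= \1_(~` A) x + \1_A y + \1_(A `\` K1) x + \1_(~` A `\` K2) y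
    + c^-1 * dissip S b x y.
Proof.
move=> c0 hc.
have one (B : set 'rV[R]_d) u : B u -> \1_B u = 1 :> R by move=> Bu; rewrite indicE mem_set.
have i0 (B : set 'rV[R]_d) u : 0 <= \1_B u :> R by rewrite indicE; case: (_ \in _).
have q0 : 0 <= c^-1 * dissip S b x y.
  by rewrite mulr_ge0 ?invr_ge0 ?(ltW c0)//; exact: dissip_ge0.
have := i0 (~` A) x; have := i0 A y.
have := i0 (A `\` K1) x; have := i0 (~` A `\` K2) y.
have [Ax|nAx] := pselect (A x); last by have := one (~` A) x nAx; lra.
have [Ay|nAy] := pselect (A y); first by have := one A y Ay; lra.
have [Kx|nKx] := pselect (K1 x); last by have := one (A `\` K1) x (conj Ax nKx); lra.
have [Ky|nKy] := pselect (K2 y); last by have := one (~` A `\` K2) y (conj nAy nKy); lra.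
suff : 1 <= c^-1 * dissip S b x y by lra.
by rewrite -(@ler_pM2l _ c)// mulr1 mulVKf ?gt_eqF// hc.
Qed.

End dissipation_lower_bound.

(** * From near-couplings to comparison of measures *)

Section comparison.
Variables (R : realType) (d d1 : nat) (mu1 mu2 : probability (Rd R d) R).
Variables (S : 'rV[R]_d -> 'M[R]_(d, d1)) (b : 'rV[R]_d -> 'rV[R]_d).
Hypothesis mS : forall i k, measurable_fun setT (fun x : Rd R d => S x i k).
Hypothesis mb : forall i, measurable_fun setT (fun x : Rd R d => b x 0 i).
Hypothesis qneg : forall x y, x != y -> qfun S b x y < 0.
Context dT (T : measurableType dT) (PT : probability T R).
Let M1 : probability _ R := (mu1 \x PT)%E.
Let M2 : probability _ R := (mu2 \x PT)%E.
Let E := (Rd R d * T)%type.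

Hypothesis couple : forall eps : R, 0 < eps -> exists P : E * E -> R,
  [/\ measurable_fun setT P /\ bnd P, forall z, 0 <= P z,
      (forall x, \int[M2]_y P (x, y) <= 1) /\ (forall y, \int[M1]_x P (x, y) <= 1),
      1 - eps <= \int[(M1 \x M2)%E]_z P z &
      DP M1 M2 (fun z => P z * dissip S b z.1.1 z.2.1) /\
      \int[(M1 \x M2)%E]_z (P z * dissip S b z.1.1 z.2.1) <= 2 * eps].

Let ind (A : set (Rd R d)) (e : E) : R := \1_A e.1.

Let ind01 A e : 0 <= ind A e <= 1.
Proof. by rewrite /ind indicE; case: (_ \in _); rewrite ?lexx ler01. Qed.

Let ind_L1 (mu : probability (Rd R d) R) A : measurable A ->
  L1 (mu \x PT)%E (ind A) /\ \int[(mu \x PT)%E]_e ind A e = fine (mu A).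
Proof.
move=> mA.
have IA : L1 mu (\1_A : Rd R d -> R).
  apply: L1_bnd; first exact: measurable_indic.
  by exists 1 => x; rewrite indicE; case: (_ \in _); rewrite ?normr1 ?normr0.
have D := DP_1 PT IA; split; first exact: DP_L1.
rewrite (DP_fub1 D).2 -[RHS]/(fine (mu A)) -(setIT A) -(integral_indic mu measurableT mA).
by rewrite setIT; apply: eq_Rintegral => x _ /=; rewrite int_cst.
Qed.

(** [cover_le] is integrated against [P]. Domination of the marginals bounds each indicator term by
    a measure under [mu1] or [mu2], so [1 - eps <= mu1 (~A) + mu2 A] up to Lusin errors and the
    dissipation. *)
Lemma measure_comparison A : measurable A -> fine (mu1 A) <= fine (mu2 A).
Proof.
move=> mA; apply/ler_addgt0Pr => e e0.
have e40 : 0 < e / 4 by rewrite divr_gt0.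
pose J := ('I_d * 'I_d1 + 'I_d)%type.
pose g (j : J) : 'rV[R]_d -> R :=
  match j with inl ik => fun x => S x ik.1 ik.2 | inr i => fun x => b x 0 i end.
have mg j : measurable_fun setT (g j : Rd R d -> R).
  by case: j => [[i k]|i]; [exact: mS|exact: mb].
have mAC : measurable (~` A) by exact: measurableC.
have [K1 [cK1 K1A h1 g1]] := lusin_compact mu1 mg mA e40.
have [K2 [cK2 K2A h2 g2]] := lusin_compact mu2 mg mAC e40.
have [c c0 hc] : exists2 c : R, 0 < c & forall x y, K1 x -> K2 y -> c <= dissip S b x y.
  apply: dissip_lower_bound => //.
  - by move=> x /K1A Ax /K2A.
  - by move=> i k; exact: (g1 (inl (i, k))).
  - by move=> i k; exact: (g2 (inl (i, k))).
  - by move=> i; exact: (g1 (inr i)).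
  - by move=> i; exact: (g2 (inr i)).
have mK1 : measurable (K1 : set (Rd R d)).
  by apply: Rd_closed; apply: compact_closed => //; exact: norm_hausdorff.
have mK2 : measurable (K2 : set (Rd R d)).
  by apply: Rd_closed; apply: compact_closed => //; exact: norm_hausdorff.
(* Chosen so that the missing mass [eps] and the dissipation term [2 eps / c] together make [e / 4].
   It must follow the choice of [K1] and [K2], on which [c] depends. *)
pose eps := e / (4 * (1 + 2 / c)).
have d0 : 0 < 4 * (1 + 2 / c) by rewrite mulr_gt0// addr_gt0// divr_gt0.
have eps0 : 0 < eps by rewrite divr_gt0.
have [P [[mP bP] P0 [P1 P2] Pm [DQ hQ]]] := couple eps0.
pose A1 := A `\` K1; pose A2 := ~` A `\` K2.
have mA1 : measurable A1 by exact: measurableD.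
have mA2 : measurable A2 by exact: measurableD.
have [IA iA] := ind_L1 mu1 mAC; have [IB iB] := ind_L1 mu2 mA.
have [IA1 iA1] := ind_L1 mu1 mA1; have [IA2 iA2] := ind_L1 mu2 mA2.
have p0 B x : 0 <= ind B x by case/andP: (ind01 B x).
have [DA hA] := marginal1_le mP bP P1 IA (p0 _).
have [DB hB] := marginal2_le mP bP P2 IB (p0 _).
have [DA1 hA1] := marginal1_le mP bP P1 IA1 (p0 _).
have [DA2 hA2] := marginal2_le mP bP P2 IA2 (p0 _).
have DQc := DPZ c^-1 DQ.
have comp z : P z <= P z * ind (~` A) z.1 + P z * ind A z.2 + P z * ind A1 z.1
    + P z * ind A2 z.2 + c^-1 * (P z * dissip S b z.1.1 z.2.1).
  have h : 1 <= ind (~` A) z.1 + ind A z.2 + ind A1 z.1 + ind A2 z.2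
      + c^-1 * dissip S b z.1.1 z.2.1 by exact: cover_le c0 hc.
  have := ler_wpM2l (P0 z) h; rewrite mulr1 => /le_trans; apply.
  by rewrite !mulrDr mulrCA.
have DP0 : DP M1 M2 P by exact: DP_bnd.
have := int_le5 (DP_L1 DP0) (DP_L1 DA) (DP_L1 DB) (DP_L1 DA1) (DP_L1 DA2) (DP_L1 DQc) comp.
rewrite (intZ _ (DP_L1 DQ)) => key.
rewrite iA in hA; rewrite iB in hB; rewrite iA1 in hA1; rewrite iA2 in hA2.
have fle (mu : probability (Rd R d) R) B : measurable B -> (mu B <= (e / 4)%:E)%E ->
    fine (mu B) <= e / 4.
  by move=> mB h; rewrite -lee_fin fineK// fin_num_measure.
have comple : fine (mu1 (~` A)) = 1 - fine (mu1 A).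
  have := probability_setC mu1 mA => ->.
  by rewrite -[in LHS](fineK (fin_num_measure mu1 A mA)) -EFinB.
have hcQ : c^-1 * \int[(M1 \x M2)%E]_z (P z * dissip S b z.1.1 z.2.1) <= c^-1 * (2 * eps).
  by rewrite ler_pM2l ?invr_gt0.
have heps : eps + c^-1 * (2 * eps) = e / 4.
  by rewrite /eps; field; rewrite gt_eqF//= gt_eqF// addr_gt0.
rewrite -[fine (mu1 A)](subKr 1) -comple.
exact: (error_bound heps key Pm hA hB hA1 hA2 hcQ (fle mu1 A1 mA1 h1) (fle mu2 A2 mA2 h2) e0).
Qed.

End comparison.

Lemma measure_concentrated (R : realType) (d : nat) (mu : probability (Rd R d) R)
    (p : 'rV[R]_d) (A : set (Rd R d)) :
  mu (~` [set p] : set (Rd R d)) = 0%E -> measurable A -> mu A = (\1_A p)%:E.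
Proof.
move=> mup mA.
have null (B : set (Rd R d)) : measurable B -> ~ B p -> mu B = 0%E.
  move=> mB nBp; apply/eqP; rewrite eq_le measure_ge0 andbT -mup.
  apply: le_measure; rewrite ?inE//; first by apply: measurableC; exact: Rd_set1.
  by move=> x Bx xp; apply: nBp; rewrite -xp.
rewrite indicE; have [Ap|nAp] := pselect (A p); last by rewrite memNset// null.
have := null (~` A) (measurableC mA) (fun h => h Ap).
rewrite probability_setC// mem_set//= -(fineK (fin_num_measure mu A mA)) -EFinB.
by move=> [/eqP]; rewrite subr_eq0 => /eqP <-.
Qed.

Theorem theorem1 (R : realType) (d d1 : nat) (hd : (1 <= d)%N) (hd1 : (1 <= d1)%N)
  (Sigma : 'rV[R]_d -> 'M[R]_(d, d1)) (b : 'rV[R]_d -> 'rV[R]_d)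
  (hSigma : forall i j, measurable_fun [set: Rd R d] (fun x : Rd R d => Sigma x i j))
  (hb : forall i, measurable_fun [set: Rd R d] (fun x : Rd R d => b x 0 i))
  (hq : (forall x y, x != y -> 0 < qfun Sigma b x y) \/
        (forall x y, x != y -> qfun Sigma b x y < 0))
  (mu1 mu2 : probability (Rd R d) R) :
  prob_solution Sigma b mu1 ->
  (\int[mu1]_(x in [set: Rd R d])
      ((frob (Sigma x)) ^+ 2 + enorm (b x) * enorm (x : 'rV[R]_d))%:E < +oo)%E ->
  prob_solution Sigma b mu2 ->
  (\int[mu2]_(x in [set: Rd R d])
      ((frob (Sigma x)) ^+ 2 + enorm (b x) * enorm (x : 'rV[R]_d))%:E < +oo)%E ->
  forall A : set (Rd R d), measurable A -> mu1 A = mu2 A.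
Proof.
move=> sol1 fin1 sol2 fin2 A mA.
have [S1 S2] := (sol_S2 hSigma hb fin1, sol_S2 hSigma hb fin2).
have [b1 b2] := (sol_b hSigma hb sol1 fin1, sol_b hSigma hb sol2 fin2).
have [e1 e2] := (sol_eqn hSigma hb sol1 fin1, sol_eqn hSigma hb sol2 fin2).
case: hq => [qpos|qneg].
  have point (mu : probability (Rd R d) R) (sol : prob_solution Sigma b mu)
      (fin : (\int[mu]_(x in [set: Rd R d])
        ((frob (Sigma x)) ^+ 2 + enorm (b x) * enorm (x : 'rV[R]_d))%:E < +oo)%E) :
      exists p : 'rV[R]_d, [/\ mu (~` [set p] : set (Rd R d)) = 0%E, b p = 0 & Sigma p = 0].
    have IS := sol_S2 hSigma hb fin; have Ib := sol_b hSigma hb sol fin.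
    have Ibx := sol_bx hSigma hb fin; have eqn := sol_eqn hSigma hb sol fin.
    apply: (positive_form_point hSigma hb IS Ib Ibx _ _ qpos).
      exact: mean_drift hSigma hb IS Ib eqn.
    exact: energy_identity hSigma hb IS Ibx eqn.
  have [p [mup bp Sp]] := point mu1 sol1 fin1.
  have [p' [mup' bp' Sp']] := point mu2 sol2 fin2.
  have pp' : p = p'.
    apply/eqP; apply: contraT => /qpos.
    rewrite qfunE bp bp' Sp Sp' !big1 ?addr0 ?ltxx// => i _.
      by rewrite subrr mul0r.
    by rewrite big1// => k _; rewrite subrr expr0n.
  by rewrite (measure_concentrated mup mA) (measure_concentrated mup' mA) pp'.
have [dT [T [PT [Z [sc Hs]]]]] := smoother_exists R d.
have cmp := measure_comparison hSigma hb qneg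
  (near_coupling_dissip hSigma S1 S2 b1 b2 e1 e2 Hs).
(* The inequality for [A] and for its complement yields equality, since both measures have total
   mass 1. *)
have mAC : measurable (~` A) by exact: measurableC.
have := cmp A mA; have := cmp _ mAC.
rewrite !probability_setC//.
rewrite -(fineK (fin_num_measure mu1 A mA)) -(fineK (fin_num_measure mu2 A mA)) -!EFinB /=.
by rewrite lerD2l lerN2 => h1 h2; congr EFin; apply/eqP; rewrite eq_le h1 h2.
Qed.
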